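(* Let $\beta$ be the braid on the six points $K=\{0,1,-1,i,-i,2\}$ obtained by first performing a $180^\circ$ counterclockwise rotation of the points $1,-1,i,-i$ around $0$ (with $2$ fixed), and then letting the point $2$ perform a counterclockwise full-twist with the block consisting of all the other points (i.e. $2$ makes one full counterclockwise revolution along the circle $|y|=2$ with the other five points fixed); this $\beta$ is the local braid monodromy assigned to the singular point presented locally by $xy(y+x^2)(y-x^2)=0$. Then the induced relations are: $$\text{(1) } x_5x_4x_3x_2=x_2x_5x_4x_3,$$ $$\text{(2) } x_3x_5x_4x_3x_2x_5x_4=x_5x_4x_3x_2x_5x_4x_3=x_4x_3x_5x_4x_3x_2x_5,$$ $$\text{(3) } x_1=x_5x_4x_3x_4^{-1}x_5^{-1},\qquad \text{(4) } x_5=x_6,$$ where $\{x_1,\dots,x_6\}$ are the generators of the standard g-base.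
   Context: Let $D=\{y\in\mathbb{C}:|y|\le 4\}$ and $u_0=-4i$. A motion of a finite set in $D$ consists of continuous functions $m_i:[0,1]\to D$ with pairwise distinct values at each time, starting at the points of the set. It is realized by a continuous family of diffeomorphisms $D_t$ of $D$, $D_0=\mathrm{Id}$, equal to the identity on $\partial D$, with $D_t(m_i(0))=m_i(t)$; we say it induces $D_1$. If the motion ends at the same set $K$ it started from, the induced braid is the class of $D_1$ among diffeomorphisms of $D$ preserving $K$ and equal to the identity on $\partial D$, two being identified if they act in the same way on $\pi_1(D-K,u_0)$. Standard g-base for this fiber, which has two non-real points: in the model set of real points $p_1=-1,\ p_2=0,\ p_3=1,\ p_4=2,\ p_5=\frac52,\ p_6=\frac72$, let the $i$-th loop go from $u_0$ along the straight segment to near $p_i$, once counterclockwise around $p_i$ on a small circle, and back. Move the model set to $K$ as follows, keeping $p_1,\dots,p_4$ fixed: rotate $p_5,p_6$ by $90^\circ$ counterclockwise about their midpoint $3$ (so $p_5$ becomes the lower point $3-\frac i2$ and $p_6$ the upper point $3+\frac i2$), move them vertically to $3-i$ and $3+i$, and then horizontally to the left to $-i$ and $i$ respectively. The loops $x_1,\dots,x_6$ are the images of the six loops under the diffeomorphism induced by this motion. In a product of loops the left factor is traversed first. The group $\pi_1(D-K,u_0)$ is free on $x_1,\dots,x_6$. The relations induced by $\beta$ are $\beta(x_j)=x_j$, $j=1,\dots,6$. Saying that ''the induced relations are $R$'' means that $R$ and $\{\beta(x_j)=x_j\}_j$ have the same normal closure in the free group on $x_1,\dots,x_6$. *)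

(* Defs.v *)
From HB Require Import structures.
From mathcomp Require Import all_boot all_order all_algebra generic_quotient.
From mathcomp Require Import all_classical all_reals all_analysis.
From mathcomp Require Import ring lra.

Set Implicit Arguments.
Unset Strict Implicit.
Unset Printing Implicit Defensive.

Import Order.TTheory GRing.Theory Num.Theory.
Import numFieldNormedType.Exports.

Local Open Scope classical_set_scope.
Local Open Scope ring_scope.

Definition unit_itv {R : realType} : set R := `[0, 1].

Lemma unit_itvE (R : realType) (t : R) : unit_itv t = (0 <= t <= 1) :> Prop.
Proof. by rewrite /unit_itv set_itvE. Qed.

Lemma unit_itv0 (R : realType) : unit_itv (0 : R).
Proof. by rewrite unit_itvE lexx ler01. Qed.

Lemma unit_itv1 (R : realType) : unit_itv (1 : R).
Proof. by rewrite unit_itvE lexx ler01. Qed.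

#[local] Hint Resolve unit_itv0 unit_itv1 : core.

Lemma closed_unit_itv (R : realType) : closed (@unit_itv R).
Proof. exact: itv_closed. Qed.

Lemma closed_unit_square (R : realType) : closed (@unit_itv R `*` @unit_itv R).
Proof.
have -> : @unit_itv R `*` @unit_itv R = fst @^-1` unit_itv `&` snd @^-1` unit_itv.
  by apply/seteqP; split => -[].
apply: closedI; apply: preimage_closed; try exact: closed_unit_itv.
- by move=> x _; exact: cvg_fst.
- by move=> x _; exact: cvg_snd.
Qed.

Section within_continuity.

Lemma cts_pair (S T U : topologicalType) (f : S -> T) (g : S -> U) :
  continuous f -> continuous g -> continuous (fun x => (f x, g x)).
Proof. by move=> cf cg x; apply: cvg_pair; [exact: cf|exact: cg]. Qed.

Lemma within_comp (S T U : topologicalType) (A : set S) (B : set T)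
    (f : S -> T) (g : T -> U) :
  (forall x, A x -> B (f x)) -> {within A, continuous f} ->
  {within B, continuous g} -> {within A, continuous (fun x => g (f x))}.
Proof.
move=> fAB /subspace_continuousP cf /subspace_continuousP cg.
apply/subspace_continuousP => x Ax.
apply: (cvg_comp _ _ _ (cg _ (fAB _ Ax))) => V /= BV.
have := cf _ Ax _ BV; rewrite /nbhs/= /within/=.
by apply: filterS => y Vy Ay; apply: Vy => //; exact: fAB.
Qed.

Lemma within_pair (S T U : topologicalType) (A : set S) (f : S -> T) (g : S -> U) :
  {within A, continuous f} -> {within A, continuous g} ->
  {within A, continuous (fun x => (f x, g x))}.
Proof. by move=> cf cg x; apply: cvg_pair; [exact: cf | exact: cg]. Qed.

Lemma within_paste (R : realType) (S T : topologicalType) (A : set S)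
    (p : S -> R) (f g : S -> T) :
  closed A -> continuous p ->
  {within A `&` [set x | p x <= 2^-1], continuous f} ->
  {within A `&` [set x | 2^-1 <= p x], continuous g} ->
  (forall x, A x -> p x = 2^-1 -> f x = g x) ->
  {within A, continuous (fun x => if p x <= 2^-1 then f x else g x)}.
Proof.
move=> cA cp cf cg fg.
have -> : A = (A `&` [set x | p x <= 2^-1]) `|` (A `&` [set x | 2^-1 <= p x]).
  rewrite -setIUr; apply/seteqP; split => [x Ax|x []//]; split => //=.
  by case: (leP (p x) 2^-1) => [?|/ltW ?]; [left|right].
apply: withinU_continuous.
- apply: closedI => //.
  by apply: (@preimage_closed _ _ p [set x | x <= 2^-1]); [move=> x _; exact: cp|exact: closed_le].
- apply: closedI => //.
  by apply: (@preimage_closed _ _ p [set x | 2^-1 <= x]); [move=> x _; exact: cp|exact: closed_ge].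
- apply: subspace_eq_continuous cf => x; rewrite inE => -[_ px]; by rewrite /from_subspace/= ifT.
- apply: subspace_eq_continuous cg => x; rewrite inE => -[Ax px]; rewrite /from_subspace/=.
  case: ifPn => // p'x; rewrite fg//; apply/eqP; rewrite eq_le p'x//.
Qed.

End within_continuity.

Section loops.
Context (R : realType) (T : topologicalType) (X : set T) (u : T).

(* A loop in [X] based at [u]; its values outside [0, 1] are irrelevant, since
   [homotopic] only constrains them on [0, 1]. *)
Record loop := Loop {
  loop_fun :> R -> T;
  loop_continuous : {within unit_itv, continuous loop_fun};
  loop_in : forall t, unit_itv t -> X (loop_fun t);
  loop_start : loop_fun 0 = u;
  loop_end : loop_fun 1 = u }.

HB.instance Definition _ := gen_eqMixin loop.
HB.instance Definition _ := gen_choiceMixin loop.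

(* Homotopy in [X] relative to the base point; the first coordinate is the
   deformation parameter. *)
Definition homotopic (f g : loop) : Prop :=
  exists H : R * R -> T,
    [/\ {within unit_itv `*` unit_itv, continuous H},
        forall s t, unit_itv s -> unit_itv t -> X (H (s, t)),
        forall t, unit_itv t -> H (0, t) = f t /\ H (1, t) = g t &
        forall s, unit_itv s -> H (s, 0) = u /\ H (s, 1) = u].

Lemma homotopic_reparam (f g h : loop) (phi psi : R -> R) :
  continuous phi -> continuous psi ->
  (forall t, unit_itv t -> unit_itv (phi t) /\ unit_itv (psi t)) ->
  phi 0 = psi 0 -> phi 1 = psi 1 ->
  (forall t, unit_itv t -> g t = f (phi t)) ->
  (forall t, unit_itv t -> h t = f (psi t)) ->
  homotopic g h.
Proof.
move=> cphi cpsi II e0 e1 gE hE.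
pose k (x : R * R) := (1 - x.1) * phi x.2 + x.1 * psi x.2.
have kI s t : unit_itv s -> unit_itv t -> unit_itv (k (s, t)).
  move=> + /II []; rewrite !unit_itvE /k/= => /andP[s0 s1] /andP[p0 p1] /andP[q0 q1].
  apply/andP; split; nra.
exists (f \o k); split.
- apply: (within_comp (B := unit_itv) (f := k) (g := f)).
  + by move=> [s t] [/=]; exact: kI.
  + apply: continuous_subspaceT => x; rewrite /k.
    apply: cvgD; apply: cvgM.
    * by apply: cvgB; [exact: cvg_cst|exact: cvg_fst].
    * by apply: cvg_comp; [exact: cvg_snd|exact: cphi].
    * exact: cvg_fst.
    * by apply: cvg_comp; [exact: cvg_snd|exact: cpsi].
  + exact: loop_continuous.
- by move=> s t Is It; apply: loop_in; exact: kI.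
- move=> t It; rewrite /k/= gE// hE//; split; congr (f _); ring.
- move=> s _; rewrite /k/= -e0 -e1; split.
    by rewrite [X in f X](_ : _ = phi 0); [rewrite -gE// loop_start|ring].
  by rewrite [X in f X](_ : _ = phi 1); [rewrite -gE// loop_end|ring].
Qed.

Lemma homotopic_refl f : homotopic f f.
Proof.
by apply: (@homotopic_reparam f f f id id) => // t; exact: cvg_id.
Qed.

Lemma homotopic_sym f g : homotopic f g -> homotopic g f.
Proof.
move=> [H [cH HX Hfg H01]].
have CI (s : R) : unit_itv s -> unit_itv (1 - s).
  by rewrite !unit_itvE => /andP[? ?]; apply/andP; split; lra.
exists (fun x => H (1 - x.1, x.2)); split => /=.
- apply: (within_comp (B := unit_itv `*` unit_itv)
    (f := fun x : R * R => (1 - x.1, x.2)) (g := H)) => //.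
  + by move=> [s t] [/= /CI].
  + apply: continuous_subspaceT; apply: cts_pair; last by move=> x; exact: cvg_snd.
    by move=> x; apply: cvgB; [exact: cvg_cst|exact: cvg_fst].
- by move=> s t Is It; apply: HX => //; exact: CI.
- by move=> t It; rewrite subr0 subrr; have [] := Hfg _ It.
- by move=> s Is; apply: H01; exact: CI.
Qed.

Lemma half_lo (t : R) : unit_itv t -> t <= 2^-1 -> unit_itv (2 * t).
Proof. by rewrite !unit_itvE => /andP[? ?] ?; apply/andP; split; lra. Qed.
Lemma half_hi (t : R) : unit_itv t -> 2^-1 <= t -> unit_itv (2 * t - 1).
Proof. by rewrite !unit_itvE => /andP[? ?] ?; apply/andP; split; lra. Qed.

Lemma homotopic_trans f g h : homotopic f g -> homotopic g h -> homotopic f h.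
Proof.
move=> [H [cH HX Hfg H01]] [K [cK KX Kgh K01]].
exists (fun x => if x.1 <= 2^-1 then H (2 * x.1, x.2) else K (2 * x.1 - 1, x.2)).
split => /=.
- apply: within_paste.
  + exact: closed_unit_square.
  + by move=> x; exact: cvg_fst.
  + apply: (within_comp (B := unit_itv `*` unit_itv)
      (f := fun x : R * R => (2 * x.1, x.2)) (g := H)) => //.
      by move=> [s t] [[/= Is It] s2]; split => //=; exact: half_lo.
    apply: continuous_subspaceT; apply: cts_pair; last by move=> x; exact: cvg_snd.
    by move=> x; apply: cvgM; [exact: cvg_cst|exact: cvg_fst].
  + apply: (within_comp (B := unit_itv `*` unit_itv)
      (f := fun x : R * R => (2 * x.1 - 1, x.2)) (g := K)) => //.
      by move=> [s t] [[/= Is It] s2]; split => //=; exact: half_hi.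
    apply: continuous_subspaceT; apply: cts_pair; last by move=> x; exact: cvg_snd.
    move=> x; apply: cvgB; last exact: cvg_cst.
    by apply: cvgM; [exact: cvg_cst|exact: cvg_fst].
  + move=> [s t] [/= Is It] ->; rewrite divff// subrr.
    by have [_ ->] := Hfg _ It; have [-> _] := Kgh _ It.
- move=> s t Is It; case: (leP s 2^-1) => [s2|/ltW s2].
    by apply: HX => //; exact: half_lo.
  by apply: KX => //; exact: half_hi.
- move=> t It; rewrite invr_ge0 ler0n mulr0; split; first by have [] := Hfg _ It.
  rewrite ifF; last by apply/negbTE; rewrite -ltNge; lra.
  rewrite (_ : 2 * 1 - 1 = 1); last by ring.
  by have [] := Kgh _ It.
- move=> s Is; case: (leP s 2^-1) => [s2|/ltW s2].
    by apply: H01; exact: half_lo.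
  by apply: K01; exact: half_hi.
Qed.

Lemma const_loop_cts : {within unit_itv, continuous (fun _ : R => u)}.
Proof. by apply: continuous_subspaceT => x; exact: cvg_cst. Qed.

Definition const_loop (Xu : X u) : loop :=
  @Loop (fun=> u) const_loop_cts (fun _ _ => Xu) erefl erefl.

Lemma rev_itv (t : R) : unit_itv t -> unit_itv (1 - t).
Proof. by rewrite !unit_itvE => /andP[? ?]; apply/andP; split; lra. Qed.

Section rev_loop.
Variable f : loop.
Let h (t : R) := f (1 - t).

Lemma rev_cts : {within unit_itv, continuous h}.
Proof.
apply: (within_comp (f := fun t : R => 1 - t) (B := unit_itv)).
- by move=> t; exact: rev_itv.
- by apply: continuous_subspaceT => x; apply: cvgB; [exact: cvg_cst|exact: cvg_id].
- exact: loop_continuous.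
Qed.

Lemma rev_in t : unit_itv t -> X (h t).
Proof. by move=> It; apply: loop_in; exact: rev_itv. Qed.

Lemma rev_start : h 0 = u. Proof. by rewrite /h subr0 loop_end. Qed.
Lemma rev_end : h 1 = u. Proof. by rewrite /h subrr loop_start. Qed.

Definition rev_loop : loop := Loop rev_cts rev_in rev_start rev_end.

End rev_loop.

Section cat_loop.
Variables f g : loop.
Let h (t : R) := if t <= 2^-1 then f (2 * t) else g (2 * t - 1).

Lemma cat_cts : {within unit_itv, continuous h}.
Proof.
apply: within_paste.
- exact: closed_unit_itv.
- by move=> x; exact: cvg_id.
- apply: (within_comp (f := fun t : R => 2 * t) (B := unit_itv)).
  + by move=> t [/half_lo]; apply.
  + by apply: continuous_subspaceT => x; apply: cvgM; [exact: cvg_cst|exact: cvg_id].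
  + exact: loop_continuous.
- apply: (within_comp (f := fun t : R => 2 * t - 1) (B := unit_itv)).
  + by move=> t [/half_hi]; apply.
  + apply: continuous_subspaceT => x; apply: cvgB; last exact: cvg_cst.
    by apply: cvgM; [exact: cvg_cst|exact: cvg_id].
  + exact: loop_continuous.
- by move=> t _ ->; rewrite divff// subrr loop_end loop_start.
Qed.

Lemma cat_in t : unit_itv t -> X (h t).
Proof.
rewrite /h => It; case: (leP t 2^-1) => [t2|/ltW t2].
  by apply: loop_in; exact: half_lo.
by apply: loop_in; exact: half_hi.
Qed.

Lemma cat_start : h 0 = u.
Proof. by rewrite /h invr_ge0 ler0n mulr0 loop_start. Qed.

Lemma cat_end : h 1 = u.
Proof.
rewrite /h ifF; last by apply/negbTE; rewrite -ltNge; lra.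
by rewrite (_ : 2 * 1 - 1 = 1) ?loop_end//; ring.
Qed.

Definition cat_loop : loop := Loop cat_cts cat_in cat_start cat_end.

End cat_loop.

Lemma homotopic_cat f f' g g' :
  homotopic f f' -> homotopic g g' -> homotopic (cat_loop f g) (cat_loop f' g').
Proof.
move=> [H [cH HX Hf H01]] [K [cK KX Kg K01]].
exists (fun x => if x.2 <= 2^-1 then H (x.1, 2 * x.2) else K (x.1, 2 * x.2 - 1)).
split => /=.
- apply: within_paste.
  + exact: closed_unit_square.
  + by move=> x; exact: cvg_snd.
  + apply: (within_comp (B := unit_itv `*` unit_itv)
      (f := fun x : R * R => (x.1, 2 * x.2)) (g := H)) => //.
      by move=> [s t] [[/= Is It] s2]; split => //=; exact: half_lo.
    apply: continuous_subspaceT; apply: cts_pair; first by move=> x; exact: cvg_fst.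
    by move=> x; apply: cvgM; [exact: cvg_cst|exact: cvg_snd].
  + apply: (within_comp (B := unit_itv `*` unit_itv)
      (f := fun x : R * R => (x.1, 2 * x.2 - 1)) (g := K)) => //.
      by move=> [s t] [[/= Is It] s2]; split => //=; exact: half_hi.
    apply: continuous_subspaceT; apply: cts_pair; first by move=> x; exact: cvg_fst.
    move=> x; apply: cvgB; last exact: cvg_cst.
    by apply: cvgM; [exact: cvg_cst|exact: cvg_snd].
  + move=> [s t] [/= Is It] ->; rewrite divff// subrr.
    by have [_ ->] := H01 _ Is; have [-> _] := K01 _ Is.
- move=> s t Is It; case: (leP t 2^-1) => [s2|/ltW s2].
    by apply: HX => //; exact: half_lo.
  by apply: KX => //; exact: half_hi.
- move=> t It; case: (leP t 2^-1) => [s2|/ltW s2].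
    by apply: Hf; exact: half_lo.
  by apply: Kg; exact: half_hi.
- move=> s Is; rewrite invr_ge0 ler0n mulr0.
  rewrite [X in _ /\ X = _]ifF; last by apply/negbTE; rewrite -ltNge; lra.
  rewrite (_ : 2 * 1 - 1 = 1); last by ring.
  by have [-> _] := H01 _ Is; have [_ ->] := K01 _ Is.
Qed.

Lemma homotopic_rev f g : homotopic f g -> homotopic (rev_loop f) (rev_loop g).
Proof.
move=> [H [cH HX Hfg H01]].
exists (fun x => H (x.1, 1 - x.2)); split => /=.
- apply: (within_comp (B := unit_itv `*` unit_itv)
    (f := fun x : R * R => (x.1, 1 - x.2)) (g := H)) => //.
  + by move=> [s t] [/= ? /rev_itv].
  + apply: continuous_subspaceT; apply: cts_pair; first by move=> x; exact: cvg_fst.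
    by move=> x; apply: cvgB; [exact: cvg_cst|exact: cvg_snd].
- by move=> s t Is It; apply: HX => //; exact: rev_itv.
- by move=> t /rev_itv; exact: Hfg.
- by move=> s Is; rewrite subr0 subrr; have [] := H01 _ Is.
Qed.

End loops.

Section loop_laws.
Context (R : realType) (T : topologicalType) (X : set T) (u : T).
Implicit Types f g h : loop R X u.

Lemma cts_affine (a b : R) : continuous (fun t : R => a * t + b).
Proof.
by move=> x; apply: cvgD; [apply: cvgM; [exact: cvg_cst|exact: cvg_id]|exact: cvg_cst].
Qed.

Lemma cts_min (a b : R -> R) : continuous a -> continuous b ->
  continuous (fun t => Num.min (a t) (b t)).
Proof. by move=> ca cb x; apply: continuous_min; [exact: ca|exact: cb]. Qed.

Lemma cts_max (a b : R -> R) : continuous a -> continuous b ->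
  continuous (fun t => Num.max (a t) (b t)).
Proof. by move=> ca cb x; apply: continuous_max; [exact: ca|exact: cb]. Qed.

Lemma cat_loopA f g h :
  homotopic (cat_loop f (cat_loop g h)) (cat_loop (cat_loop f g) h).
Proof.
pose phi (t : R) := Num.min (2 * t + 0) (Num.min (1 * t + 4^-1) (2^-1 * t + 2^-1)).
apply: (@homotopic_reparam _ _ _ _ (cat_loop f (cat_loop g h)) _ _ id phi) => //.
- by move=> x; exact: cvg_id.
- by apply: cts_min; [exact: cts_affine|apply: cts_min; exact: cts_affine].
- move=> t It; split => //; move: It; rewrite !unit_itvE => /andP[t0 t1].
  rewrite /phi !le_min !ge_min; apply/andP; split.
    by apply/and3P; split; lra.
  by rewrite orbC orbC; apply/orP; right; apply/orP; right; lra.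
- by rewrite /phi (min_idPl _); [ring|rewrite le_min; apply/andP; split; lra].
- rewrite /phi (min_idPr _); last by rewrite ge_min; apply/orP; left; lra.
  by rewrite (min_idPr _); lra.
- move=> t; rewrite unit_itvE => /andP[t0 t1]; rewrite /= /phi.
  have [t2|t2] := leP t 2^-1.
  + have [t4|t4] := leP (2 * t) 2^-1.
      rewrite (min_idPl _); last by rewrite le_min; apply/andP; split; lra.
      by rewrite ifT; [congr (f _); ring|lra].
    rewrite (min_idPr _); last by rewrite ge_min; apply/orP; left; lra.
    rewrite (min_idPl _); last by lra.
    rewrite ifF; last by apply/negbTE; rewrite -ltNge; lra.
    rewrite ifT; last by lra.
    by congr (g _); lra.
  + rewrite (min_idPr _); last by rewrite ge_min; apply/orP; left; lra.
    rewrite (min_idPr _); last by lra.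
    rewrite ifF; last by apply/negbTE; rewrite -ltNge; lra.
    rewrite ifF; last by apply/negbTE; rewrite -ltNge; lra.
    by congr (h _); lra.
Qed.

Lemma cat_loop1 (Xu : X u) f : homotopic (cat_loop f (const_loop R Xu)) f.
Proof.
pose phi (t : R) := Num.min (2 * t + 0) (0 * t + 1).
apply: (@homotopic_reparam _ _ _ _ f _ _ phi id) => //.
- by apply: cts_min; exact: cts_affine.
- by move=> x; exact: cvg_id.
- move=> t It; split => //; move: It; rewrite !unit_itvE => /andP[t0 t1].
  by rewrite /phi le_min ge_min; apply/andP; split; [apply/andP; split|apply/orP; right]; lra.
- by rewrite /phi; case: leP => //; lra.
- by rewrite /phi; case: leP => //; lra.
- move=> t; rewrite unit_itvE => /andP[t0 t1]; rewrite /= /phi.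
  have [t2|t2] := leP t 2^-1.
    by rewrite (min_idPl _); [congr (f _); ring|lra].
  by rewrite (min_idPr _); [rewrite mul0r add0r loop_end|lra].
Qed.

Lemma cat_1loop (Xu : X u) f : homotopic (cat_loop (const_loop R Xu) f) f.
Proof.
pose phi (t : R) := Num.max (0 * t + 0) (2 * t + (- 1)).
apply: (@homotopic_reparam _ _ _ _ f _ _ phi id) => //.
- by apply: cts_max; exact: cts_affine.
- by move=> x; exact: cvg_id.
- move=> t It; split => //; move: It; rewrite !unit_itvE => /andP[t0 t1].
  by rewrite /phi ge_max le_max; apply/andP; split; [apply/orP; left|apply/andP; split]; lra.
- by rewrite /phi; case: leP => //; lra.
- by rewrite /phi; case: leP => //; lra.
- move=> t; rewrite unit_itvE => /andP[t0 t1]; rewrite /= /phi.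
  have [t2|t2] := leP t 2^-1.
    by rewrite (max_idPl _); [rewrite mul0r add0r loop_start|lra].
  by rewrite (max_idPr _)//; lra.
Qed.

Lemma cat_loopV (Xu : X u) f : homotopic (cat_loop f (rev_loop f)) (const_loop R Xu).
Proof.
pose phi (t : R) := Num.min (2 * t + 0) ((- 2) * t + 2).
apply: (@homotopic_reparam _ _ _ _ f _ _ phi (fun=> 0)) => //.
- by apply: cts_min; exact: cts_affine.
- by move=> x; exact: cvg_cst.
- move=> t; rewrite !unit_itvE => /andP[t0 t1]; split; last by rewrite lexx ler01.
  by rewrite /phi; case: (leP (2 * t + 0)) => ?; apply/andP; split; lra.
- by rewrite /phi; case: leP => //; lra.
- by rewrite /phi; case: leP => //; lra.
- move=> t; rewrite unit_itvE => /andP[t0 t1]; rewrite /= /phi.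
  have [t2|t2] := leP t 2^-1.
    by rewrite (min_idPl _); [congr (f _); ring|lra].
  by rewrite (min_idPr _); [congr (f _); ring|lra].
- by move=> t _; rewrite /= loop_start.
Qed.

Lemma cat_Vloop (Xu : X u) f : homotopic (cat_loop (rev_loop f) f) (const_loop R Xu).
Proof.
pose phi (t : R) := Num.max ((- 2) * t + 1) (2 * t + (- 1)).
apply: (@homotopic_reparam _ _ _ _ f _ _ phi (fun=> 1)) => //.
- by apply: cts_max; exact: cts_affine.
- by move=> x; exact: cvg_cst.
- move=> t; rewrite !unit_itvE => /andP[t0 t1]; split; last by rewrite lexx ler01.
  by rewrite /phi; case: (leP ((- 2) * t + 1)) => ?; apply/andP; split; lra.
- by rewrite /phi; case: leP => //; lra.
- by rewrite /phi; case: leP => //; lra.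
- move=> t; rewrite unit_itvE => /andP[t0 t1]; rewrite /= /phi.
  have [t2|t2] := leP t 2^-1.
    by rewrite (max_idPl _); [congr (f _); ring|lra].
  by rewrite (max_idPr _)//; lra.
- by move=> t _; rewrite /= loop_end.
Qed.

End loop_laws.

Local Open Scope quotient_scope.

Record pointed_set (T : Type) := PointedSet {
  pt_carrier :> set T;
  pt_base : T;
  pt_base_in : pt_carrier pt_base }.

Section fundamental_group.
Context (R : realType) (T : topologicalType) (X : pointed_set T).

Definition ploop := loop R X (pt_base X).

HB.instance Definition _ := Choice.on ploop.

Definition homotopicb (f g : ploop) : bool := `[< homotopic f g >].

Lemma homotopicb_refl : reflexive homotopicb.
Proof. by move=> f; apply/asboolP; exact: homotopic_refl. Qed.

Lemma homotopicb_sym : symmetric homotopicb.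
Proof. by move=> f g; apply/asboolP/asboolP; exact: homotopic_sym. Qed.

Lemma homotopicb_trans : transitive homotopicb.
Proof.
by move=> g f h /asboolP fg /asboolP gh; apply/asboolP; exact: homotopic_trans gh.
Qed.

Canonical homotopic_equiv :=
  EquivRel homotopicb homotopicb_refl homotopicb_sym homotopicb_trans.

Definition pi1 : Type := {eq_quot homotopicb}.

HB.instance Definition _ := Choice.on pi1.
HB.instance Definition _ := EqQuotient.on pi1.

Definition loop_class (f : ploop) : pi1 := \pi_pi1 f.

Lemma loop_classP f g : loop_class f = loop_class g <-> homotopic f g.
Proof.
split=> [/eqP|fg]; first by rewrite /loop_class eqmodE => /asboolP.
by apply/eqP; rewrite /loop_class eqmodE; apply/asboolP.
Qed.

Lemma loop_class_repr (a : pi1) : loop_class (repr a) = a.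
Proof. exact: reprK. Qed.

Definition pi1_one : pi1 := loop_class (const_loop R (pt_base_in X)).
Definition pi1_mul (a b : pi1) : pi1 := loop_class (cat_loop (repr a) (repr b)).
Definition pi1_inv (a : pi1) : pi1 := loop_class (rev_loop (repr a)).

Lemma pi1_mulE f g :
  pi1_mul (loop_class f) (loop_class g) = loop_class (cat_loop f g).
Proof.
by apply/loop_classP; apply: homotopic_cat; apply/loop_classP; exact: loop_class_repr.
Qed.

Lemma pi1_invE f : pi1_inv (loop_class f) = loop_class (rev_loop f).
Proof.
by apply/loop_classP; apply: homotopic_rev; apply/loop_classP; exact: loop_class_repr.
Qed.

Lemma pi1_mulA : associative pi1_mul.
Proof.
move=> a b c; rewrite -[a]loop_class_repr -[b]loop_class_repr -[c]loop_class_repr.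
by rewrite !pi1_mulE; apply/loop_classP; exact: cat_loopA.
Qed.

Lemma pi1_1mul : left_id pi1_one pi1_mul.
Proof.
move=> a; rewrite -[a]loop_class_repr pi1_mulE.
by apply/loop_classP; exact: cat_1loop.
Qed.

Lemma pi1_mul1 : right_id pi1_one pi1_mul.
Proof.
move=> a; rewrite -[a]loop_class_repr pi1_mulE.
by apply/loop_classP; exact: cat_loop1.
Qed.

Lemma pi1_Vmul : left_inverse pi1_one pi1_inv pi1_mul.
Proof.
move=> a; rewrite -[a]loop_class_repr pi1_invE pi1_mulE.
by apply/loop_classP; exact: cat_Vloop.
Qed.

Lemma pi1_mulV : right_inverse pi1_one pi1_inv pi1_mul.
Proof.
move=> a; rewrite -[a]loop_class_repr pi1_invE pi1_mulE.
by apply/loop_classP; exact: cat_loopV.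
Qed.

HB.instance Definition _ := isGroup.Build pi1
  pi1_mulA pi1_1mul pi1_mul1 pi1_Vmul pi1_mulV.

End fundamental_group.

Section pointed_maps.
Context (R : realType) (T U : topologicalType).
Context (X : pointed_set T) (Y : pointed_set U).

Record pointed_map := PointedMap {
  pm_fun :> T -> U;
  pm_continuous : {within X, continuous pm_fun};
  pm_in : forall x, (X : set T) x -> (Y : set U) (pm_fun x);
  pm_base : pm_fun (pt_base X) = pt_base Y }.

Variable F : pointed_map.

Lemma push_continuous (f : ploop R X) :
  {within unit_itv, continuous (fun t : R => F (f t))}.
Proof.
apply: (within_comp (B := X)) (@pm_continuous F) => //.
  exact: loop_in.
exact: loop_continuous.
Qed.

Lemma push_in (f : ploop R X) t : unit_itv t -> (Y : set U) (F (f t)).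
Proof. by move=> It; apply: pm_in; exact: loop_in. Qed.

Lemma push_start (f : ploop R X) : F (f 0) = pt_base Y.
Proof. by rewrite loop_start pm_base. Qed.

Lemma push_end (f : ploop R X) : F (f 1) = pt_base Y.
Proof. by rewrite loop_end pm_base. Qed.

Definition push_loop (f : ploop R X) : ploop R Y :=
  Loop (@push_continuous f) (@push_in f) (push_start f) (push_end f).

Lemma homotopic_push (f g : ploop R X) :
  homotopic f g -> homotopic (push_loop f) (push_loop g).
Proof.
move=> [H [cH HX Hfg H01]]; exists (fun x => F (H x)); split.
- apply: (within_comp (B := X)) (@pm_continuous F) => //.
  by move=> [s t] [/= Is It]; exact: HX.
- by move=> s t Is It; apply: pm_in; exact: HX.
- by move=> t It; rewrite /=; have [-> ->] := Hfg _ It.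
- by move=> s Is; have [-> ->] := H01 _ Is; rewrite pm_base.
Qed.

Definition pi1_map (a : pi1 R X) : pi1 R Y := loop_class (push_loop (repr a)).

Lemma pi1_mapE (f : ploop R X) : pi1_map (loop_class f) = loop_class (push_loop f).
Proof.
by apply/loop_classP; apply: homotopic_push; apply/loop_classP; exact: loop_class_repr.
Qed.

End pointed_maps.

Section normal_closure.
Local Open Scope group_scope.
Variable G : groupType.

Definition normal_subgroup (N : set G) : Prop :=
  [/\ N 1, forall a b, N a -> N b -> N (a * b), forall a, N a -> N a^-1 &
      forall a g, N a -> N (g^-1 * a * g)].

(* A pair [(u, v)] stands for the relation [u = v], i.e. for the relator
   [u * v^-1]. *)
Definition normal_closure (S : set (G * G)) : set G :=
  smallest normal_subgroup [set r.1 * r.2^-1 | r in S].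

End normal_closure.

(* [f] is of class C^n on the open set [U]: all its iterated directional
   derivatives up to order [n] exist and are continuous on [U]. *)
Fixpoint Cn (R : realType) (V W : normedModType R) (n : nat) (U : set V)
    (f : V -> W) : Prop :=
  if n is m.+1 then
    (forall x, U x -> differentiable f x) /\ (forall v, Cn m U ('D_v f))
  else forall x, U x -> {for x, continuous f}.

(* [A] need not be open: [f] is smooth on [A] if it agrees on [A] with a map that
   is C^oo on a neighbourhood of [A]. *)
Definition smooth_on (R : realType) (V W : normedModType R) (A : set V)
    (f : V -> W) : Prop :=
  exists U g, [/\ open U, A `<=` U, forall x, A x -> g x = f x &
                  forall n, Cn n U g].

Definition diffeomorphism_of (R : realType) (V : normedModType R) (A : set V)
    (f : V -> V) : Prop :=
  exists g : V -> V,
    [/\ forall x, A x -> A (f x) /\ g (f x) = x,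
        forall y, A y -> A (g y) /\ f (g y) = y,
        smooth_on A f & smooth_on A g].

Section plane.
Variable R : realType.

Local Notation C := (R * R)%type.

(* The complex number a + ib is the pair (a, b) of [C]; [normsq y] is |y|^2. *)
Definition normsq (y : C) : R := y.1 ^+ 2 + y.2 ^+ 2.

Definition disk : set C := [set y | normsq y <= 4 ^+ 2].
Definition circle : set C := [set y | normsq y = 4 ^+ 2].

Definition u0 : C := (0, - 4).

Lemma circle_disk y : circle y -> disk y.
Proof. by rewrite /circle /disk /= => ->. Qed.

Lemma circle_u0 : circle u0.
Proof. by rewrite /circle /normsq/=; ring. Qed.

(* Finite subsets of the disk that avoid the base point u0 = -4i. *)
Record config := Config {
  cfg_set :> set C;
  cfg_finite : finite_set cfg_set;
  cfg_disk : cfg_set `<=` disk;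
  cfg_base : ~ cfg_set u0 }.

Lemma punctured_base (K : config) : (disk `\` K) u0.
Proof. by split; [exact/circle_disk/circle_u0|exact: cfg_base]. Qed.

Definition punctured (K : config) : pointed_set C :=
  PointedSet (punctured_base K).

Record motion (n : nat) (K K' : config) := Motion {
  mo_fun :> 'I_n -> R -> C;
  mo_continuous : forall i, {within unit_itv, continuous (mo_fun i)};
  mo_disk : forall i t, unit_itv t -> disk (mo_fun i t);
  mo_inj : forall t, unit_itv t -> injective (mo_fun^~ t);
  mo_start : range (mo_fun^~ 0) = K;
  mo_end : range (mo_fun^~ 1) = K' }.

(* "Continuous family" is read as joint continuity of (t, y) |-> D_t(y) on
   [0, 1] x D. *)
Record realization (n : nat) (K K' : config) (m : motion n K K') := Realization {
  rz_fun :> R -> C -> C;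
  rz_diffeo : forall t, unit_itv t -> diffeomorphism_of disk (rz_fun t);
  rz_continuous :
    {within unit_itv `*` disk, continuous (fun p : R * C => rz_fun p.1 p.2)};
  rz_start : forall y, disk y -> rz_fun 0 y = y;
  rz_boundary : forall t y, unit_itv t -> circle y -> rz_fun t y = y;
  rz_move : forall t i, unit_itv t -> rz_fun t (m i 0) = m i t }.

Section induced_diffeo.
Variables (n : nat) (K K' : config) (m : motion n K K') (D : realization m).

Lemma induced_continuous : {within punctured K, continuous (D 1)}.
Proof.
apply: (within_comp (f := fun y : C => (1 : R, y)) (B := unit_itv `*` disk))
  (@rz_continuous _ _ _ _ D).
- by move=> y [].
- by apply: continuous_subspaceT; apply: cts_pair => x; [exact: cvg_cst|exact: cvg_id].
Qed.

Lemma induced_in y : (disk `\` K) y -> (disk `\` K') (D 1 y).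
Proof.
move=> [Dy Ky]; have [g [fg gf _ _]] := rz_diffeo D (unit_itv1 R).
split; first by have [] := fg _ Dy.
rewrite -(mo_end m) => -[i _ /= mi]; apply: Ky; rewrite -(mo_start m).
exists i => //=; have m0 := mo_disk m i (unit_itv0 R).
have [_ <-] := fg _ Dy; rewrite -mi -(rz_move D i (unit_itv1 R)).
by have [_ ->] := fg _ m0.
Qed.

Definition induced_diffeo : pointed_map (punctured K) (punctured K') :=
  @PointedMap _ _ (punctured K) (punctured K') (D 1) induced_continuous induced_in
    (rz_boundary D (unit_itv1 R) circle_u0).

End induced_diffeo.

(* Multiplication by e^(ia). *)
Definition rot (a : R) (y : C) : C :=
  (cos a * y.1 - sin a * y.2, sin a * y.1 + cos a * y.2).

(* Cut [0, 1] into [n] equal consecutive intervals: [stage k n t] is the fraction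
   of interval number [k] (counted from 0) that is over at time [t]. *)
Definition stage (k n : nat) (t : R) : R := Num.max 0 (Num.min 1 (n%:R * t - k%:R)).

Definition model_seq : seq C :=
  [:: (- 1, 0); (0, 0); (1, 0); (2, 0); (5 / 2, 0); (7 / 2, 0)].

Definition model_point (i : 'I_6) : C := nth u0 model_seq i.

(* Stage 0: straight from u0 to p + (u0 - p) / 20; stage 1: once counterclockwise
   around [p] on the circle of radius |u0 - p| / 20, smaller than 3/10
   for every model point, while these are at least 1/2 apart; stage 2: straight
   back. *)
Definition lasso (p : C) (t : R) : C :=
  p + (1 - 19 / 20 * (stage 0 3 t - stage 2 3 t))
        *: rot (2 * pi * stage 1 3 t) (u0 - p).

(* [c] is the midpoint of the last two points and [d] half their difference.
   Stage 0 turns [d] from 1/2 to i/2, stage 1 stretches it to [i], and stage 2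
   moves [c] from 3 to 0. *)
Definition gbase_fun (i : 'I_6) (t : R) : C :=
  let c := (3 * (1 - stage 2 3 t), 0) in
  let d := rot (pi / 2 * stage 0 3 t) ((1 + stage 1 3 t) / 2, 0) in
  nth u0 [:: (- 1, 0); (0, 0); (1, 0); (2, 0); c - d; c + d] i.

(* The set K, in the order of the end points of [gbase_fun]. *)
Definition beta_seq : seq C :=
  [:: (- 1, 0); (0, 0); (1, 0); (2, 0); (0, - 1); (0, 1)].

(* First half: the rotation by 180 degrees of 1, -1, i, -i (which fixes 0); second
   half: the full turn of the point 2, which has index 3 in [beta_seq]. *)
Definition beta_fun (i : 'I_6) (t : R) : C :=
  let a := if i == 3 :> nat then 2 * pi * stage 1 2 t else pi * stage 0 2 t in
  rot a (nth u0 beta_seq i).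

End plane.

Section plane_lemmas.
Variable R : realType.

Local Notation C := (R * R)%type.

Lemma rot0 (y : C) : rot 0 y = y.
Proof. by case: y => a b; rewrite /rot cos0 sin0 /=; congr pair; ring. Qed.

Lemma rot_pi (y : C) : rot pi y = (- y.1, - y.2).
Proof. by case: y => a b; rewrite /rot cospi sinpi /=; congr pair; ring. Qed.

Lemma rot_2pi (y : C) : rot (2 * pi) y = y.
Proof.
by case: y => a b; rewrite /rot mulr_natl cos2pi sin2pi /=; congr pair; ring.
Qed.

Lemma rot_pihalf (y : C) : rot (pi / 2) y = (- y.2, y.1).
Proof.
by case: y => a b; rewrite /rot cos_pihalf sin_pihalf /=; congr pair; ring.
Qed.

Lemma normsq_rot a (y : C) : normsq (rot a y) = normsq y.
Proof.
rewrite /normsq/=; have := cos2Dsin2 a; set c := cos a; set s := sin a => cs.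
by rewrite -[RHS]mul1r -cs; ring.
Qed.

Lemma rot_inj a : injective (@rot R a).
Proof.
move=> [x1 x2] [y1 y2]; rewrite /rot /= => -[].
have := cos2Dsin2 a; set c := cos a; set s := sin a => cs e1 e2; congr pair.
- rewrite -[LHS]mul1r -[RHS]mul1r -cs.
  transitivity (c * (c * x1 - s * x2) + s * (s * x1 + c * x2)); first ring.
  by rewrite e1 e2; ring.
- rewrite -[LHS]mul1r -[RHS]mul1r -cs.
  transitivity (c * (s * x1 + c * x2) - s * (c * x1 - s * x2)); first ring.
  by rewrite e1 e2; ring.
Qed.

Lemma continuous_rot (a : R -> R) (y : R -> C) :
  continuous a -> continuous y -> continuous (fun t => rot (a t) (y t)).
Proof.
move=> ca cy.
have cc : continuous (cos \o a).
  by move=> t; apply: continuous_comp; [exact: ca|exact: continuous_cos].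
have cs : continuous (sin \o a).
  by move=> t; apply: continuous_comp; [exact: ca|exact: continuous_sin].
have c1 : continuous (fun t => (y t).1).
  by move=> t; apply: (continuous_comp (cy t)); exact: cvg_fst.
have c2 : continuous (fun t => (y t).2).
  by move=> t; apply: (continuous_comp (cy t)); exact: cvg_snd.
apply: cts_pair => t.
- by apply: cvgB; apply: cvgM; [exact: cc|exact: c1|exact: cs|exact: c2].
- by apply: cvgD; apply: cvgM; [exact: cs|exact: c1|exact: cc|exact: c2].
Qed.

Lemma continuous_stage k n : continuous (@stage R k n).
Proof.
apply: (@cts_max R (fun=> 0) (fun t => Num.min 1 (n%:R * t - k%:R))).
  by move=> t; exact: cvg_cst.
apply: (@cts_min R (fun=> 1)); first by move=> t; exact: cvg_cst.
exact: cts_affine.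
Qed.

Lemma stage_itv k n (t : R) : 0 <= stage k n t <= 1.
Proof.
by rewrite /stage le_max lexx /= ge_max ler01 ge_min lexx.
Qed.

Lemma stageP k l n (t : R) : (k < l)%N -> stage l n t = 0 \/ stage k n t = 1.
Proof.
move=> kl; have kl1 : k%:R + 1 <= l%:R :> R by rewrite natr1 ler_nat.
rewrite /stage; set x := _ * t; have [xl|lx] := leP x l%:R; [left|right].
  apply/max_idPl; rewrite ge_min; apply/orP; right; lra.
rewrite (min_idPl _); last by lra.
by apply/max_idPr.
Qed.

Lemma stage0 k n : stage k n (0 : R) = 0.
Proof.
rewrite /stage mulr0 sub0r; apply/max_idPl; rewrite ge_min oppr_le0 ler0n.
by rewrite orbT.
Qed.

Lemma stage1 k n : (k < n)%N -> stage k n (1 : R) = 1.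
Proof.
move=> kn; have kn1 : k%:R + 1 <= n%:R :> R by rewrite natr1 ler_nat.
by rewrite /stage mulr1 (min_idPl _); [apply/max_idPr|lra].
Qed.

Lemma range_nth (s : seq C) (x : C) (f : 'I_6 -> C) : size s = 6%N ->
  (forall i, f i = nth x s i) -> range f = [set` s].
Proof.
move=> s6 fE; apply/seteqP; split=> [y [i _ <-]|y /= /(nthP x)[i]].
  by rewrite /= fE; apply: mem_nth; rewrite s6.
by rewrite s6 => i6 <-; exists (Ordinal i6) => //; rewrite fE.
Qed.

Lemma nth_inj (s : seq C) (x : C) (f : 'I_6 -> C) : size s = 6%N -> uniq s ->
  (forall i, f i = nth x s i) -> injective f.
Proof.
move=> s6 us fE i j; rewrite !fE => /eqP; rewrite nth_uniq ?s6// => /eqP.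
exact: val_inj.
Qed.
End plane_lemmas.

Section motions.
Variable R : realType.

Local Notation C := (R * R)%type.
Local Notation model_seq := (@model_seq R).
Local Notation model_point := (@model_point R).
Local Notation beta_seq := (@beta_seq R).
Local Notation gbase_fun := (@gbase_fun R).
Local Notation beta_fun := (@beta_fun R).
Local Notation u0 := (@u0 R).
Local Notation disk := (@disk R).

Lemma seq6P (P : C -> Prop) (a b c d e f : C) :
  [/\ P a, P b & P c] -> [/\ P d, P e & P f] ->
  forall y, y \in [:: a; b; c; d; e; f] -> P y.
Proof.
move=> [Pa Pb Pc] [Pd Pe Pf] y.
by rewrite !inE => /or4P[/eqP->|/eqP->|/eqP->|/or3P[/eqP->|/eqP->|/eqP->]].
Qed.

Lemma model_disk : [set` model_seq] `<=` disk.
Proof. by apply: seq6P; split; rewrite /disk/= /normsq/=; lra. Qed.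

Lemma model_base : ~ [set` model_seq] u0.
Proof.
rewrite /=; apply/negP; rewrite !inE !negb_or !xpair_eqE !negb_and.
by do !(apply/andP; split); apply/orP; right; rewrite lt_eqF//; lra.
Qed.

Definition model_config : config R :=
  Config (finite_seq model_seq) model_disk model_base.

Definition K_seq : seq C :=
  [:: (0, 0); (1, 0); (- 1, 0); (0, 1); (0, - 1); (2, 0)].

Lemma K_disk : [set` K_seq] `<=` disk.
Proof. by apply: seq6P; split; rewrite /disk/= /normsq/=; lra. Qed.

Lemma K_base : ~ [set` K_seq] u0.
Proof.
rewrite /=; apply/negP; rewrite !inE !negb_or !xpair_eqE !negb_and.
by do !(apply/andP; split); apply/orP; right; rewrite lt_eqF//; lra.
Qed.

Definition K_config : config R := Config (finite_seq K_seq) K_disk K_base.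

Lemma beta_seqK : [set` beta_seq] = [set` K_seq].
Proof.
apply/seteqP; split; apply: seq6P; split; rewrite /= !inE eqxx ?orbT //.
Qed.

Section gbase.
Variable t : R.
Let a := pi / 2 * stage 0 3 t.
Let r := (1 + stage 1 3 t) / 2.
Let cx := 3 * (1 - stage 2 3 t).
Let dx := cos a * r.
Let dy := sin a * r.

Let gbase_seq : seq C :=
  [:: (- 1, 0); (0, 0); (1, 0); (2, 0); (cx - dx, - dy); (cx + dx, dy)].

Lemma gbase_funE i : gbase_fun i t = nth u0 gbase_seq i.
Proof.
rewrite /gbase_fun /gbase_seq -/a -/r -/cx; congr (nth _ [:: _, _, _, _, _ & _] _).
  by rewrite /rot /=; congr pair; rewrite /= /dx /dy; ring.
by congr [:: _]; rewrite /rot /=; congr pair; rewrite /= /dx /dy; ring.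
Qed.

Lemma gbase_phases :
  [/\ 0 <= dx, 0 <= dy, cx = 3 & dx ^+ 2 + dy ^+ 2 = 4^-1] \/
  [/\ dx = 0, 2^-1 <= dy <= 1 & 0 <= cx <= 3].
Proof.
have /andP[s1 s1'] := stage_itv 1 3 t.
have /andP[s2 s2'] := stage_itv 2 3 t.
have /andP[s0 s0'] := stage_itv 0 3 t.
have [s10|s01] := @stageP R 0 1 3 t isT; last first.
  right; rewrite /dx /dy /a s01 mulr1 cos_pihalf sin_pihalf mul0r mul1r /r /cx.
  by split => //; apply/andP; split; lra.
have [s20|s01] := @stageP R 0 2 3 t isT.
  left; have pi0 := pi_gt0 R.
  have a0 : 0 <= a by rewrite /a; nra.
  have api : a <= pi / 2 by rewrite /a; nra.
  have c0 : 0 <= cos a by apply: cos_ge0_pihalf; apply/andP; split; lra.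
  have sn0 : 0 <= sin a by apply: sin_ge0_pi; apply/andP; split; lra.
  rewrite /dx /dy /cx /r s10 s20; have := cos2Dsin2 a => cs.
  split; [lra|lra|lra|].
  by rewrite !exprMn -mulrDl cs; lra.
right; rewrite /dx /dy /a s01 mulr1 cos_pihalf sin_pihalf mul0r mul1r /r /cx.
by split => //; apply/andP; split; lra.
Qed.

Lemma gbase_seq_disk i : disk (gbase_fun i t).
Proof.
rewrite gbase_funE; move: (nth _ _ _) (@mem_nth _ u0 gbase_seq i (ltn_ord i)).
have H : [/\ normsq (cx - dx, - dy) <= 4 ^+ 2 & normsq (cx + dx, dy) <= 4 ^+ 2].
  rewrite /normsq /=; have [[dx0 dy0 -> dd]|[-> /andP[? ?] /andP[? ?]]] := gbase_phases.
    have dx1 : dx <= 2^-1 by nra.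
    by split; nra.
  by split; nra.
by apply: seq6P; split; rewrite /disk/=; (try by case: H); rewrite /normsq/=; lra.
Qed.

Lemma gbase_seq_uniq : uniq gbase_seq.
Proof.
have D (p q : C) : (p.1 != q.1) || (p.2 != q.2) -> p != q.
  by case: p q => [p1 p2] [q1 q2] /=; rewrite xpair_eqE negb_and.
have ne (x y : R) : x < y -> x != y by move=> xy; rewrite lt_eqF.
have en (x y : R) : y < x -> x != y by move=> xy; rewrite gt_eqF.
have [[dx0 dy0 cx3 dd]|[dx0 /andP[? ?] /andP[? ?]]] := gbase_phases.
  have dx1 : dx <= 2^-1 by nra.
  have dxy : 0 < dx + dy by nra.
  rewrite /= !inE !negb_or -!andbA.
  do 14 (apply/andP; split; [by apply: D => /=; apply/orP; left; apply: ne; lra|]).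
  rewrite andbT; apply: D => /=; have [h|h] := ltP 0 dx.
    by apply/orP; left; apply: ne; lra.
  by apply/orP; right; apply: ne; lra.
rewrite /= !inE !negb_or -!andbA.
by do ?(apply/andP; split) => //; apply: D => /=; apply/orP;
  first [left; apply: ne; lra | right; apply: ne; lra | right; apply: en; lra].
Qed.

End gbase.

Lemma gbase_continuous i : {within unit_itv, continuous (gbase_fun i)}.
Proof.
apply: continuous_subspaceT.
have cc : continuous (fun t : R => (3 * (1 - stage 2 3 t), 0) : C).
  apply: cts_pair => t; last exact: cvg_cst.
  apply: cvgM; first exact: cvg_cst.
  by apply: cvgB; [exact: cvg_cst|exact: continuous_stage].
have cd : continuous (fun t : R =>
    rot (pi / 2 * stage 0 3 t) ((1 + stage 1 3 t) / 2, 0)).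
  apply: continuous_rot => [t|].
    by apply: cvgM; [exact: cvg_cst|exact: continuous_stage].
  apply: cts_pair => t; last exact: cvg_cst.
  apply: cvgM; last exact: cvg_cst.
  by apply: cvgD; [exact: cvg_cst|exact: continuous_stage].
case: i => [[|[|[|[|[|[|//]]]]]] ?] /= t; try exact: cvg_cst.
  by apply: cvgB; [exact: cc|exact: cd].
by apply: cvgD; [exact: cc|exact: cd].
Qed.

Lemma gbase_inj t : unit_itv t -> injective (gbase_fun^~ t).
Proof. by move=> _; apply: (nth_inj _ (gbase_seq_uniq t)) => // i; exact: gbase_funE. Qed.

Lemma gbase_start : range (gbase_fun^~ 0) = model_config.
Proof.
apply: (@range_nth _ _ u0) => // i; rewrite gbase_funE !stage0 !mulr0 cos0 sin0.
rewrite (_ : 3 * (1 - 0) - _ = 5 / 2); last by field.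
rewrite (_ : 3 * (1 - 0) + _ = 7 / 2); last by field.
by rewrite mul0r oppr0.
Qed.

Lemma gbase_end : range (gbase_fun^~ 1) = K_config.
Proof.
rewrite -[RHS]beta_seqK; apply: (@range_nth _ _ u0) => // i.
rewrite gbase_funE !stage1// !mulr1 cos_pihalf sin_pihalf.
rewrite !mul0r subrr mulr0 subrr addr0 mul1r divff//.
Qed.

Definition gbase_motion : motion 6 model_config K_config :=
  Motion gbase_continuous (fun i t _ => gbase_seq_disk t i) gbase_inj
    gbase_start gbase_end.

Lemma beta_continuous i : {within unit_itv, continuous (beta_fun i)}.
Proof.
apply: continuous_subspaceT; rewrite /beta_fun; case: (_ == _).
  apply: (@continuous_rot _ (fun t => 2 * pi * stage 1 2 t) (fun=> nth u0 beta_seq i)) => t.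
    by apply: cvgM; [exact: cvg_cst|exact: continuous_stage].
  exact: cvg_cst.
apply: (@continuous_rot _ (fun t => pi * stage 0 2 t) (fun=> nth u0 beta_seq i)) => t.
  by apply: cvgM; [exact: cvg_cst|exact: continuous_stage].
exact: cvg_cst.
Qed.

Lemma beta_disk i t : disk (beta_fun i t).
Proof.
rewrite /disk /= normsq_rot; move: (nth _ _ _) (@mem_nth _ u0 beta_seq i (ltn_ord i)).
by apply: seq6P; split; rewrite /normsq/=; lra.
Qed.

Lemma beta_seq_uniq : uniq beta_seq.
Proof.
have n1 : (- 1 : R) == 0 = false by apply/negbTE; rewrite oppr_eq0 oner_neq0.
have n2 : (- 1 : R) == 1 = false by apply/negbTE; rewrite lt_eqF//; lra.
have n3 : (- 1 : R) == 2 = false by apply/negbTE; rewrite lt_eqF//; lra.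
have n4 : (0 : R) == 1 = false by apply/negbTE; rewrite lt_eqF//; lra.
have n5 : (0 : R) == 2 = false by apply/negbTE; rewrite lt_eqF//; lra.
have n6 : (1 : R) == 2 = false by apply/negbTE; rewrite lt_eqF//; lra.
have n7 : (0 : R) == - 1 = false by rewrite eq_sym.
have n8 : (1 : R) == 0 = false by rewrite eq_sym.
have n9 : (2 : R) == 0 = false by rewrite eq_sym.
by rewrite /= !inE !xpair_eqE !(n1, n2, n3, n4, n5, n6, n7, n8, n9) ?andbF.
Qed.

Lemma beta_inj t : unit_itv t -> injective (beta_fun^~ t).
Proof.
move=> _.
have bi : injective (fun i : 'I_6 => nth u0 beta_seq i).
  by apply: (nth_inj _ beta_seq_uniq).
have n3 (i : 'I_6) (b : R) : i != 3 :> nat ->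
    normsq (rot b (nth u0 beta_seq i)) < normsq (2, 0).
  rewrite normsq_rot; case: i => [[|[|[|[|[|[|//]]]]]] ?]//= _;
    by rewrite /normsq/=; lra.
have e3 (i : 'I_6) (b : R) : i == 3 :> nat ->
    normsq (rot b (nth u0 beta_seq i)) = normsq (2, 0).
  by rewrite normsq_rot => /eqP ->.
move=> i j; rewrite /beta_fun.
case: (boolP (_ == _)) => i3; case: (boolP (_ == _)) => j3.
- by move=> _; apply: val_inj; rewrite /= (eqP i3) (eqP j3).
- by move=> /(congr1 (@normsq R)); rewrite e3// => /esym/eqP; rewrite lt_eqF// n3.
- by move=> /(congr1 (@normsq R)); rewrite [RHS]e3// => /eqP; rewrite lt_eqF// n3.
- by move=> /rot_inj /bi.
Qed.

Lemma beta_start : range (beta_fun^~ 0) = K_config.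
Proof.
rewrite -[RHS]beta_seqK; apply: (@range_nth _ _ u0) => // i.
by rewrite /beta_fun !stage0 !mulr0 if_same rot0.
Qed.

Lemma beta_end : range (beta_fun^~ 1) = K_config.
Proof.
transitivity [set` [:: (1, 0); (0, 0); (- 1, 0); (2, 0); (0, 1); (0, - 1)] : seq C].
  apply: (@range_nth _ _ u0) => // i; rewrite /beta_fun !stage1// !mulr1.
  by case: i => [[|[|[|[|[|[|//]]]]]] ?] /=; rewrite ?rot_pi ?rot_2pi //= ?oppr0 ?opprK.
by apply/seteqP; split; apply: seq6P; split; rewrite /= !inE eqxx ?orbT.
Qed.

Definition beta_motion : motion 6 K_config K_config :=
  Motion beta_continuous (fun i t _ => beta_disk i t) beta_inj beta_start beta_end.

Lemma lasso_phases (p : C) t :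
  (exists2 l : R, 20^-1 <= l <= 1 & lasso p t = p + l *: (u0 - p)) \/
  (exists a : R, lasso p t = p + 20^-1 *: rot a (u0 - p)).
Proof.
have /andP[s0 s0'] := stage_itv 0 3 t.
have /andP[s2 s2'] := stage_itv 2 3 t.
rewrite /lasso.
have [s10|s01] := @stageP R 0 1 3 t isT.
  left; rewrite s10 mulr0 rot0; have [s20|s11] := @stageP R 1 2 3 t isT; last first.
    by move: s10; rewrite s11 => /eqP; rewrite oner_eq0.
  exists (1 - 19 / 20 * (stage 0 3 t - stage 2 3 t)) => //.
  by rewrite s20; apply/andP; split; lra.
have [s20|s11] := @stageP R 1 2 3 t isT; last first.
  left; exists (1 - 19 / 20 * (stage 0 3 t - stage 2 3 t)).
    by rewrite s01; apply/andP; split; lra.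
  by rewrite s11 mulr1 rot_2pi.
right; exists (2 * pi * stage 1 3 t); rewrite s20 s01; congr (_ + _ *: _).
by field.
Qed.

Lemma lasso_in (i : 'I_6) t : (disk `\` model_config) (lasso (model_point i) t).
Proof.
set p := model_point i.
have pm : p \in model_seq by apply: mem_nth; exact: ltn_ord.
have p2 : p.2 = 0 by move: (p) pm; apply: seq6P.
have p1 : - 1 <= p.1 <= 7 / 2.
  by move: (p) pm; apply: seq6P; split; rewrite /=; apply/andP; split; lra.
have sep (q : C) : q \in model_seq ->
    q.2 = 0 /\ (q.1 = p.1 \/ 2^-1 <= q.1 - p.1 \/ 2^-1 <= p.1 - q.1).
  move: (p) pm; apply: seq6P; split; move: q; apply: seq6P; split; split => //=;
    (try by left); right; (try by left; lra); by right; lra.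
move: (p) p2 p1 sep => [x y] /= -> /andP[x0 x1] sep.
have [[l /andP[l0 l1] ->]|[a ->]] := lasso_phases (x, 0) t.
  have -> : (x, 0) + l *: (u0 - (x, 0)) = ((1 - l) * x, - (4 * l)).
    rewrite /u0 /=; congr pair; rewrite /= /GRing.scale/=; ring.
  split.
    have xx : x ^+ 2 <= 16 by nra.
    have := ler_wpM2l (sqr_ge0 (1 - l)) xx.
    by rewrite /disk /normsq /= exprMn; nra.
  by move=> /sep [/= ]; lra.
have := normsq_rot a (u0 - (x, 0)); move: (rot _ _) => [v w].
rewrite /normsq/= => vw.
have -> : (x, 0) + 20^-1 *: (v, w) = (x + v / 20, w / 20).
  by congr pair; rewrite /= /GRing.scale/=; ring.
have vw' : v ^+ 2 + w ^+ 2 = x ^+ 2 + 16 by rewrite vw; ring.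
have vlo : - 6 <= v by nra.
have vhi : v <= 6 by nra.
split; first by rewrite /disk /normsq /=; nra.
move=> /sep [/= w0 h]; have {}w0 : w = 0 by lra.
have v16 : 16 <= v ^+ 2 by nra.
by case: h => [h|[h|h]]; nra.
Qed.

Lemma lasso_continuous (p : C) : {within unit_itv, continuous (lasso p)}.
Proof.
apply: continuous_subspaceT => t; apply: cvgD; first exact: cvg_cst.
apply: cvgZ.
  apply: cvgB; first exact: cvg_cst.
  apply: cvgM; first exact: cvg_cst.
  by apply: cvgB; exact: continuous_stage.
apply: (@continuous_rot _ (fun t => 2 * pi * stage 1 3 t) (fun=> u0 - p)) => t'.
  by apply: cvgM; [exact: cvg_cst|exact: continuous_stage].
exact: cvg_cst.
Qed.

Lemma lasso_start (p : C) : lasso p 0 = u0.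
Proof. by rewrite /lasso !stage0 subrr !mulr0 subr0 scale1r rot0 addrC subrK. Qed.

Lemma lasso_end (p : C) : lasso p 1 = u0.
Proof.
by rewrite /lasso !stage1// subrr !mulr0 subr0 scale1r mulr1 rot_2pi addrC subrK.
Qed.

Definition model_loop (i : 'I_6) : ploop R (punctured model_config) :=
  @Loop _ _ (punctured model_config) (pt_base (punctured model_config))
    (lasso (model_point i)) (@lasso_continuous _) (fun t _ => lasso_in i t)
    (lasso_start _) (lasso_end _).

End motions.

(* Main.v *)
(* Let D_t realize a motion.  If loops f_t avoid the moving points at time t, then
   D_1 o D_t^-1 o f_t is a homotopy from D_1 o f_0 to f_1; so the action of D_1 does
   not depend on the realization and is computed by following loops explicitly.
   For the g-base, four loops can be pushed away from the moving points once and for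
   all, and the last two move with their points; this exhibits x_1, ..., x_6 as
   polygons.  For beta, the loops are followed by the twists
   y |-> exp (i theta_t(|y|)) y, whose final image of a suitable polygon is again
   homotopic to a polygon.  Two polygons are compared by deleting vertices whose
   triangle with their neighbours contains no puncture, which is a computation on
   integral coordinates.  With w = x5 x4 x3 x2 and v = x5 x4 x3, the outcome is
     x1 -> v x4^-1 x5^-1,  x2 -> v x2 v^-1,  x3 -> w x1 w^-1,  x5 -> x6,
     x4 -> (w x1) x5 x4 x5^-1 (w x1)^-1,
     x6 -> (x6 w x1) x5 x4 x5 x4^-1 x5^-1 (x6 w x1)^-1.
   Modulo (3), the images of x2, x3, x4 give (1) and the two equalities of (2), and
   the image of x6 gives nothing new. *)

From Stdlib Require Import ZArith.
From mathcomp Require Import all_boot all_order all_algebra.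
From mathcomp Require Import all_classical all_reals all_analysis.
From mathcomp Require Import ring lra zify ssrZ.
Require Import Defs.

Set Implicit Arguments.
Unset Strict Implicit.
Unset Printing Implicit Defensive.

Import Order.TTheory GRing.Theory Num.Theory.
Import numFieldNormedType.Exports.

Local Open Scope classical_set_scope.
Local Open Scope ring_scope.

#[local] Hint Resolve unit_itv0 unit_itv1 : core.
#[local] Delimit Scope Z_scope with binz.

(** * Paths and their homotopy classes *)

(** The obstacle is that a realization is an arbitrary family of diffeomorphisms, given without a
    formula: its effect is reached only through continuous families of loops that avoid the moving
    points. The punctures lie where this angle is constant in the radius: a half turn on the block,
    a full turn on the ring through 2. Beyond radius 7/2 the angle unwinds to 0, which keeps u0
    fixed at all times. Edges inside the zones of constancy have straight images; the two transition
    annuli are crossed only along the imaginary axis, where the images are spirals that can be cut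
    into quarter turns. Every identity in the fundamental group is a homotopy found by a terminating
    test, whose failure would prove nothing. The two normal closures are compared modulo an
    arbitrary normal subgroup, so that each image of a generator becomes an equation to be
    rewritten. *)

Section paths.
Context (R : realType) (T : topologicalType).
Implicit Types (X : set T) (f g h : R -> T).

(** Loops of the statement are bundled and based; paths are bare functions with free end points, so
    that a loop can be cut into edges and arcs. *)
Definition is_path X f :=
  {within unit_itv, continuous f} /\ forall t, unit_itv t -> X (f t).

(* Homotopy in [X] relative to the end points; the functions are only
   meaningful on [0, 1]. *)
Definition path_homotopic X f g := exists H : R * R -> T,
  [/\ {within unit_itv `*` unit_itv, continuous H},
      forall s t, unit_itv s -> unit_itv t -> X (H (s, t)),
      forall t, unit_itv t -> H (0, t) = f t /\ H (1, t) = g t &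
      forall s, unit_itv s -> H (s, 0) = f 0 /\ H (s, 1) = f 1].

Definition catp f g (t : R) := if t <= 2^-1 then f (2 * t) else g (2 * t - 1).

Lemma catp0 f g : catp f g 0 = f 0.
Proof. by rewrite /catp invr_ge0 ler0n mulr0. Qed.

Lemma catp1 f g : catp f g 1 = g 1.
Proof.
rewrite /catp ifF; last by apply/negbTE; rewrite -ltNge; lra.
by congr g; ring.
Qed.

(** Stated for families: a constant family gives the continuity of one concatenation, and a homotopy
    is a family too, so the same lemma glues homotopies in either direction. *)
Lemma catp_family_continuous (F G : R * R -> T) :
  {within unit_itv `*` unit_itv, continuous F} ->
  {within unit_itv `*` unit_itv, continuous G} ->
  (forall s, unit_itv s -> F (s, 1) = G (s, 0)) ->
  {within unit_itv `*` unit_itv, continuous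
     (fun x => catp (fun t => F (x.1, t)) (fun t => G (x.1, t)) x.2)}.
Proof.
move=> cF cG FG; apply: within_paste.
- exact: closed_unit_square.
- by move=> x; exact: cvg_snd.
- apply: (within_comp (B := unit_itv `*` unit_itv)
    (f := fun x : R * R => (x.1, 2 * x.2)) (g := F)) => //.
    by move=> [s t] [[/= Is It] s2]; split => //=; exact: half_lo.
  apply: continuous_subspaceT; apply: cts_pair; first by move=> x; exact: cvg_fst.
  by move=> x; apply: cvgM; [exact: cvg_cst|exact: cvg_snd].
- apply: (within_comp (B := unit_itv `*` unit_itv)
    (f := fun x : R * R => (x.1, 2 * x.2 - 1)) (g := G)) => //.
    by move=> [s t] [[/= Is It] s2]; split => //=; exact: half_hi.
  apply: continuous_subspaceT; apply: cts_pair; first by move=> x; exact: cvg_fst.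
  move=> x; apply: cvgB; last exact: cvg_cst.
  by apply: cvgM; [exact: cvg_cst|exact: cvg_snd].
- by move=> [s t] [/= Is It] ->; rewrite divff// subrr FG.
Qed.

Lemma catp_in X f g : (forall t, unit_itv t -> X (f t)) ->
  (forall t, unit_itv t -> X (g t)) -> forall t, unit_itv t -> X (catp f g t).
Proof.
move=> Xf Xg t It; rewrite /catp; case: (leP t 2^-1) => [t2|/ltW t2].
  by apply: Xf; exact: half_lo.
by apply: Xg; exact: half_hi.
Qed.

Lemma slice_continuous (F : R * R -> T) s : unit_itv s ->
  {within unit_itv `*` unit_itv, continuous F} ->
  {within unit_itv, continuous (fun t => F (s, t))}.
Proof.
move=> Is; apply: (within_comp (f := fun t => (s, t))) => //.
by apply: continuous_subspaceT; apply: cts_pair => x; [exact: cvg_cst|exact: cvg_id].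
Qed.

Lemma snd_continuous f : {within unit_itv, continuous f} ->
  {within unit_itv `*` unit_itv, continuous (fun x : R * R => f x.2)}.
Proof.
apply: (within_comp (f := fun x : R * R => x.2)) => [x []//|].
by apply: continuous_subspaceT => x; exact: cvg_snd.
Qed.

Lemma is_path_catp X f g : is_path X f -> is_path X g -> f 1 = g 0 ->
  is_path X (catp f g).
Proof.
move=> [cf Xf] [cg Xg] fg; split; last exact: catp_in.
exact: (slice_continuous (unit_itv0 R)
  (catp_family_continuous (snd_continuous cf) (snd_continuous cg) (fun _ _ => fg))).
Qed.

Lemma path_eq_continuous f g : (forall t, unit_itv t -> f t = g t) ->
  {within unit_itv, continuous f} -> {within unit_itv, continuous g}.
Proof. by move=> fg; apply: subspace_eq_continuous => t; rewrite inE; exact: fg. Qed.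

Lemma is_path_eq X f g : (forall t, unit_itv t -> f t = g t) ->
  is_path X f -> is_path X g.
Proof.
by move=> fg [cf Xf]; split=> [|t It]; [exact: path_eq_continuous cf|rewrite -fg//; exact: Xf].
Qed.

Lemma path_homotopic_eq X f g : is_path X f -> (forall t, unit_itv t -> f t = g t) ->
  path_homotopic X f g.
Proof.
move=> [cf Xf] fg; exists (fun x => f x.2); split => //=.
- exact: snd_continuous.
- by move=> _ t _; exact: Xf.
- by move=> t It; rewrite fg.
Qed.

Lemma path_homotopic_path X f g : path_homotopic X f g -> is_path X f /\ is_path X g.
Proof.
move=> [H [cH XH H01 _]]; split.
  apply: (@is_path_eq _ (fun t => H (0, t))) => [t /H01[]//|].
  by split; [exact: slice_continuous|move=> t; exact: XH].
apply: (@is_path_eq _ (fun t => H (1, t))) => [t /H01[]//|].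
by split; [exact: slice_continuous|move=> t; exact: XH].
Qed.

Lemma path_homotopic_ends X f g : path_homotopic X f g -> f 0 = g 0 /\ f 1 = g 1.
Proof.
move=> [H [_ _ H01 He]].
have [<- <-] := He 1 (unit_itv1 R).
by have [_ ->] := H01 _ (unit_itv0 R); have [_ ->] := H01 _ (unit_itv1 R).
Qed.

Lemma path_homotopic_sym X f g : path_homotopic X f g -> path_homotopic X g f.
Proof.
move=> fg; have [e0 e1] := path_homotopic_ends fg; move: fg => [H [cH XH H01 He]].
exists (fun x => H (1 - x.1, x.2)); split => /=.
- apply: (within_comp (B := unit_itv `*` unit_itv)
    (f := fun x : R * R => (1 - x.1, x.2)) (g := H)) => //.
  + by move=> [s t] [/= /rev_itv].
  + apply: continuous_subspaceT; apply: cts_pair; last by move=> x; exact: cvg_snd.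
    by move=> x; apply: cvgB; [exact: cvg_cst|exact: cvg_fst].
- by move=> s t Is It; apply: XH => //; exact: rev_itv.
- by move=> t It; rewrite subr0 subrr; have [] := H01 _ It.
- by move=> s Is; rewrite -e0 -e1; apply: He; exact: rev_itv.
Qed.

Lemma path_homotopic_trans X f g h :
  path_homotopic X f g -> path_homotopic X g h -> path_homotopic X f h.
Proof.
move=> fg; have [e0 e1] := path_homotopic_ends fg; move: fg => [H [cH XH Hfg He]].
move=> [K [cK XK Kgh Ke]].
(* Stacking two homotopies is concatenation in the deformation parameter; exchanging the coordinates
   reduces it to [catp_family_continuous]. *)
have sw : {within unit_itv `*` unit_itv, continuous (fun x : R * R => (x.2, x.1))}.
  by apply: continuous_subspaceT; apply: cts_pair => x; [exact: cvg_snd|exact: cvg_fst].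
have swc (F : R * R -> T) : {within unit_itv `*` unit_itv, continuous F} ->
    {within unit_itv `*` unit_itv, continuous (fun x => F (x.2, x.1))}.
  by apply: (within_comp (f := fun x : R * R => (x.2, x.1))) sw => -[s t] [].
exists (fun x => catp (fun s => H (s, x.2)) (fun s => K (s, x.2)) x.1); split => /=.
- apply: (swc (fun x => catp (fun s => H (s, x.1)) (fun s => K (s, x.1)) x.2)).
  apply: (@catp_family_continuous (fun x => H (x.2, x.1)) (fun x => K (x.2, x.1))) => [||t It] /=.
  + exact: swc.
  + exact: swc.
  + by have [_ ->] := Hfg _ It; have [-> _] := Kgh _ It.
- move=> s t Is It; apply: (@catp_in X (fun s => H (s, t)) (fun s => K (s, t))) => // s' Is'.
    exact: XH.
  exact: XK.
- move=> t It; rewrite catp0 catp1; split; first by have [] := Hfg _ It.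
  by have [] := Kgh _ It.
- move=> s Is; rewrite e0 e1.
  by split; apply: (@catp_in (fun y => y = _)) => // s' Is';
    [have [-> _] := He _ Is'|have [-> _] := Ke _ Is'
    |have [_ ->] := He _ Is'|have [_ ->] := Ke _ Is'].
Qed.

Lemma path_homotopic_catp X f f' g g' : f 1 = g 0 ->
  path_homotopic X f f' -> path_homotopic X g g' ->
  path_homotopic X (catp f g) (catp f' g').
Proof.
move=> fg [H [cH XH Hf He]] [K [cK XK Kg Ke]].
exists (fun x => catp (fun t => H (x.1, t)) (fun t => K (x.1, t)) x.2); split => /=.
- apply: catp_family_continuous => // s Is.
  by have [_ ->] := He _ Is; have [-> _] := Ke _ Is.
- by move=> s t Is It; apply: catp_in => // t' It'; [exact: XH|exact: XK].
- move=> t It; rewrite /catp; case: (leP t 2^-1) => [t2|/ltW t2].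
    by apply: Hf; exact: half_lo.
  by apply: Kg; exact: half_hi.
- move=> s Is; rewrite !catp0 !catp1.
  by have [-> _] := He _ Is; have [_ ->] := Ke _ Is.
Qed.

Lemma path_homotopic_reparam X f g h (phi psi : R -> R) : is_path X f ->
  continuous phi -> continuous psi ->
  (forall t, unit_itv t -> unit_itv (phi t) /\ unit_itv (psi t)) ->
  phi 0 = psi 0 -> phi 1 = psi 1 ->
  (forall t, unit_itv t -> g t = f (phi t)) ->
  (forall t, unit_itv t -> h t = f (psi t)) ->
  path_homotopic X g h.
Proof.
move=> [cf Xf] cphi cpsi II e0 e1 gE hE.
pose k (x : R * R) := (1 - x.1) * phi x.2 + x.1 * psi x.2.
have kI s t : unit_itv s -> unit_itv t -> unit_itv (k (s, t)).
  move=> + /II []; rewrite !unit_itvE /k/= => /andP[s0 s1] /andP[p0 p1] /andP[q0 q1].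
  by apply/andP; split; nra.
exists (f \o k); split.
- apply: (within_comp (B := unit_itv) (f := k) (g := f)) => //.
  + by move=> [s t] [/=]; exact: kI.
  + apply: continuous_subspaceT => x; rewrite /k.
    apply: cvgD; apply: cvgM.
    * by apply: cvgB; [exact: cvg_cst|exact: cvg_fst].
    * by apply: cvg_comp; [exact: cvg_snd|exact: cphi].
    * exact: cvg_fst.
    * by apply: cvg_comp; [exact: cvg_snd|exact: cpsi].
- by move=> s t Is It; apply: Xf; exact: kI.
- by move=> t It; rewrite /k/= gE// hE//; split; congr (f _); ring.
- by move=> s _; rewrite /k/= !gE// -e0 -e1; split; congr (f _); ring.
Qed.

Lemma catpA X f g h : is_path X f -> is_path X g -> is_path X h ->
  f 1 = g 0 -> g 1 = h 0 ->
  path_homotopic X (catp f (catp g h)) (catp (catp f g) h).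
Proof.
move=> pf pg ph fg gh.
(* The change of parameter between the two bracketings has slopes 2, 1, 1/2 with breaks at 1/4 and
   1/2; being concave, it is the minimum of its affine pieces, hence continuous at once. *)
pose phi (t : R) := Num.min (2 * t + 0) (Num.min (1 * t + 4^-1) (2^-1 * t + 2^-1)).
apply: (@path_homotopic_reparam _ (catp f (catp g h)) _ _ id phi) => //.
- by apply: is_path_catp => //; [exact: is_path_catp|rewrite catp0].
- by move=> x; exact: cvg_id.
- by apply: cts_min; [exact: cts_affine|apply: cts_min; exact: cts_affine].
- move=> t It; split => //; move: It; rewrite !unit_itvE => /andP[t0 t1].
  rewrite /phi !le_min !ge_min; apply/andP; split.
    by apply/and3P; split; lra.
  by rewrite orbC orbC; apply/orP; right; apply/orP; right; lra.
- by rewrite /phi (min_idPl _); [ring|rewrite le_min; apply/andP; split; lra].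
- rewrite /phi (min_idPr _); last by rewrite ge_min; apply/orP; left; lra.
  by rewrite (min_idPr _); lra.
move=> t; rewrite unit_itvE => /andP[t0 t1]; rewrite /catp /phi.
have [t2|t2] := leP t 2^-1.
  have [t4|t4] := leP (2 * t) 2^-1.
    rewrite (min_idPl _); last by rewrite le_min; apply/andP; split; lra.
    by rewrite ifT; [congr f; ring|lra].
  rewrite (min_idPr _); last by rewrite ge_min; apply/orP; left; lra.
  rewrite (min_idPl _); last by lra.
  rewrite ifF; last by apply/negbTE; rewrite -ltNge; lra.
  by rewrite ifT; [congr g; lra|lra].
rewrite (min_idPr _); last by rewrite ge_min; apply/orP; left; lra.
rewrite (min_idPr _); last by lra.
rewrite ifF; last by apply/negbTE; rewrite -ltNge; lra.
by rewrite ifF; [congr h; lra|apply/negbTE; rewrite -ltNge; lra].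
Qed.

End paths.

Section path_class.
Context (R : realType) (T : topologicalType) (X : pointed_set T).
Implicit Types f g : R -> T.

Definition is_loop f := [/\ is_path X f, f 0 = pt_base X & f 1 = pt_base X].

(* Junk value 1 when [f] is not a loop of [X]. *)
Definition path_class f : pi1 R X :=
  if pselect (is_loop f) is left (And3 p f0 f1)
  then loop_class (Loop p.1 p.2 f0 f1 : ploop R X) else 1%g.

Lemma path_homotopic_loop_class f g (lf : is_loop f) (lg : is_loop g) :
  path_homotopic X f g -> path_class f = path_class g.
Proof.
move=> [H [cH XH H01 He]]; rewrite /path_class.
case: pselect => // -[pf f0 f1]; case: pselect => // -[pg g0 g1].
apply/loop_classP; exists H; split => // s Is.
by have [-> ->] := He _ Is.
Qed.

Lemma path_class_loop (l : ploop R X) : path_class l = loop_class l.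
Proof.
rewrite /path_class; case: pselect => [[pf f0 f1]|[]]; last first.
  split; [|exact: loop_start|exact: loop_end].
  by split; [exact: loop_continuous|exact: loop_in].
apply/loop_classP; exists (fun x => l x.2); split => //.
- by apply: snd_continuous; exact: loop_continuous.
- by move=> s t _; exact: loop_in.
Qed.

Lemma is_loop_ploop (l : ploop R X) : is_loop l.
Proof.
split; [|exact: loop_start|exact: loop_end].
by split; [exact: loop_continuous|exact: loop_in].
Qed.

Lemma path_homotopic_is_loop f g : path_homotopic X f g -> is_loop f -> is_loop g.
Proof.
move=> fg [_ f0 f1]; have [_ pg] := path_homotopic_path fg.
by have [e0 e1] := path_homotopic_ends fg; split; rewrite -?e0 -?e1.
Qed.

Lemma path_class_homotopic f g : is_loop f -> path_homotopic X f g ->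
  path_class f = path_class g.
Proof.
by move=> lf fg; apply: path_homotopic_loop_class => //; exact: path_homotopic_is_loop lf.
Qed.

Lemma is_loop_catp f g : is_loop f -> is_loop g -> is_loop (catp f g).
Proof.
move=> [pf f0 f1] [pg g0 g1]; split; rewrite ?catp0 ?catp1//.
by apply: is_path_catp => //; rewrite f1.
Qed.

Lemma path_class_catp f g : is_loop f -> is_loop g ->
  path_class (catp f g) = (path_class f * path_class g)%g.
Proof.
move=> lf lg; have lfg := is_loop_catp lf lg.
move: lf lg => [pf f0 f1] [pg g0 g1].
pose lF : ploop R X := Loop pf.1 pf.2 f0 f1.
pose lG : ploop R X := Loop pg.1 pg.2 g0 g1.
rewrite -[f]/(loop_fun lF) -[g]/(loop_fun lG) !path_class_loop.
by rewrite -[catp _ _]/(loop_fun (cat_loop lF lG)) path_class_loop -pi1_mulE.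
Qed.

End path_class.

Lemma pi1_map_path_class (R : realType) (T U : topologicalType)
    (X : pointed_set T) (Y : pointed_set U) (F : pointed_map X Y) (f : R -> T) :
  is_loop X f -> pi1_map F (path_class X f) = path_class Y (F \o f).
Proof.
move=> [pf f0 f1]; pose l : ploop R X := Loop pf.1 pf.2 f0 f1.
rewrite -[f]/(loop_fun l) path_class_loop pi1_mapE.
by rewrite -[F \o _]/(loop_fun (push_loop F l)) path_class_loop.
Qed.

(** * Transport of loops along a motion *)

(** A closed part of the compact [A] has a compact image, which is closed because [T] is Hausdorff;
    so [g] pulls closed sets back to closed sets. *)
Lemma within_compact_inverse (S T : topologicalType) (A : set S)
    (f : S -> T) (g : T -> S) :
  hausdorff_space T -> compact A -> {within A, continuous f} ->
  (forall x, A x -> g (f x) = x) -> {within f @` A, continuous g}.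
Proof.
move=> hT cA cf gf; apply/continuous_closedP => C cC.
apply/closed_subspaceP; exists (f @` (A `&` C)).
  apply: compact_closed => //; apply: continuous_compact.
    by apply: continuous_subspaceW cf; exact: subIsetl.
  by apply: compact_closedI.
apply/seteqP; split => [y [[x [Ax Cx] <-] fAy]|y [Cgy [x Ax fxy]]].
  by split => //; move: Cx; rewrite -{1}(gf _ Ax).
by split; [exists x => //; split => //; rewrite -(gf _ Ax) fxy|exists x].
Qed.

Section transport.
Variable R : realType.
Local Notation C := (R * R)%type.
Local Notation disk := (@disk R).

Lemma normsq_continuous : continuous (@normsq R).
Proof.
by move=> x; apply: cvgD; apply: cvgM; (exact: cvg_fst || exact: cvg_snd).
Qed.

Lemma disk_compact : compact disk.
Proof.
apply: (@subclosed_compact C _ ([set` `[- 4 : R, 4]] `*` [set` `[- 4 : R, 4]])).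
- apply: (@preimage_closed _ _ (@normsq R) [set x | x <= 4 ^+ 2]).
    by move=> x _; exact: normsq_continuous.
  exact: closed_le.
- by apply: compact_setX; exact: segment_compact.
- move=> [x y]; rewrite /disk /normsq /= => xy.
  by rewrite !in_itv /=; split; apply/andP; split; nra.
Qed.

Lemma normsq_convex (r s : R) (x y : C) : unit_itv s ->
  normsq x <= r -> normsq y <= r -> normsq ((1 - s) *: x + s *: y) <= r.
Proof.
rewrite unit_itvE => /andP[s0 s1]; case: x y => [x1 x2] [y1 y2].
rewrite /normsq /= => dx dy.
have -> : ((1 - s) *: x1 + s *: y1) ^+ 2 + ((1 - s) *: x2 + s *: y2) ^+ 2 =
    (1 - s) * (x1 ^+ 2 + x2 ^+ 2) + s * (y1 ^+ 2 + y2 ^+ 2)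
    - (1 - s) * s * ((x1 - y1) ^+ 2 + (x2 - y2) ^+ 2).
  by rewrite /GRing.scale /=; ring.
have s1' : 0 <= 1 - s by lra.
have := mulr_ge0 (mulr_ge0 s1' s0) (addr_ge0 (sqr_ge0 (x1 - y1)) (sqr_ge0 (x2 - y2))).
have := ler_wpM2l s1' dx; have := ler_wpM2l s0 dy; lra.
Qed.

Lemma disk_convex (s : R) (x y : C) : unit_itv s -> disk x -> disk y ->
  disk ((1 - s) *: x + s *: y).
Proof. exact: normsq_convex. Qed.

(* The loops [F (s, _)] follow the motion, so pulling them back by D_s and pushing
   the result by D_1 is a homotopy from D_1 o F (0, _) to F (1, _). *)
Lemma transport_loops (n : nat) (K K' : config R) (m : motion n K K')
    (D : realization m) (F : R * R -> C) :
  {within unit_itv `*` unit_itv, continuous F} ->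
  (forall s t, unit_itv s -> unit_itv t ->
     disk (F (s, t)) /\ forall i, F (s, t) <> m i s) ->
  (forall s, unit_itv s -> F (s, 0) = u0 R /\ F (s, 1) = u0 R) ->
  pi1_map (induced_diffeo D) (path_class (punctured K) (fun t => F (0, t))) =
  path_class (punctured K') (fun t => F (1, t)).
Proof.
move=> cF FX F01.
have /choice[inv invP] : forall s, exists g : C -> C, unit_itv s ->
    (forall x, disk x -> g (D s x) = x) /\
    (forall y, disk y -> disk (g y) /\ D s (g y) = y).
  move=> s; have [Is|nIs] := pselect (unit_itv s); last by exists id.
  have [g [fg gf _ _]] := rz_diffeo D Is.
  by exists g; split => // x /fg[].
pose Q := @unit_itv R `*` disk.
(* The inverses are chosen separately for each time, with no continuity in time. Inverting the total
   map of the compact cylinder [0, 1] x D makes them jointly continuous. *)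
pose Phi (p : R * C) := (p.1, D p.1 p.2).
pose Psi (p : R * C) := (p.1, inv p.1 p.2).
have cPhi : {within Q, continuous Phi}.
  apply: within_pair; last exact: rz_continuous.
  by apply: continuous_subspaceT => x; exact: cvg_fst.
have QPhi : Phi @` Q = Q.
  apply/seteqP; split => [_ [[s y] [/= Is Dy] <-]|[s y] [/= Is Dy]].
    by split => //=; have [g [/(_ _ Dy)[]]] := rz_diffeo D Is.
  have [_ /(_ _ Dy)[Dg gy]] := invP _ Is.
  by exists (s, inv s y) => //=; rewrite /Phi /= gy.
have cPsi : {within Q, continuous Psi}.
  rewrite -QPhi; apply: within_compact_inverse => //.
  - apply: compact_setX; last exact: disk_compact.
    exact: segment_compact.
  - move=> [s y] [/= Is Dy]; rewrite /Psi /Phi /=.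
    by have [-> //] := invP _ Is.
pose H (x : R * R) := D 1 (inv x.1 (F x)).
have cH : {within unit_itv `*` unit_itv, continuous H}.
  apply: (@within_comp _ C C _ disk (fun x => inv x.1 (F x)) (D 1)).
  - move=> [s t] [/= Is It]; have [_ /(_ (F (s, t)))[]//] := invP _ Is.
    by have [] := FX _ _ Is It.
  - apply: (within_comp (B := Q) (f := fun x => (x.1, F x)) (g := fun p => (Psi p).2)).
    + by move=> [s t] [/= Is It]; split => //=; have [] := FX _ _ Is It.
    + apply: within_pair => //.
      by apply: continuous_subspaceT => x; exact: cvg_fst.
    + apply: (within_comp (B := setT) (f := Psi) (g := snd)) => //.
      by apply: continuous_subspaceT => x; exact: cvg_snd.
  - have cD := @rz_continuous _ _ _ _ _ D.
    apply: (@within_comp _ _ C _ (unit_itv `*` disk) (fun y : C => (1 : R, y))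
      (fun p => D p.1 p.2)) => //.
    by apply: continuous_subspaceT; apply: cts_pair => x; [exact: cvg_cst|exact: cvg_id].
(* If the pulled back point were some m_i(0), applying D_s would put [F (s, t)] on m_i(s). *)
have inK s t : unit_itv s -> unit_itv t -> (disk `\` K) (inv s (F (s, t))).
  move=> Is It; have [DF Fm] := FX _ _ Is It.
  have [_ /(_ _ DF)[Dg gy]] := invP _ Is; split => //.
  by rewrite -(mo_start m) => -[i _ /= mi]; apply: (Fm i); rewrite -gy -mi rz_move.
have inK' s t : unit_itv s -> unit_itv t -> (disk `\` K') (H (s, t)).
  by move=> Is It; apply: induced_in; exact: inK.
have invu s : unit_itv s -> inv s (u0 R) = u0 R.
  move=> Is; have [gD _] := invP _ Is.
  by rewrite -[in LHS](rz_boundary D Is (@circle_u0 R)) gD//; exact/circle_disk/circle_u0.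
have Du : D 1 (u0 R) = u0 R by apply: rz_boundary => //; exact: circle_u0.
have E0 t : unit_itv t -> inv 0 (F (0, t)) = F (0, t).
  move=> It; have [DF _] := FX _ _ (unit_itv0 R) It.
  have [_ /(_ _ DF)[Dg gy]] := invP _ (unit_itv0 R).
  by rewrite -[RHS]gy rz_start.
have E1 t : unit_itv t -> D 1 (inv 1 (F (1, t))) = F (1, t).
  move=> It; have [DF _] := FX _ _ (unit_itv1 R) It.
  by have [_ /(_ _ DF)[]] := invP _ (unit_itv1 R).
have l0 : is_loop (punctured K) (fun t => F (0, t)).
  have [F0 F1] := F01 _ (unit_itv0 R); split => //; split.
    exact: slice_continuous.
  by move=> t It; rewrite -E0//; exact: inK.
rewrite pi1_map_path_class//; apply: path_class_homotopic.
  have [p0 e0 e1] := l0; split; rewrite /= ?e0 ?e1 //.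
  split.
    apply: (path_eq_continuous _ (slice_continuous (unit_itv0 R) cH)) => t It.
    by rewrite /H /= E0.
  by move=> t It; have := inK' _ _ (unit_itv0 R) It; rewrite /H /= E0.
exists H; split => //.
- by move=> t It; rewrite /H /= E0// E1.
- by move=> s Is; have [F0 F1] := F01 _ Is; have [F0' F1'] := F01 _ (unit_itv0 R);
  rewrite /H /= F0 F1 F0' F1' invu.
Qed.

End transport.

(** * Polygons *)

Section polygons.
Variable R : realType.
Local Notation C := (R * R)%type.
Local Notation disk := (@disk R).
Local Notation u0 := (u0 R).
Implicit Types (a b c p x y : C) (X A P : set C) (L s : seq C).

Definition convex A := forall t x y, unit_itv t -> A x -> A y ->
  A ((1 - t) *: x + t *: y).

(** Defined by its universal property: a hull is bounded by exhibiting a convex set, such as a disk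
    or a half-plane, without barycentric coordinates. *)
Definition hull s : set C :=
  [set y | forall P, convex P -> (forall x, x \in s -> P x) -> P y].

Lemma hull_convex s : convex (hull s).
Proof. by move=> t x y It hx hy P cP sP; apply: (cP) => //; [apply: hx|apply: hy]. Qed.

Lemma hull_mem s x : x \in s -> hull s x.
Proof. by move=> xs P _; exact. Qed.

Lemma hull_subset s s' : {subset s <= s'} -> hull s `<=` hull s'.
Proof. by move=> ss' y hy P cP sP; apply: hy => // x /ss'; exact: sP. Qed.

Lemma path_homotopic_convex X A (f g : R -> C) : convex A -> A `<=` X ->
  is_path A f -> is_path A g -> f 0 = g 0 -> f 1 = g 1 -> path_homotopic X f g.
Proof.
move=> cA AX [cf Af] [cg Ag] e0 e1.
have cfst : continuous (fun x : R * R => x.1) by move=> x; exact: cvg_fst.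
exists (fun x => (1 - x.1) *: f x.2 + x.1 *: g x.2); split => /=.
- move=> x; apply: cvgD; apply: cvgZ.
  + apply: (@continuous_subspaceT _ _ _ (fun x : R * R => 1 - x.1)) => y.
    by apply: cvgB; [exact: cvg_cst|exact: cvg_fst].
  + exact: (snd_continuous cf).
  + exact: (@continuous_subspaceT _ _ _ (fun x : R * R => x.1)).
  + exact: (snd_continuous cg).
- by move=> s t Is It; apply: AX; apply: cA => //; [exact: Af|exact: Ag].
- by move=> t It; rewrite subr0 subrr !scale0r !scale1r addr0 add0r.
- by move=> s Is; rewrite -e0 -e1 -!scalerDl subrK !scale1r.
Qed.

Definition seg a b (t : R) : C := (1 - t) *: a + t *: b.

Lemma seg0 a b : seg a b 0 = a.
Proof. by rewrite /seg subr0 scale1r scale0r addr0. Qed.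

Lemma seg1 a b : seg a b 1 = b.
Proof. by rewrite /seg subrr scale1r scale0r add0r. Qed.

Lemma seg_hull a b t : unit_itv t -> hull [:: a; b] (seg a b t).
Proof. by move=> It; apply: hull_convex => //; apply: hull_mem; rewrite !inE eqxx ?orbT. Qed.

Lemma is_path_seg X a b : hull [:: a; b] `<=` X -> is_path X (seg a b).
Proof.
move=> hX; split; last by move=> t It; apply: hX; exact: seg_hull.
apply: continuous_subspaceT => t; apply: cvgD; apply: cvgZ; try exact: cvg_cst.
  by apply: cvgB; [exact: cvg_cst|exact: cvg_id].
exact: cvg_id.
Qed.

Lemma is_path_cst X a : X a -> is_path X (fun _ : R => a).
Proof. by move=> Xa; split => //; apply: continuous_subspaceT => x; exact: cvg_cst. Qed.

(** The trailing constant path makes the recursion follow that of sequences; [catp_const] absorbs it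
    up to homotopy. *)
Fixpoint polygon a L : R -> C :=
  if L is b :: L' then catp (seg a b) (polygon b L') else fun=> a.

Fixpoint polygon_in X a L : Prop :=
  if L is b :: L' then hull [:: a; b] `<=` X /\ polygon_in X b L' else X a.

Lemma polygon0 a L : polygon a L 0 = a.
Proof. by case: L => //= b L; rewrite catp0 seg0. Qed.

Lemma polygon1 a L : polygon a L 1 = last a L.
Proof. by elim: L a => //= b L IH a; rewrite catp1. Qed.

Lemma is_path_polygon X a L : polygon_in X a L -> is_path X (polygon a L).
Proof.
elim: L a => [|b L IH] a /=; first exact: is_path_cst.
move=> [ab bL]; apply: is_path_catp; [exact: is_path_seg|exact: IH|].
by rewrite seg1 polygon0.
Qed.

Lemma polygon_in_cat X a L L' :
  polygon_in X a L -> polygon_in X (last a L) L' -> polygon_in X a (L ++ L').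
Proof. by elim: L a => [//|b L IH] a /= [ab bL] bL'; split=> //; exact: IH. Qed.

Lemma catp_const X a b : hull [:: a; b] `<=` X ->
  path_homotopic X (catp (seg a b) (fun=> b)) (seg a b).
Proof.
move=> abX; apply: (path_homotopic_convex (@hull_convex _) abX).
- apply: is_path_catp; rewrite ?seg1//; first exact: is_path_seg.
  by apply: is_path_cst; apply: hull_mem; rewrite !inE eqxx orbT.
- exact: is_path_seg.
- by rewrite catp0.
- by rewrite catp1 seg1.
Qed.

(** One side is nested to the right throughout, so each vertex costs one reassociation by [catpA];
    at the last edge the trailing constant of the first polygon is absorbed. *)
Lemma polygon_cat X a b L L' :
  polygon_in X a (b :: L) -> polygon_in X (last b L) L' ->
  path_homotopic X (polygon a (b :: L ++ L'))
    (catp (polygon a (b :: L)) (polygon (last b L) L')).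
Proof.
elim: L a b => [|c L IH] a b /= [ab bL] bL'.
  apply: path_homotopic_sym; apply: path_homotopic_catp.
  - by rewrite catp1 polygon0.
  - exact: catp_const.
  - by apply: path_homotopic_eq => //; exact: is_path_polygon.
apply: (path_homotopic_trans (g := catp (seg a b)
    (catp (polygon b (c :: L)) (polygon (last c L) L')))).
  apply: path_homotopic_catp; rewrite ?seg1 ?catp0 ?seg0//.
    by apply: path_homotopic_eq => //; exact: is_path_seg.
  exact: IH.
apply: catpA; rewrite ?seg1 ?catp0 ?seg0 ?catp1 ?polygon0 ?polygon1//.
- exact: is_path_seg.
- exact: (@is_path_polygon _ b (c :: L)).
- exact: is_path_polygon.
Qed.

(** The broken line through [b] and the chord from [a] to [c] lie in the same convex triangle, where
    the straight-line homotopy joins them. *)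
Lemma polygon_delete X a b c L : hull [:: a; b; c] `<=` X -> polygon_in X c L ->
  path_homotopic X (polygon a [:: b, c & L]) (polygon a (c :: L)).
Proof.
move=> hX cL.
have sub (x y : C) : x \in [:: a; b; c] -> y \in [:: a; b; c] ->
    hull [:: x; y] `<=` hull [:: a; b; c].
  by move=> xs ys; apply: hull_subset => z; rewrite in_cons mem_seq1 => /orP[]/eqP->.
have ab : is_path (hull [:: a; b; c]) (seg a b).
  by apply: is_path_seg; apply: sub; rewrite !inE eqxx ?orbT.
have bc : is_path (hull [:: a; b; c]) (seg b c).
  by apply: is_path_seg; apply: sub; rewrite !inE eqxx ?orbT.
have ac : is_path (hull [:: a; b; c]) (seg a c).
  by apply: is_path_seg; apply: sub; rewrite !inE eqxx ?orbT.
have toX f : is_path (hull [:: a; b; c]) f -> is_path X f.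
  by move=> [cf hf]; split => // t It; apply: hX; exact: hf.
apply: (path_homotopic_trans (g := catp (catp (seg a b) (seg b c)) (polygon c L))).
  by apply: (catpA (h := polygon c L)); rewrite ?seg1 ?seg0 ?polygon0//; [exact: toX|exact: toX|exact: is_path_polygon].
apply: path_homotopic_catp; first by rewrite catp1 seg1 polygon0.
  apply: (path_homotopic_convex (@hull_convex _) hX) => //.
  - by apply: is_path_catp; rewrite ?seg1 ?seg0.
  - by rewrite catp0 !seg0.
  - by rewrite catp1 !seg1.
by apply: path_homotopic_eq => //; exact: is_path_polygon.
Qed.

Definition dot x y : R := x.1 * y.1 + x.2 * y.2.

Lemma halfplane_convex (n : C) (r : R) : convex [set y | r < dot n y].
Proof.
move=> t x y; rewrite unit_itvE /dot /= /GRing.scale /= => /andP[t0 t1] nx ny.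
(* At t = 1 the weight of [x] vanishes and strictness must come from [y]; otherwise [x] alone
   provides it. *)
have [->|tn] := eqVneq t 1; first by lra.
have : 0 < (1 - t) * (n.1 * x.1 + n.2 * x.2 - r).
  by apply: mulr_gt0; rewrite subr_gt0 // lt_neqAle tn.
have : 0 <= t * (n.1 * y.1 + n.2 * y.2 - r) by apply: mulr_ge0 => //; lra.
lra.
Qed.

(** Each puncture gets its own half-plane, which contains [s], hence its hull, but not the
    puncture. *)
Lemma hull_avoids (M : set C) s : (forall x, x \in s -> disk x) ->
  (forall p, M p -> exists n, forall x, x \in s -> dot n p < dot n x) ->
  hull s `<=` disk `\` M.
Proof.
move=> sD sM y hy; split; first by apply: hy => //; exact: disk_convex.
move=> /sM[n np].
by have := hy _ (@halfplane_convex n (dot n y)) np; rewrite /= ltxx.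
Qed.

End polygons.

(* Integer coordinates count fortieths, so that all vertices below are integral. *)
Notation zpt := (Z * Z)%type.

Definition zdot (m n : zpt) : Z := (m.1 * n.1 + m.2 * n.2)%binz.
Definition zsub (m n : zpt) : zpt := ((m.1 - n.1)%binz, (m.2 - n.2)%binz).

(* The box [(lo, hi)] stands for [lo.1, hi.1] x [lo.2, hi.2]. *)
Notation zbox := (zpt * zpt)%type.

Definition corners (B : zbox) : seq zpt :=
  [:: B.1; B.2; (B.1.1, B.2.2); (B.2.1, B.1.2)].

(** Candidates for separation: axis directions for the sides of a box, perpendiculars of differences
    for the edges of the hull. The differences themselves handle flat hulls, as when a puncture lies
    beyond the end of a segment on its line. Ordered pairs give both signs. *)
Definition normals (s : seq zpt) : seq zpt :=
  [:: (1, 0); (0, 1); (-1, 0); (0, -1)]%binz ++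
  flatten [seq [seq (zsub x y) | y <- s] ++
               [seq ((zsub x y).2, Z.opp (zsub x y).1) | y <- s] | x <- s].

Definition separates (s : seq zpt) (B : zbox) (n : zpt) : bool :=
  all (fun x => all (fun c => Z.ltb (zdot n c) (zdot n x)) (corners B)) s.

(** The radius 4 is 160 fortieths. *)
Definition in_zdisk (x : zpt) : bool := Z.leb (zdot x x) (160 * 160).

Definition hull_free (Bs : seq zbox) (s : seq zpt) : bool :=
  all in_zdisk s && all (fun B => has (separates s B) (normals s)) Bs.

Fixpoint polygon_free Bs (a : zpt) (L : seq zpt) : bool :=
  if L is b :: L' then hull_free Bs [:: a; b] && polygon_free Bs b L'
  else in_zdisk a && hull_free Bs [:: a].

Fixpoint delete_next Bs (a : zpt) (L : seq zpt) {struct L} : seq zpt :=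
  if L is b :: L' then
    if L' is c :: _ then
      if hull_free Bs [:: a; b; c] then delete_next Bs a L' else L
    else L
  else L.

(** Works from the end like the reduction of a word with a stack: once the tail is reduced, vertices
    at its head are removed as long as possible, so backtracking collapses. *)
Fixpoint reduce Bs (a : zpt) (L : seq zpt) : seq zpt :=
  if L is b :: L' then delete_next Bs a (b :: reduce Bs b L') else [::].

Definition zu0 : zpt := (0, -160)%binz.

Definition is_base (L : seq zpt) : bool :=
  if L is [:: (x, y)] then Z.eqb x 0 && Z.eqb y (-160) else false.

(** Each pass yields a homotopic polygon, so the number of passes affects success only; three
    suffice for the loops tested below. *)
Definition null_polygon Bs (L : seq zpt) : bool :=
  is_base (iter 3 (reduce Bs zu0) L).

Definition is_zloop Bs (L : seq zpt) : bool :=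
  (if L is _ :: _ then is_base [:: last zu0 L] else false) && polygon_free Bs zu0 L.

(** Vertex lists omit the starting point: it is restored before reversing, and the new starting
    point is dropped. *)
Definition rev_polygon (L : seq zpt) : seq zpt := behead (rev (zu0 :: L)).

(* [reduce] is greedy, hence incomplete: this test may fail for homotopic loops, and
   is not symmetric. *)
Definition same_loop Bs (L L' : seq zpt) : bool :=
  [&& is_zloop Bs L, is_zloop Bs L', is_zloop Bs (rev_polygon L),
      null_polygon Bs (L ++ rev_polygon L) & null_polygon Bs (L' ++ rev_polygon L)].

Lemma polygon_free_cat Bs a L L' : polygon_free Bs a L ->
  polygon_free Bs (last a L) L' -> polygon_free Bs a (L ++ L').
Proof. by elim: L a => [//|b L IH] a /= /andP[-> bL] bL'; exact: IH. Qed.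

(** * Soundness of the integral tests *)

Section integral_polygons.
Variable R : realType.
Local Notation C := (R * R)%type.
Local Notation disk := (@disk R).
Local Notation u0 := (u0 R).

Lemma pair_eq (p q : C) : p.1 = q.1 -> p.2 = q.2 -> p = q.
Proof. by case: p q => [p1 p2] [q1 q2] /= -> ->. Qed.

Definition zr (z : Z) : R := (int_of_Z z)%:~R.

Lemma zrD (x y : Z) : zr (x + y)%binz = zr x + zr y.
Proof. by rewrite /zr -[(x + y)%binz]/(GRing.add x y) rmorphD rmorphD. Qed.

Lemma zrN (x : Z) : zr (- x)%binz = - zr x.
Proof. by rewrite /zr -[(- x)%binz]/(GRing.opp x) rmorphN rmorphN. Qed.

Lemma zrM (x y : Z) : zr (x * y)%binz = zr x * zr y.
Proof. by rewrite /zr -[(x * y)%binz]/(GRing.mul x y) rmorphM rmorphM. Qed.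

Lemma zr_le (x y : Z) : Z.leb x y -> zr x <= zr y.
Proof. by move=> xy; rewrite /zr ler_int; move: xy; lia. Qed.

Lemma zr_lt (x y : Z) : Z.ltb x y -> zr x < zr y.
Proof. by move=> xy; rewrite /zr ltr_int; move: xy; lia. Qed.

Definition emb (x : zpt) : C := (zr x.1 / 40, zr x.2 / 40).

Definition in_zbox (p : C) (B : zbox) : Prop :=
  zr B.1.1 <= 40 * p.1 <= zr B.2.1 /\ zr B.1.2 <= 40 * p.2 <= zr B.2.2.

Definition covers (Bs : seq zbox) (M : set C) : Prop :=
  forall p, M p -> exists2 B, B \in Bs & in_zbox p B.

Lemma emb_u0 : emb zu0 = u0.
Proof. by rewrite /emb /u0 /zr /=; congr pair; [lra|field]. Qed.

Lemma in_zdisk_emb x : in_zdisk x -> disk (emb x).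
Proof.
move=> /zr_le; rewrite /zdot zrD !zrM (_ : zr 160 = 160)// => h.
by rewrite /disk /normsq /emb /=; lra.
Qed.

Lemma separates_emb s B n p : separates s B n -> in_zbox p B ->
  forall x, x \in map emb s ->
    dot (zr n.1, zr n.2) p < dot (zr n.1, zr n.2) x.
Proof.
move=> /allP sB [/andP[p1 p2] /andP[p3 p4]] _ /mapP[x /sB xB ->].
move: xB => /and5P[/zr_lt c1 /zr_lt c2 /zr_lt c3 /zr_lt c4 _].
move: c1 c2 c3 c4; rewrite /zdot !zrD !zrM /dot /=.
set n1 := zr n.1; set n2 := zr n.2; set x1 := zr x.1; set x2 := zr x.2.
move: p1 p2 p3 p4; set a := zr _; set b := zr _; set c := zr _; set d := zr _.
move=> p1 p2 p3 p4 c1 c2 c3 c4.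
(* In each coordinate the sign of the normal selects the end of the interval that bounds the
   product; the four combinations are the four corners. *)
have : n1 * p.1 <= n1 * a / 40 \/ n1 * p.1 <= n1 * b / 40.
  have [n0|/ltW n0] := leP 0 n1; [right|left]; nra.
have : n2 * p.2 <= n2 * c / 40 \/ n2 * p.2 <= n2 * d / 40.
  have [n0|/ltW n0] := leP 0 n2; [right|left]; nra.
by case=> ? [] ?; lra.
Qed.

Lemma hull_free_emb Bs s (M : set C) : covers Bs M -> hull_free Bs s ->
  hull (map emb s) `<=` disk `\` M.
Proof.
move=> BM /andP[/allP sD /allP sB]; apply: hull_avoids.
  by move=> _ /mapP[x /sD xs ->]; exact: in_zdisk_emb.
move=> p /BM[B /sB /hasP[n _ sBn] pB]; exists (zr n.1, zr n.2).
exact: separates_emb sBn pB.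
Qed.

Section fixed_obstacles.
Variables (Bs : seq zbox) (M : set C).
Hypothesis BM : covers Bs M.
Local Notation X := (disk `\` M).

Lemma polygon_free_emb a L : polygon_free Bs a L ->
  polygon_in X (emb a) (map emb L).
Proof.
elim: L a => [|b L IH] a /= /andP[ab bL]; last first.
  by split; [exact: (hull_free_emb BM ab)|exact: IH].
by apply: (hull_free_emb BM bL); apply: hull_mem; rewrite mem_seq1.
Qed.

Lemma delete_next_homotopic a L : polygon_in X (emb a) (map emb L) ->
  polygon_in X (emb a) (map emb (delete_next Bs a L)) /\
  path_homotopic X (polygon (emb a) (map emb L))
    (polygon (emb a) (map emb (delete_next Bs a L))).
Proof.
elim: L => [|b [|c L] IH] h.
- by split=> //; apply: path_homotopic_eq => //; exact: is_path_polygon.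
- by split=> //; apply: path_homotopic_eq => //; exact: is_path_polygon.
rewrite [delete_next _ _ _]/=; case: ifPn => [f|_]; last first.
  by split=> //; apply: path_homotopic_eq => //; exact: is_path_polygon.
have hX := hull_free_emb BM f.
have h' : polygon_in X (emb a) (map emb (c :: L)).
  split; last by case: h => _ [].
  apply: subset_trans hX; apply: hull_subset => z.
  by rewrite in_cons mem_seq1 => /orP[]/eqP->; rewrite !inE eqxx ?orbT.
have [h1 h2] := IH h'; split=> //; apply: path_homotopic_trans h2.
by apply: polygon_delete => //; case: h => _ [].
Qed.

Lemma reduce_homotopic a L : polygon_in X (emb a) (map emb L) ->
  polygon_in X (emb a) (map emb (reduce Bs a L)) /\
  path_homotopic X (polygon (emb a) (map emb L))
    (polygon (emb a) (map emb (reduce Bs a L))).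
Proof.
elim: L a => [|b L IH] a.
  by move=> h; split=> //; apply: path_homotopic_eq => //; exact: is_path_polygon.
move=> [ab bL]; have [h1 h2] := IH _ bL; rewrite [reduce _ _ _]/=.
have [|h3 h4] := @delete_next_homotopic a (b :: reduce Bs b L); first by split.
split=> //; apply: path_homotopic_trans h4.
apply: (path_homotopic_catp (g := polygon _ _) (g' := polygon _ _)) => //.
  by rewrite seg1 polygon0.
by apply: path_homotopic_eq => //; exact: is_path_seg.
Qed.

End fixed_obstacles.

Section punctured_disk.
Variables (K : config R) (Bs : seq zbox).
Hypothesis BK : covers Bs K.

Definition zclass (L : seq zpt) : pi1 R (punctured K) :=
  path_class (punctured K) (polygon u0 (map emb L)).

Lemma is_base_eq L : is_base L -> L = [:: zu0].
Proof. by case: L => [//|[x y] [|//]] /andP[/Z.eqb_eq -> /Z.eqb_eq ->]. Qed.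

Lemma is_zloop_in L : is_zloop Bs L ->
  polygon_in (disk `\` K) u0 (map emb L).
Proof. by move=> /andP[_]; rewrite -emb_u0; exact: polygon_free_emb. Qed.

Lemma is_zloop_last L : is_zloop Bs L -> last zu0 L = zu0.
Proof. by case: L => [//|b L] /andP[/is_base_eq[]]. Qed.

Lemma is_zloop_emb L : is_zloop Bs L ->
  is_loop (punctured K) (polygon u0 (map emb L)).
Proof.
move=> lL; split; rewrite ?polygon0 //; first exact/is_path_polygon/is_zloop_in.
by rewrite polygon1 -emb_u0 last_map (is_zloop_last lL) emb_u0.
Qed.

Lemma zclass_cat L L' : is_zloop Bs L -> is_zloop Bs L' ->
  zclass (L ++ L') = (zclass L * zclass L')%g.
Proof.
move=> lL lL'; have := is_zloop_last lL; have := is_zloop_in lL.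
have := is_zloop_emb lL; case: L lL => [//|b L] lL lpL inL lastL.
have /= lastL' : last (emb b) (map emb L) = u0 by rewrite -emb_u0 last_map -lastL.
rewrite /zclass -path_class_catp//; last exact: is_zloop_emb.
apply/esym/path_class_homotopic; first by apply: is_loop_catp => //; exact: is_zloop_emb.
have := @polygon_cat _ (disk `\` K) u0 (emb b) (map emb L) (map emb L') inL.
rewrite lastL' -map_cat => h; apply: path_homotopic_sym.
exact/h/is_zloop_in.
Qed.

Lemma is_zloop_cat L L' : is_zloop Bs L -> is_zloop Bs L' -> is_zloop Bs (L ++ L').
Proof.
move=> lL; have := is_zloop_last lL.
case: L lL => [//|b L] /andP[_ fL] lastL.
case: L' => [//|c L'] /andP[l' fL']; apply/andP; split; first by rewrite last_cat.
by apply: polygon_free_cat => //; rewrite lastL.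
Qed.

Lemma zclass_null L : is_zloop Bs L -> null_polygon Bs L -> zclass L = 1%g.
Proof.
move=> lL /is_base_eq /= L0; have h0 := is_zloop_in lL; rewrite -emb_u0 in h0.
have [h1 g1] := reduce_homotopic BK h0.
have [h2 g2] := reduce_homotopic BK h1.
have [h3 g3] := reduce_homotopic BK h2.
have g : path_homotopic (disk `\` K) (polygon u0 (map emb L)) (polygon u0 [:: u0]).
  have := path_homotopic_trans g1 (path_homotopic_trans g2 g3).
  by rewrite L0 -[map emb [:: zu0]]/[:: emb zu0] emb_u0.
rewrite /zclass (path_class_homotopic (is_zloop_emb lL) g).
rewrite -[RHS]/(loop_class (const_loop R (pt_base_in (punctured K)))) -path_class_loop.
apply/esym/path_class_homotopic; first exact: is_loop_ploop.
apply: path_homotopic_eq; first by case: (is_loop_ploop (const_loop R (pt_base_in (punctured K)) : ploop _ _)).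
by move=> t _; rewrite /= /catp /seg -!scalerDl !subrK !scale1r; case: ifP.
Qed.

Lemma zclass_same L L' : same_loop Bs L L' -> zclass L = zclass L'.
Proof.
move=> /and5P[lL lL' lr n1 n2].
(* Both loops are left inverses of the class of the reversed [L], so they agree by cancellation; the
   behaviour of reversal is part of what the test checks. *)
have := zclass_null (is_zloop_cat lL lr) n1.
have := zclass_null (is_zloop_cat lL' lr) n2.
by rewrite !zclass_cat// => <-; apply: mulIg.
Qed.

End punctured_disk.
End integral_polygons.

(** Turns closed integers, by conversion, into the numerals that [lra] reads. *)
Ltac zr_eval := repeat match goal with
  | |- context [@zr ?R (Zpos ?p)] =>
      let n := eval vm_compute in (Pos.to_nat p) in
      change (@zr R (Zpos p)) with (n%:R : R)
  | |- context [@zr ?R (Zneg ?p)] =>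
      let n := eval vm_compute in (Pos.to_nat p) in
      change (@zr R (Zneg p)) with (- n%:R : R)
  | |- context [@zr ?R Z0] => change (@zr R Z0) with (0 : R)
  end.

(** * The twist that realizes beta *)

Section spirals.
Variable R : realType.
Local Notation C := (R * R)%type.
Local Notation disk := (@disk R).
Implicit Types (p e v w y : C) (X : set C) (L : seq C).

(** The condition [polygon_in] is kept beside the homotopy so that traces of consecutive pieces can
    be concatenated. *)
Definition traces X (f : R -> C) L :=
  polygon_in X (f 0) L /\ path_homotopic X f (polygon (f 0) L).

Lemma traces_eq X (f g : R -> C) L : (forall t, unit_itv t -> f t = g t) ->
  traces X g L -> traces X f L.
Proof.
move=> fg; rewrite /traces fg// => -[h gL]; split=> //.
have [pg _] := path_homotopic_path gL.
apply: path_homotopic_trans gL; apply: path_homotopic_sym.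
by apply: path_homotopic_eq => // t It; rewrite fg.
Qed.

Lemma traces_last X f L : traces X f L -> f 1 = last (f 0) L.
Proof. by move=> [_ /path_homotopic_ends[_ ->]]; rewrite polygon1. Qed.

Lemma traces_catp X f g b L L' : f 1 = g 0 ->
  traces X f (b :: L) -> traces X g L' -> traces X (catp f g) (b :: L ++ L').
Proof.
move=> fg tf [g1 g2]; have /= fl := traces_last tf; case: tf => [f1 f2].
rewrite -fg fl in g1 g2; rewrite /traces catp0; split.
  exact: (@polygon_in_cat _ _ _ (b :: L)).
apply: path_homotopic_trans (path_homotopic_sym (polygon_cat f1 g1)).
by apply: path_homotopic_catp.
Qed.

Lemma traces_seg X a b : hull [:: a; b] `<=` X -> traces X (seg a b) [:: b].
Proof.
move=> h; rewrite /traces seg0; split.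
  by split=> //; apply: h; apply: hull_mem; rewrite !inE eqxx orbT.
by apply: path_homotopic_sym; exact: catp_const.
Qed.

(** For orthogonal [v] and [w] of unit length, a quarter of an annulus whose inner circle is
    replaced by the chord a + b = m. The annulus sector is not convex, this larger set is; it
    contains the sector because a + b is at least the radius when a and b are nonnegative. *)
Definition truncated_cone p v w (m M : R) : set C :=
  [set y | exists ab : C, [/\ y = p + (ab.1 *: v + ab.2 *: w),
     0 <= ab.1, 0 <= ab.2, m <= ab.1 + ab.2 & normsq ab <= M ^+ 2]].

Lemma truncated_cone_convex p v w m M : convex (truncated_cone p v w m M).
Proof.
move=> t _ _ It [ab [-> a0 b0 mab abM]] [cd [-> c0 d0 mcd cdM]].
have := It; rewrite unit_itvE => /andP[t0 t1].
exists ((1 - t) *: ab + t *: cd); split; last exact: normsq_convex.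
- case: p v w => [p1 p2] [v1 v2] [w1 w2]; rewrite /GRing.scale /=.
  by congr pair; rewrite /= /GRing.scale /=; ring.
- by rewrite /= /GRing.scale /=; nra.
- by rewrite /= /GRing.scale /=; nra.
- by rewrite /= /GRing.scale /=; nra.
Qed.

(** The image of a radial segment under a rotation whose angle is affine in the radius; a circle
    when [r0] equals [r1]. *)
Definition spiral p e (r0 r1 a0 a1 t : R) : C :=
  p + (r0 + (r1 - r0) * t) *: rot (a0 + (a1 - a0) * t) e.

Lemma spiral0 p e r0 r1 a0 a1 : spiral p e r0 r1 a0 a1 0 = p + r0 *: rot a0 e.
Proof. by rewrite /spiral !mulr0 !addr0. Qed.

Lemma spiral1 p e r0 r1 a0 a1 : spiral p e r0 r1 a0 a1 1 = p + r1 *: rot a1 e.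
Proof. by rewrite /spiral !mulr1 ![_ + (_ - _)]addrC !subrK. Qed.

Lemma spiral_continuous p e r0 r1 a0 a1 : continuous (spiral p e r0 r1 a0 a1).
Proof.
have ca (a b : R) : continuous (fun t : R => a + (b - a) * t).
  move=> t; apply: cvgD; first exact: cvg_cst.
  by apply: cvgM; [exact: cvg_cst|exact: cvg_id].
move=> t; apply: cvgD; first exact: cvg_cst.
apply: cvgZ; first exact: ca.
apply: (@continuous_rot _ (fun t => a0 + (a1 - a0) * t) (fun=> e)); first exact: ca.
by move=> t'; exact: cvg_cst.
Qed.

(** Radius and angle are affine in the parameter, and [catp] also cuts at the middle, so the two
    halves are again spirals and this is an equality of functions. *)
Lemma spiral_split p e r0 r1 a0 a1 t :
  spiral p e r0 r1 a0 a1 t =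
  catp (spiral p e r0 ((r0 + r1) / 2) a0 ((a0 + a1) / 2))
       (spiral p e ((r0 + r1) / 2) r1 ((a0 + a1) / 2) a1) t.
Proof.
rewrite /catp /spiral; case: ifP => _; congr (_ + _ *: rot _ e); by field.
Qed.

Lemma rot_quarter (a0 a1 t : R) e :
  a1 = a0 + pi / 2 \/ a1 = a0 - pi / 2 ->
  rot (a0 + (a1 - a0) * t) e =
    cos (pi / 2 * t) *: rot a0 e + sin (pi / 2 * t) *: rot a1 e.
Proof.
case=> ->; rewrite [X in rot (_ + X * _)]addrAC subrr add0r.
  rewrite /rot cosDpihalf sinDpihalf cosD sinD; case: e => x y /=.
  by congr pair; rewrite /= /GRing.scale /=; ring.
rewrite mulNr /rot cosBpihalf sinBpihalf cosB sinB; case: e => x y /=.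
by congr pair; rewrite /= /GRing.scale /=; ring.
Qed.

(* The cone over a quarter turn, truncated, is convex and contains both the spiral
   and its chord. *)
Lemma quarter_spiral X p e (r0 r1 a0 a1 m M : R) :
  a1 = a0 + pi / 2 \/ a1 = a0 - pi / 2 -> 0 <= m ->
  m <= r0 <= M -> m <= r1 <= M ->
  truncated_cone p (rot a0 e) (rot a1 e) m M `<=` X ->
  traces X (spiral p e r0 r1 a0 a1) [:: p + r1 *: rot a1 e].
Proof.
move=> qa m0 /andP[mr0 r0M] /andP[mr1 r1M] coneX.
pose A := truncated_cone p (rot a0 e) (rot a1 e) m M.
have inA t : unit_itv t -> A (spiral p e r0 r1 a0 a1 t).
  rewrite unit_itvE => /andP[t0 t1]; rewrite /spiral (rot_quarter _ _ qa).
  have pi0 := pi_gt0 R; set b := pi / 2 * t; set r := r0 + _.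
  have b0 : 0 <= b by rewrite /b; nra.
  have b1 : b <= pi / 2 by rewrite /b; nra.
  have cb : 0 <= cos b by apply: cos_ge0_pihalf; apply/andP; split; lra.
  have sb : 0 <= sin b by apply: sin_ge0_pi; apply/andP; split; lra.
  have cs := cos2Dsin2 b.
  have rm : m <= r <= M by apply/andP; split; rewrite /r; nra.
  have /andP[mr rM] := rm.
  exists (r * cos b, r * sin b); split => /=.
  - by rewrite scalerDr !scalerA.
  - by apply: mulr_ge0 => //; lra.
  - by apply: mulr_ge0 => //; lra.
  (* Both are nonnegative and their squares sum to 1; this is what puts the arc beyond the chord a +
     b = m. *)
  - have cs1 : 1 <= cos b + sin b by nra.
    by rewrite -mulrDr; nra.
  - rewrite /normsq /= !exprMn -mulrDr cs mulr1 ler_sqr ?nnegrE//; lra.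
have cA := @truncated_cone_convex p (rot a0 e) (rot a1 e) m M.
have hA : hull [:: p + r0 *: rot a0 e; p + r1 *: rot a1 e] `<=` A.
  move=> y; apply => // x; rewrite !inE => /orP[]/eqP->.
    by rewrite -(spiral0 p e r0 r1 a0 a1); exact: inA.
  by rewrite -(spiral1 p e r0 r1 a0 a1); exact: inA.
have [h1 h2] := traces_seg (subset_trans hA coneX).
rewrite seg0 in h1 h2.
rewrite /traces spiral0; split => //; apply: path_homotopic_trans h2.
apply: (path_homotopic_convex cA coneX).
- by split => //; apply: continuous_subspaceT; exact: spiral_continuous.
- exact: is_path_seg.
- by rewrite spiral0 seg0.
- by rewrite spiral1 seg1.
Qed.

(** Multiplication by s i; the sign s is the sense of rotation, so one proof serves both senses. *)
Definition turn (s : R) v : C := (- (s * v.2), s * v.1).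

Lemma rot_turn (s a : R) v : s = 1 \/ s = - 1 ->
  rot (a + s * (pi / 2)) v = turn s (rot a v).
Proof.
case=> ->; rewrite ?mul1r ?mulN1r /rot /turn /= ?cosDpihalf ?sinDpihalf
  ?cosBpihalf ?sinBpihalf; by congr pair; ring.
Qed.

Lemma turn2 (s : R) v : s = 1 \/ s = - 1 -> turn s (turn s v) = - v.
Proof. by case: v => x y [] ->; rewrite /turn /=; congr pair; rewrite /=; ring. Qed.

Section spirals_of_quarters.
Variables (X Q : set C) (p e : C) (s m M : R).
Hypotheses (s1 : s = 1 \/ s = - 1) (m0 : 0 <= m).
Hypothesis QX : forall v, Q v -> truncated_cone p v (turn s v) m M `<=` X.
Hypothesis Qturn : forall v, Q v -> Q (turn s v).

(** [Q] stands for the admissible directions, the half-axes for the twist and the vectors of a fixed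
    length for the lassos. Its stability under quarter turns lets the cone condition be reused for
    consecutive quarters. *)
Lemma quarter_turn_traces (r0 r1 a : R) : Q (rot a e) ->
  m <= r0 <= M -> m <= r1 <= M ->
  traces X (spiral p e r0 r1 a (a + s * (pi / 2))) [:: p + r1 *: turn s (rot a e)].
Proof.
move=> Qa h0 h1; rewrite -(rot_turn _ _ s1).
apply: (quarter_spiral (m := m) (M := M)) => //.
  by case: s1 => ->; [left|right]; rewrite ?mul1r ?mulN1r.
by rewrite rot_turn//; exact: QX.
Qed.

Lemma half_turn_traces (r0 r1 a : R) : Q (rot a e) ->
  m <= r0 <= M -> m <= r1 <= M ->
  traces X (spiral p e r0 r1 a (a + s * pi))
    [:: p + ((r0 + r1) / 2) *: turn s (rot a e); p + r1 *: - rot a e].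
Proof.
move=> Qa h0 h1; have /andP[h00 h01] := h0; have /andP[h10 h11] := h1.
have am : (a + (a + s * pi)) / 2 = a + s * (pi / 2) by field.
have ae : a + s * pi = a + s * (pi / 2) + s * (pi / 2) by field.
have h : m <= (r0 + r1) / 2 <= M by apply/andP; split; lra.
apply: (traces_eq (fun t _ => spiral_split _ _ _ _ _ _ t)); rewrite am.
apply: (traces_catp (L := [::])); first by rewrite spiral0 spiral1.
  exact: quarter_turn_traces.
rewrite ae -(turn2 (rot a e) s1) -(rot_turn _ _ s1).
by apply: quarter_turn_traces => //; rewrite rot_turn//; exact: Qturn.
Qed.

Lemma full_turn_traces (r0 r1 a : R) : Q (rot a e) ->
  m <= r0 <= M -> m <= r1 <= M ->
  traces X (spiral p e r0 r1 a (a + s * (2 * pi)))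
    [:: p + ((r0 + (r0 + r1) / 2) / 2) *: turn s (rot a e);
        p + ((r0 + r1) / 2) *: - rot a e;
        p + (((r0 + r1) / 2 + r1) / 2) *: - turn s (rot a e);
        p + r1 *: rot a e].
Proof.
move=> Qa h0 h1; have /andP[h00 h01] := h0; have /andP[h10 h11] := h1.
have am : (a + (a + s * (2 * pi))) / 2 = a + s * pi by field.
have ae : a + s * (2 * pi) = a + s * pi + s * pi by ring.
have rp : rot (a + s * pi) e = - rot a e.
  rewrite (_ : a + s * pi = a + s * (pi / 2) + s * (pi / 2)); last by field.
  by rewrite !rot_turn// turn2.
have h : m <= (r0 + r1) / 2 <= M by apply/andP; split; lra.
apply: (traces_eq (fun t _ => spiral_split _ _ _ _ _ _ t)); rewrite am.
apply: (traces_catp (L := [:: _])); first by rewrite spiral0 spiral1.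
  exact: half_turn_traces.
have := @half_turn_traces ((r0 + r1) / 2) r1 (a + s * pi).
rewrite rp ae opprK (_ : turn s (- rot a e) = - turn s (rot a e)); last first.
  by rewrite /turn; congr pair; rewrite /=; ring.
by apply => //; rewrite -(turn2 _ s1); apply/Qturn/Qturn.
Qed.

End spirals_of_quarters.

End spirals.

(** * Images of integral edges under the twist *)

Definition points (s : seq zpt) : seq zbox := [seq (x, x) | x <- s].

Definition K_points : seq zbox :=
  points [:: (0, 0); (40, 0); (-40, 0); (0, 40); (0, -40); (80, 0)]%binz.

(* Images under the twist of the edges that cross one of the two annuli where it is
   not locally a rotation. *)
Definition twist_table : seq ((zpt * zpt) * seq zpt) :=
  [:: ((0, -160), (0, -140), [:: (155, 0); (0, 150); (-145, 0); (0, -140)]);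
      ((0, -140), (0, -160), [:: (-145, 0); (0, 150); (155, 0); (0, -160)]);
      ((0, -70), (0, -60), [:: (-65, 0); (0, 60)]);
      ((0, -60), (0, -70), [:: (-65, 0); (0, -70)]);
      ((0, 70), (0, 60), [:: (65, 0); (0, -60)]);
      ((0, 60), (0, 70), [:: (65, 0); (0, 70)])]%binz.

Definition zpt_eqb (x y : zpt) : bool := Z.eqb x.1 y.1 && Z.eqb x.2 y.2.
Definition zopp (x : zpt) : zpt := (Z.opp x.1, Z.opp x.2).

(** Up to radius 60, that is 3/2, the final twist is a half turn: the image is the opposite edge,
    and it is this one that must avoid the punctures. *)
Definition inner_edge (a b : zpt) : bool :=
  [&& Z.leb (zdot a a) (60 * 60), Z.leb (zdot b b) (60 * 60)
    & hull_free K_points [:: zopp a; zopp b]].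

(** The half-plane with normal [n] at distance 70, that is 7/4, from the origin, squared to stay
    integral. By convexity, testing both ends of an edge keeps all of it in the zone where the final
    twist is the identity, up to radius 7/2. *)
Definition far_from_origin (x n : zpt) : bool :=
  Z.leb 0 (zdot n x) && Z.leb (70 * 70 * zdot n n) (zdot n x * zdot n x).

Definition outer_edge (a b : zpt) : bool :=
  [&& Z.leb (zdot a a) (140 * 140), Z.leb (zdot b b) (140 * 140),
      has (fun n => [&& Z.ltb 0 (zdot n n), far_from_origin a n & far_from_origin b n])
        (normals [:: a; b])
    & hull_free K_points [:: a; b]].

(** [None] is a refusal: the edge is neither tabulated nor certified to lie in a zone of constant
    angle. *)
Definition twist_edge (a b : zpt) : option (seq zpt) :=
  if ohead [seq x.2 | x <- twist_table & zpt_eqb x.1.1 a && zpt_eqb x.1.2 b] is Some s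
  then Some s
  else if inner_edge a b then Some [:: zopp b]
  else if outer_edge a b then Some [:: b] else None.

Fixpoint twist_polygon (a : zpt) (L : seq zpt) : option (seq zpt) :=
  if L is b :: L' then
    if twist_edge a b is Some s then
      if twist_polygon b L' is Some M then Some (s ++ M) else None
    else None
  else Some [::].

Section twist.
Variable R : realType.
Local Notation C := (R * R)%type.
Local Notation disk := (@disk R).
Local Notation u0 := (u0 R).
Local Notation K := (K_config R).
Local Notation zr := (@zr R).
Local Notation emb := (@emb R).
Implicit Types (p e v w y : C) (L : seq C).

Lemma covers_points (s : seq zpt) (M : set C) :
  (forall p, M p -> p \in map emb s) -> covers (points s) M.
Proof.
move=> Ms p /Ms /mapP[x xs ->]; exists (x, x); first by apply: map_f.
by rewrite /in_zbox /emb /= ![40 * _]mulrC !divfK// !lexx.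
Qed.

Lemma covers_K : covers K_points K.
Proof.
apply: covers_points => p.
suff <- : K_seq R = map emb
    [:: (0, 0); (40, 0); (-40, 0); (0, 40); (0, -40); (80, 0)]%binz by [].
rewrite /= /emb /= /K_seq; zr_eval.
by do !(congr cons; first by congr pair; lra).
Qed.

(* At time 1 the twist is the rotation by [pi] for [r <= 3/2] and the identity for
   [7/4 <= r <= 7/2] and for [r = 4]; the angle is affine in between. *)
Definition twist_angle (t r : R) : R :=
  pi * (1 - stage 6 4 r) * stage 0 2 t
  + 2 * pi * (stage 6 4 r - stage 7 2 r) * stage 1 2 t.

Definition twist (t : R) y : C := rot (twist_angle t (Num.sqrt (normsq y))) y.

Lemma normsq_twist t y : normsq (twist t y) = normsq y.
Proof. exact: normsq_rot. Qed.

(** Each circle around 0 is mapped to itself by a rotation. Hence a twisted loop never meets the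
    twisted punctures. *)
Lemma twist_inj t : injective (twist t).
Proof.
move=> x y e; move: (e); rewrite /twist.
have -> : normsq x = normsq y by rewrite -(normsq_twist t) e normsq_twist.
exact: rot_inj.
Qed.

Lemma twist0 y : twist 0 y = y.
Proof. by rewrite /twist /twist_angle !stage0 !mulr0 addr0 rot0. Qed.

Lemma stage_small k n (r : R) : n%:R * r <= k%:R -> stage k n r = 0.
Proof. by move=> h; apply/max_idPl; rewrite ge_min subr_le0 h orbT. Qed.

Lemma stage_large k n (r : R) : k%:R + 1 <= n%:R * r -> stage k n r = 1.
Proof. by move=> h; rewrite /stage (min_idPl _) ?(max_idPr _)//; lra. Qed.

Lemma stage_affine k n (r : R) : k%:R <= n%:R * r <= k%:R + 1 ->
  stage k n r = n%:R * r - k%:R.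
Proof.
by move=> /andP[h1 h2]; rewrite /stage (min_idPr _) ?(max_idPr _)//; lra.
Qed.

Lemma twist_angle1 (r : R) :
  twist_angle 1 r = pi * (1 + stage 6 4 r - 2 * stage 7 2 r).
Proof. by rewrite /twist_angle !stage1//; ring. Qed.

Lemma twist_beta i t : twist t (beta_fun i 0) = beta_fun i t.
Proof.
rewrite {1}/beta_fun !stage0 !mulr0 if_same rot0 /twist /beta_fun /twist_angle.
have S (k : nat) : (Num.sqrt (k%:R ^+ 2) = k%:R :> R) by rewrite sqrtr_sqr ger0_norm.
have S0 : Num.sqrt (normsq (0 : R, 0 : R)) = 0.
  by rewrite /normsq /= expr0n addr0 sqrtr0.
have S1 (x y : R) : x ^+ 2 + y ^+ 2 = 1 -> Num.sqrt (normsq (x, y)) = 1.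
  by rewrite /normsq /= => ->; rewrite sqrtr1.
have S2 : Num.sqrt (normsq (2 : R, 0 : R)) = 2.
  by rewrite /normsq /= expr0n addr0 (S 2%N).
(* The punctures have moduli 0, 1 and 2: the first two lie below the transition from 3/2 to 7/4, the
   last between it and the one from 7/2 to 4. *)
have A0 : @stage R 6 4 0 = 0 by apply: stage_small; lra.
have A1 : @stage R 6 4 1 = 0 by apply: stage_small; lra.
have A2 : @stage R 6 4 2 = 1 by apply: stage_large; lra.
have B0 : @stage R 7 2 0 = 0 by apply: stage_small; lra.
have B1 : @stage R 7 2 1 = 0 by apply: stage_small; lra.
have B2 : @stage R 7 2 2 = 0 by apply: stage_small; lra.
by case: i => [[|[|[|[|[|[|//]]]]]] ?] /=;
  rewrite ?S2 ?S0 ?S1 ?A0 ?A1 ?A2 ?B0 ?B1 ?B2; try (by ring); congr (rot _ _); ring.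
Qed.

Lemma twist_continuous (f : R * R -> C) : {within unit_itv `*` unit_itv, continuous f} ->
  {within unit_itv `*` unit_itv, continuous (fun x => twist x.1 (f x))}.
Proof.
move=> cf; apply: (@within_comp (R * R)%type (R * C)%type C _ setT (fun x => (x.1, f x))
  (fun p : R * C => twist p.1 p.2)) => //.
  by apply: within_pair => //; apply: continuous_subspaceT => x; exact: cvg_fst.
apply: continuous_subspaceT.
have cr : continuous (fun p : R * C => Num.sqrt (normsq p.2)).
  move=> p; apply: continuous_comp; last exact: sqrt_continuous.
  by apply: continuous_comp; [exact: cvg_snd|exact: normsq_continuous].
have cst k n : continuous (fun p : R * C => @stage R k n p.1).
  by move=> p; apply: continuous_comp; [exact: cvg_fst|exact: continuous_stage].
have csr k n : continuous (fun p : R * C => @stage R k n (Num.sqrt (normsq p.2))).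
  by move=> p; apply: (continuous_comp (cr p)); exact: continuous_stage.
have ca : continuous (fun p : R * C => twist_angle p.1 (Num.sqrt (normsq p.2))).
  move=> p; apply: cvgD; apply: cvgM; try exact: cst; apply: cvgM; try exact: cvg_cst.
    by apply: cvgB; [exact: cvg_cst|exact: csr].
  by apply: cvgB; exact: csr.
have c1 : continuous (fun p : R * C => p.2.1).
  by move=> p; apply: (@continuous_comp _ _ _ (@snd R C) fst); [exact: cvg_snd|exact: cvg_fst].
have c2 : continuous (fun p : R * C => p.2.2).
  by move=> p; apply: (@continuous_comp _ _ _ (@snd R C) snd); [exact: cvg_snd|exact: cvg_snd].
have cc : continuous (fun p : R * C => cos (twist_angle p.1 (Num.sqrt (normsq p.2)))).
  by move=> p; apply: (continuous_comp (ca p)); exact: continuous_cos.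
have cs : continuous (fun p : R * C => sin (twist_angle p.1 (Num.sqrt (normsq p.2)))).
  by move=> p; apply: (continuous_comp (ca p)); exact: continuous_sin.
apply: cts_pair => p.
- by apply: cvgB; apply: cvgM; [exact: cc|exact: c1|exact: cs|exact: c2].
- by apply: cvgD; apply: cvgM; [exact: cs|exact: c1|exact: cc|exact: c2].
Qed.
Local Notation X := (disk `\` K).

Lemma modulus_le (c : R) y : 0 <= c -> normsq y <= c ^+ 2 -> Num.sqrt (normsq y) <= c.
Proof. by move=> c0 /ler_wsqrtr; rewrite sqrtr_sqr ger0_norm. Qed.

Lemma modulus_ge (c : R) y : 0 <= c -> c ^+ 2 <= normsq y -> c <= Num.sqrt (normsq y).
Proof. by move=> c0 /ler_wsqrtr; rewrite sqrtr_sqr ger0_norm. Qed.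

Lemma twist_inner y : normsq y <= (3 / 2) ^+ 2 -> twist 1 y = - y.
Proof.
move=> /modulus_le h; have {}h : Num.sqrt (normsq y) <= 3 / 2 by apply: h; lra.
rewrite /twist twist_angle1 !stage_small; [|lra|lra].
by rewrite mulr0 subr0 addr0 mulr1 rot_pi; case: y {h}.
Qed.

Lemma twist_outer y : (7 / 4) ^+ 2 <= normsq y <= (7 / 2) ^+ 2 -> twist 1 y = y.
Proof.
move=> /andP[/modulus_ge h1 /modulus_le h2].
have {}h1 : 7 / 4 <= Num.sqrt (normsq y) by apply: h1; lra.
have {}h2 : Num.sqrt (normsq y) <= 7 / 2 by apply: h2; lra.
rewrite /twist twist_angle1 (@stage_large 6) ?stage_small; [|lra|lra].
by rewrite (_ : pi * _ = 2 * pi) ?rot_2pi//; ring.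
Qed.

Lemma inner_edge_traces (a b : zpt) : inner_edge a b ->
  traces X (twist 1 \o seg (emb a) (emb b)) [:: emb (zopp b)].
Proof.
move=> /and3P[na nb free]; have embN x : emb (zopp x) = - emb x.
  by rewrite /emb /zopp /= !zrN; congr pair; rewrite /= mulNr.
have le x : Z.leb (zdot x x) (60 * 60) -> normsq (emb x) <= (3 / 2) ^+ 2.
  move=> /(@zr_le R); rewrite /zdot zrD !zrM; zr_eval => h.
  by rewrite /normsq /emb /=; lra.
apply: traces_eq (traces_seg (hull_free_emb covers_K free)) => t It /=.
rewrite twist_inner; last by apply: normsq_convex => //; exact: le.
by rewrite !embN /seg !scalerN opprD.
Qed.

Lemma outer_edge_traces (a b : zpt) : outer_edge a b ->
  traces X (twist 1 \o seg (emb a) (emb b)) [:: emb b].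
Proof.
move=> /and4P[na nb /hasP[n _ /and3P[n0 an bn]] free].
have le x : Z.leb (zdot x x) (140 * 140) -> normsq (emb x) <= (7 / 2) ^+ 2.
  move=> /(@zr_le R); rewrite /zdot zrD !zrM; zr_eval => h.
  by rewrite /normsq /emb /=; lra.
apply: traces_eq (traces_seg (hull_free_emb covers_K free)) => t It /=.
apply: twist_outer; apply/andP; split; last by apply: normsq_convex => //; exact: le.
pose v : C := (zr n.1, zr n.2).
have v0 : 0 < normsq v.
  by move: n0 => /(@zr_lt R); rewrite /zdot zrD !zrM; zr_eval; rewrite /normsq /= !expr2.
have far x : far_from_origin x n ->
    0 <= dot v (emb x) /\ (7 / 4) ^+ 2 * normsq v <= dot v (emb x) ^+ 2.
  move=> /andP[/(@zr_le R) h1 /(@zr_le R)]; move: h1.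
  rewrite /zdot !(zrD, zrM); zr_eval; rewrite /dot /normsq /v /emb /=.
  by move=> h1 h2; split; lra.
have [a0 ha] := far _ an; have [b0 hb] := far _ bn; move: It.
rewrite unit_itvE => /andP[t0 t1]; set y := seg _ _ t.
have vy : dot v y = (1 - t) * dot v (emb a) + t * dot v (emb b).
  by rewrite /y /dot /seg /= /GRing.scale /=; ring.
(* Cauchy-Schwarz; the difference is the square of the determinant. *)
have cs : dot v y ^+ 2 <= normsq v * normsq y.
  rewrite -subr_ge0 (_ : _ - _ = (v.1 * y.2 - v.2 * y.1) ^+ 2) ?sqr_ge0//.
  by rewrite /dot /normsq; ring.
(* A convex combination of two nonnegative numbers is at least the smaller one, and so are the
   squares. *)
have vy2 : (7 / 4) ^+ 2 * normsq v <= dot v y ^+ 2.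
  rewrite vy; move: (dot v (emb a)) (dot v (emb b)) ha hb a0 b0 => A B ha hb a0 b0.
  have [AB|/ltW AB] := leP A B.
    apply: (le_trans ha); rewrite ler_sqr ?nnegrE//; first by nra.
    by apply: addr_ge0; apply: mulr_ge0 => //; lra.
  apply: (le_trans hb); rewrite ler_sqr ?nnegrE//; first by nra.
  by apply: addr_ge0; apply: mulr_ge0 => //; lra.
by rewrite -(ler_pM2r v0) (le_trans vy2)// mulrC.
Qed.

Lemma radial_twist e (r0 r1 a0 a1 : R) : normsq e = 1 -> 0 <= r0 -> 0 <= r1 ->
  (forall t, unit_itv t ->
     twist_angle 1 (r0 + (r1 - r0) * t) = a0 + (a1 - a0) * t) ->
  forall t, unit_itv t ->
    twist 1 (seg (r0 *: e) (r1 *: e) t) = spiral 0 e r0 r1 a0 a1 t.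
Proof.
move=> e1 r00 r10 ang t It; have := It; rewrite unit_itvE => /andP[t0 t1].
have -> : seg (r0 *: e) (r1 *: e) t = (r0 + (r1 - r0) * t) *: e.
  by rewrite /seg !scalerA -scalerDl; congr (_ *: _); ring.
rewrite /spiral add0r -ang//; set r := r0 + _.
have r_ge0 : 0 <= r by rewrite /r; nra.
have nr : normsq (r *: e) = r ^+ 2.
  by rewrite -[RHS]mulr1 -e1 /normsq /= /GRing.scale /=; ring.
rewrite /twist nr sqrtr_sqr ger0_norm//; case: (e) => x y.
by rewrite /rot /=; congr pair; rewrite /= /GRing.scale /=; ring.
Qed.

Definition is_axis v := (v.1 == 0) && (v.2 ^+ 2 == 1) || (v.2 == 0) && (v.1 ^+ 2 == 1).

Definition in_band (r0 r1 : R) := 3 / 2 <= r0 <= 7 / 4 /\ 3 / 2 <= r1 <= 7 / 4 \/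
  7 / 2 <= r0 <= 4 /\ 7 / 2 <= r1 <= 4.

(** For [v] and [w] along the axes the product of the coordinates of a v + b w is a b up to sign.
    All punctures lie on the axes, so meeting one forces a b = 0, and then a + b is its modulus: at
    least m > 1 and at most M, which excludes the moduli 0, 1 and 2. *)
Lemma axis_cone v w (m M : R) :
  is_axis v -> (w = (- v.2, v.1) \/ w = (v.2, - v.1)) ->
  1 < m -> M <= 4 -> 0 <= M -> 2 < m \/ M < 2 ->
  truncated_cone 0 v w m M `<=` X.
Proof.
move=> av vw m1 M4 M0 mM _ [[a b] /= [-> a0 b0 mab abM]]; rewrite add0r.
have nv : v.1 ^+ 2 + v.2 ^+ 2 = 1.
  by move: av => /orP[] /andP[/eqP -> /eqP ->]; rewrite expr0n ?addr0 ?add0r.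
set y := _ + _.
have ny : normsq y = normsq (a, b).
  rewrite -[RHS]mulr1 -nv /y /normsq; case: vw => ->;
  by rewrite /= /GRing.scale /=; ring.
have yy : (y.1 * y.2) ^+ 2 = (a * b) ^+ 2.
  have v12 : (v.1 ^+ 2 - v.2 ^+ 2) ^+ 2 = 1 /\ v.1 * v.2 = 0.
    by move: av => /orP[] /andP[/eqP -> /eqP ->]; split; ring.
  have [v12s v120] := v12.
  have : y.1 * y.2 = (a ^+ 2 - b ^+ 2) * (v.1 * v.2) + a * b * (v.1 ^+ 2 - v.2 ^+ 2) \/
      y.1 * y.2 = (a ^+ 2 - b ^+ 2) * (v.1 * v.2) - a * b * (v.1 ^+ 2 - v.2 ^+ 2).
    by rewrite /y; case: vw => ->; [left|right]; rewrite /= /GRing.scale /=; ring.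
  by case=> ->; rewrite v120 mulr0 add0r ?sqrrN exprMn v12s mulr1.
split; first by rewrite /Defs.disk /= ny (le_trans abM)// ler_sqr ?nnegrE.
have KP q : q \in K_seq R -> q.1 * q.2 = 0 /\ (normsq q <= 1 \/ normsq q = 4).
  by move: q; apply: seq6P; split; rewrite /normsq /=; split; try ring;
    first [by left; lra | by right; ring].
move=> /KP[y12 ly]; move: yy; rewrite y12 expr0n => /esym/eqP; rewrite expf_eq0 /= => /eqP ab0.
have ab2 : (a + b) ^+ 2 = normsq y by rewrite ny /normsq /= sqrrD ab0 mul0rn addr0.
clear vw; case: ly => ly; first by nra.
by case: mM => mM; nra.
Qed.
Lemma is_axis_turn (s : R) v : s = 1 \/ s = - 1 -> is_axis v -> is_axis (turn s v).
Proof.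
rewrite /is_axis /turn /= orbC => -[] -> /orP[] /andP[/eqP h1 /eqP h2];
by rewrite h1 ?mul1r ?mulN1r ?opprK ?oppr0 ?sqrrN h2 !eqxx ?orbT.
Qed.

Lemma in_band_cone (r0 r1 s : R) : s = 1 \/ s = - 1 -> in_band r0 r1 ->
  exists m M, [/\ 0 <= m, m <= r0 <= M, m <= r1 <= M &
    forall v, is_axis v -> truncated_cone 0 v (turn s v) m M `<=` X].
Proof.
move=> s1 band; have vw v : turn s v = (- v.2, v.1) \/ turn s v = (v.2, - v.1).
  by case: s1 => ->; [left|right]; rewrite /turn ?mul1r ?mulN1r ?opprK.
case: band => -[h0 h1]; [exists (3 / 2), (7 / 4)|exists (7 / 2), 4];
  split => //; try lra; move=> v av; apply: (axis_cone av (vw v));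
  first [lra | right; lra | left; lra].
Qed.

Lemma twist_table_traces (x : (zpt * zpt) * seq zpt) : x \in twist_table ->
  traces X (twist 1 \o seg (emb x.1.1) (emb x.1.2)) (map emb x.2).
Proof.
have ax (k : R) : k = 1 \/ k = - 1 -> is_axis (0, k).
  by case=> ->; rewrite /is_axis /= eqxx ?sqrrN expr1n eqxx.
have axn (k : R) : k = 1 \/ k = - 1 -> normsq (0, k) = 1.
  by case=> ->; rewrite /normsq /= ?sqrrN; ring.
(* Here k chooses the half of the imaginary axis, s the sense of rotation and a the angle at the
   beginning of the edge. *)
have full (k r0 r1 s a : R) : k = 1 \/ k = - 1 -> s = 1 \/ s = - 1 ->
    rot a (0, k) = (0, k) -> in_band r0 r1 ->
    (forall t, unit_itv t ->
     twist_angle 1 (r0 + (r1 - r0) * t) = a + (a + s * (2 * pi) - a) * t) ->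
    traces X (twist 1 \o seg (r0 *: (0, k)) (r1 *: (0, k)))
      [:: ((r0 + (r0 + r1) / 2) / 2) *: turn s (0, k);
        ((r0 + r1) / 2) *: - (0, k);
        (((r0 + r1) / 2 + r1) / 2) *: - turn s (0, k);
        r1 *: (0, k)].
  move=> k1 s1 ra band ang.
  have r0p : 0 <= r0 by case: band => -[]; lra.
  have r1p : 0 <= r1 by case: band => -[]; lra.
  apply: (traces_eq (radial_twist (axn _ k1) r0p r1p ang)).
  have [m [M [m0 h0 h1 cX]]] := in_band_cone s1 band.
  have := full_turn_traces (Q := [set v | is_axis v]) s1 m0 cX
    (fun v => is_axis_turn s1) _ h0 h1 (e := (0, k)) (a := a).
  by rewrite !add0r ra; apply; exact: ax.
have half (k r0 r1 s a : R) (v : C) : k = 1 \/ k = - 1 -> s = 1 \/ s = - 1 ->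
    rot a (0, k) = v -> is_axis v -> in_band r0 r1 ->
    (forall t, unit_itv t ->
     twist_angle 1 (r0 + (r1 - r0) * t) = a + (a + s * pi - a) * t) ->
    traces X (twist 1 \o seg (r0 *: (0, k)) (r1 *: (0, k)))
      [:: ((r0 + r1) / 2) *: turn s v; r1 *: - v].
  move=> k1 s1 ra av band ang.
  have r0p : 0 <= r0 by case: band => -[]; lra.
  have r1p : 0 <= r1 by case: band => -[]; lra.
  apply: (traces_eq (radial_twist (axn _ k1) r0p r1p ang)).
  have [m [M [m0 h0 h1 cX]]] := in_band_cone s1 band.
  have := half_turn_traces (Q := [set v | is_axis v]) s1 m0 cX
    (fun v => is_axis_turn s1) _ h0 h1 (e := (0, k)) (a := a).
  by rewrite !add0r ra; apply.
have conv (a b a' b' : C) L L' : a = a' -> b = b' -> L = L' ->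
    traces X (twist 1 \o seg a b) L -> traces X (twist 1 \o seg a' b') L'.
  by move=> -> -> ->.
have axN : is_axis (0, - - 1) by rewrite opprK; apply: ax; left.
(* Near the base point the angle falls from 2 pi to 0; across the gate between the block and the
   point 2 it grows from pi to 2 pi. *)
have base r : 7 / 2 <= r <= 4 -> twist_angle 1 r = 16 * pi - 4 * pi * r.
  move=> /andP[h1 h2]; rewrite twist_angle1 (@stage_large 6) ?stage_affine; lra.
have gate r : 3 / 2 <= r <= 7 / 4 -> twist_angle 1 r = 4 * pi * r - 5 * pi.
  move=> /andP[h1 h2]; rewrite twist_angle1 stage_affine ?stage_small; lra.
have one : (1 : R) = 1 \/ (1 : R) = - 1 by left.
have mone : (- 1 : R) = 1 \/ (- 1 : R) = - 1 by right.
have rp (k : R) : rot pi (0, k) = (0, - k) by rewrite rot_pi /= oppr0.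
(* The tabulated vertices are the ends of the quarter turns: radii 155, 150, 145 between 160 and
   140, and 65 between 70 and 60. The starting angle is 0 at radius 4, 2 pi at 7/2 and 7/4, pi at
   3/2. *)
rewrite !in_cons => /or4P[/eqP->|/eqP->|/eqP->|/or4P[/eqP->|/eqP->|/eqP->|//]].
- apply: (conv _ _ _ _ _ _ _ _ _ (@full (- 1) 4 (7 / 2) 1 0 mone one (rot0 _) _ _)).
  + by apply: pair_eq; rewrite /emb /turn /= /GRing.scale /=; zr_eval; lra.
  + by apply: pair_eq; rewrite /emb /turn /= /GRing.scale /=; zr_eval; lra.
  + by do !(congr cons; first by apply: pair_eq; rewrite /emb /turn /= /GRing.scale /=; zr_eval; lra).
  + by right; split; apply/andP; split; lra.
  + by move=> t; rewrite unit_itvE => /andP[t0 t1]; rewrite base; [lra|apply/andP; split; lra].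
- apply: (conv _ _ _ _ _ _ _ _ _ (@full (- 1) (7 / 2) 4 (- 1) (2 * pi) mone mone (rot_2pi _) _ _)).
  + by apply: pair_eq; rewrite /emb /turn /= /GRing.scale /=; zr_eval; lra.
  + by apply: pair_eq; rewrite /emb /turn /= /GRing.scale /=; zr_eval; lra.
  + by do !(congr cons; first by apply: pair_eq; rewrite /emb /turn /= /GRing.scale /=; zr_eval; lra).
  + by right; split; apply/andP; split; lra.
  + by move=> t; rewrite unit_itvE => /andP[t0 t1]; rewrite base; [lra|apply/andP; split; lra].
- apply: (conv _ _ _ _ _ _ _ _ _ (@half (- 1) (7 / 4) (3 / 2) (- 1) (2 * pi) _ mone mone (rot_2pi _) (ax _ mone) _ _)).
  + by apply: pair_eq; rewrite /emb /turn /= /GRing.scale /=; zr_eval; lra.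
  + by apply: pair_eq; rewrite /emb /turn /= /GRing.scale /=; zr_eval; lra.
  + by do !(congr cons; first by apply: pair_eq; rewrite /emb /turn /= /GRing.scale /=; zr_eval; lra).
  + by left; split; apply/andP; split; lra.
  + by move=> t; rewrite unit_itvE => /andP[t0 t1]; rewrite gate; [lra|apply/andP; split; lra].
- apply: (conv _ _ _ _ _ _ _ _ _ (@half (- 1) (3 / 2) (7 / 4) 1 pi _ mone one (rp _) axN _ _)).
  + by apply: pair_eq; rewrite /emb /turn /= /GRing.scale /=; zr_eval; lra.
  + by apply: pair_eq; rewrite /emb /turn /= /GRing.scale /=; zr_eval; lra.
  + by do !(congr cons; first by apply: pair_eq; rewrite /emb /turn /= /GRing.scale /=; zr_eval; lra).
  + by left; split; apply/andP; split; lra.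
  + by move=> t; rewrite unit_itvE => /andP[t0 t1]; rewrite gate; [lra|apply/andP; split; lra].
- apply: (conv _ _ _ _ _ _ _ _ _ (@half 1 (7 / 4) (3 / 2) (- 1) (2 * pi) _ one mone (rot_2pi _) (ax _ one) _ _)).
  + by apply: pair_eq; rewrite /emb /turn /= /GRing.scale /=; zr_eval; lra.
  + by apply: pair_eq; rewrite /emb /turn /= /GRing.scale /=; zr_eval; lra.
  + by do !(congr cons; first by apply: pair_eq; rewrite /emb /turn /= /GRing.scale /=; zr_eval; lra).
  + by left; split; apply/andP; split; lra.
  + by move=> t; rewrite unit_itvE => /andP[t0 t1]; rewrite gate; [lra|apply/andP; split; lra].
- apply: (conv _ _ _ _ _ _ _ _ _ (@half 1 (3 / 2) (7 / 4) 1 pi _ one one (rp _) (ax _ mone) _ _)).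
  + by apply: pair_eq; rewrite /emb /turn /= /GRing.scale /=; zr_eval; lra.
  + by apply: pair_eq; rewrite /emb /turn /= /GRing.scale /=; zr_eval; lra.
  + by do !(congr cons; first by apply: pair_eq; rewrite /emb /turn /= /GRing.scale /=; zr_eval; lra).
  + by left; split; apply/andP; split; lra.
  + by move=> t; rewrite unit_itvE => /andP[t0 t1]; rewrite gate; [lra|apply/andP; split; lra].
Qed.
End twist.

(** * Action of beta on integral polygons *)

Section beta_action.
Variable R : realType.
Local Notation C := (R * R)%type.
Local Notation disk := (@disk R).
Local Notation u0 := (u0 R).
Local Notation K := (K_config R).
Local Notation emb := (@emb R).
Local Notation X := (disk `\` K).

Lemma twist_edge_traces (a b : zpt) s : twist_edge a b = Some s ->
  traces X (twist 1 \o seg (emb a) (emb b)) (map emb s).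
Proof.
rewrite /twist_edge; case E : (ohead _) => [s'|].
  move=> [<-]; move: E; case F : [seq _ | _ <- _ & _] => [//|c l] [<-].
  have : c \in c :: l by rewrite inE eqxx.
  rewrite -F => /mapP[x]; rewrite mem_filter => /andP[/andP[xa xb] /twist_table_traces + ->].
  by move: xa xb; rewrite /zpt_eqb => /andP[/Z.eqb_eq xa1 /Z.eqb_eq xa2]
    /andP[/Z.eqb_eq xb1 /Z.eqb_eq xb2]; rewrite [x.1.1]surjective_pairing xa1 xa2
    [x.1.2]surjective_pairing xb1 xb2 -!surjective_pairing.
case: ifPn => [/inner_edge_traces h [<-] //|_].
by case: ifPn => [/outer_edge_traces h [<-] //|].
Qed.

(** Provides the nonempty first polygon that [traces_catp] requires. *)
Lemma twist_edge_cons (a b : zpt) s : twist_edge a b = Some s ->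
  exists c s', s = c :: s'.
Proof.
rewrite /twist_edge; case E : (ohead _) => [s'|].
  move=> [<-]; move: E; case F : [seq _ | _ <- _ & _] => [//|c l] [<-].
  have : c \in c :: l by rewrite inE eqxx.
  rewrite -F => /mapP[x]; rewrite mem_filter => /andP[_ + ->].
  by rewrite !in_cons => /or4P[/eqP->|/eqP->|/eqP->|/or4P[/eqP->|/eqP->|/eqP->|//]] /=;
    eexists; eexists.
case: ifPn => [_ [<-]|_]; first by eexists; eexists.
by case: ifPn => [_ [<-]|//]; eexists; eexists.
Qed.

Lemma twist_polygon_traces (a : zpt) L M : X (twist 1 (emb a)) ->
  twist_polygon a L = Some M ->
  traces X (twist 1 \o polygon (emb a) (map emb L)) (map emb M).
Proof.
elim: L a M => [|b L IH] a M Xa /=.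
  move=> [<-]; split=> //; apply: path_homotopic_eq => //.
  exact: (is_path_cst Xa).
case E : (twist_edge a b) => [s|//]; case F : (twist_polygon b L) => [M'|//] [<-].
have tE := twist_edge_traces E; have [c [s' se]] := twist_edge_cons E.
have e1 : (twist 1 \o seg (emb a) (emb b)) 1 = twist 1 (emb b) by rewrite /= seg1.
have Xb : X (twist 1 (emb b)).
  rewrite -e1; have [[_ h] _] := path_homotopic_path tE.2.
  exact: h.
have tL := IH _ _ Xb F.
rewrite map_cat se /= -cat_cons.
apply: (traces_eq (g := catp (twist 1 \o seg (emb a) (emb b))
    (twist 1 \o polygon (emb b) (map emb L)))) => [t It|].
  by rewrite /= /catp; case: ifP.
apply: traces_catp => //; last by move: tE; rewrite se.
by rewrite /= seg1 polygon0.
Qed.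

Lemma twist_avoids i t y : y <> beta_fun i 0 -> twist t y <> beta_fun i t :> C.
Proof. by move=> yi; rewrite -twist_beta => /twist_inj. Qed.

Lemma twist_u0 t : twist t u0 = u0.
Proof.
rewrite /twist /twist_angle (_ : Num.sqrt _ = 4); last first.
  by rewrite /normsq /= expr0n add0r sqrrN sqrtr_sqr ger0_norm.
rewrite !(@stage_large R 6) ?(@stage_large R 7) ?subrr; [|lra|lra].
by rewrite !(mulr0, mul0r) addr0 rot0.
Qed.

(** The twisted polygons form an admissible family for [transport_loops]: the twist fixes u0,
    preserves the disk and, being injective, keeps the loop off the points that it carries. *)
Lemma beta_zclass (B : realization (beta_motion R)) L M :
  is_zloop K_points L -> twist_polygon zu0 L = Some M ->
  pi1_map (induced_diffeo B) (zclass K L) = zclass K M.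
Proof.
move=> lL LM; have pL := is_zloop_emb (@covers_K R) lL.
have [[cL XL] L0 L1] := pL.
pose F (x : R * R) := twist x.1 (polygon u0 (map emb L) x.2).
have FE0 : (fun t => F (0, t)) = polygon u0 (map emb L).
  by apply/funext => t; rewrite /F /= twist0.
have := @transport_loops _ _ _ _ _ B F; rewrite FE0 => -> //.
- have tr := @twist_polygon_traces zu0 L M; rewrite emb_u0 twist_u0 in tr.
  have [|h1 h2] := tr _ LM; first exact: punctured_base.
  rewrite /= polygon0 twist_u0 in h1 h2.
  apply: path_class_homotopic => //.
  have [p1 _] := path_homotopic_path h2.
  by split => //; rewrite /F /= ?polygon0 ?twist_u0// L1 twist_u0.
- by apply: twist_continuous; exact: snd_continuous.
- move=> s t Is It; have [DL KL] := XL _ It; rewrite /F /=; split.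
    by rewrite /Defs.disk /= normsq_twist.
  move=> i; apply: twist_avoids => e; apply: KL.
  by rewrite -(mo_start (beta_motion R)) e; exists i.
- by move=> s Is; rewrite /F /= polygon0 L1 twist_u0.
Qed.

End beta_action.

(** * The loops of the g-base *)

Section lassos.
Variable R : realType.
Local Notation C := (R * R)%type.
Local Notation disk := (@disk R).
Local Notation u0 := (u0 R).
Local Notation emb := (@emb R).
Local Notation zr := (@zr R).
Local Notation X := (disk `\` model_config R).

Lemma model_seq_sep (p q : C) : p \in model_seq R -> q \in model_seq R ->
  [/\ p.2 = 0, -1 <= p.1 <= 7 / 2 & q = p \/ 4^-1 <= normsq (q - p)].
Proof.
have sep (x y : R) : x + 2^-1 <= y \/ y + 2^-1 <= x ->
    4^-1 <= normsq ((x, 0) - (y, 0) : C).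
  by rewrite /normsq /= => -[] h; nra.
by move: p; apply: seq6P; split; move: q; apply: seq6P; split;
  (split => //=; first by apply/andP; split; lra);
  first [by left | by right; apply: sep; left; lra | by right; apply: sep; right; lra].
Qed.

(** The cone lies within radius |v| / 20 of p, while other model points are at distance at least
    1/2; p itself is excluded by a + b > 0. *)
Lemma lasso_cone (i : 'I_6) (v : C) : let p := model_point R i in
  normsq v = normsq (u0 - p) ->
  truncated_cone p v (turn 1 v) 20^-1 20^-1 `<=` X.
Proof.
move=> p nv _ [[a b] /= [-> a0 b0 mab abM]].
have pm : p \in model_seq R by apply: mem_nth; exact: ltn_ord.
have [p2 /andP[p1 p1'] _] := model_seq_sep pm pm.
set y := _ + _; have ny : normsq (y - p) = normsq (a, b) * normsq v.
  by rewrite /y /normsq /turn /= /GRing.scale /=; ring.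
have nv' : normsq v = p.1 ^+ 2 + 16.
  by rewrite nv /normsq /u0 /= p2; ring.
have ab : normsq (a, b) * 400 <= 1 by move: abM; rewrite /normsq /=; lra.
have ab0 : 0 < normsq (a, b).
  have := sqr_ge0 (a - b); have : 0 < (a + b) ^+ 2 by apply: exprn_gt0; lra.
  by rewrite /normsq /= sqrrD sqrrB => ? ?; lra.
have v30 : normsq v <= 30 by rewrite nv'; nra.
have v0 : 16 <= normsq v by rewrite nv'; nra.
(* Here 30/400 < 1/12, small against the squared separation 1/4 and small enough to remain in the
   disk when p is 7/2. *)
have y1 : normsq (y - p) * 12 <= 1.
  by rewrite ny; have := ler_wpM2l (ltW ab0) v30; lra.
split; last first.
  move=> ym; have [_ _ [yp|]] := model_seq_sep pm ym; last by lra.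
  have pp : normsq (p - p) = 0 by rewrite /normsq /= !subrr expr0n addr0.
  by have : 0 < normsq v by [lra]; move=> /(mulr_gt0 ab0); rewrite -ny yp pp ltxx.
clearbody y; case: y {ny} y1 => y1 y2.
rewrite /Defs.disk /normsq /= p2 subr0 => h.
have hx : (y1 - p.1) ^+ 2 <= 12^-1 by have := sqr_ge0 y2; lra.
have hy : y2 ^+ 2 <= 12^-1 by have := sqr_ge0 (y1 - p.1); lra.
have : y1 - p.1 <= 3^-1 by nra.
have : - 3^-1 <= y1 - p.1 by nra.
by move=> ? ?; nra.
Qed.

Lemma lasso_traces (i : 'I_6) : let p := model_point R i in
  let v := 20^-1 *: (u0 - p) in
  traces X (lasso p) [:: p + v; p + turn 1 v; p - v; p - turn 1 v; p + v; u0].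
Proof.
move=> p v.
have pX : is_path X (lasso p).
  by split; [exact: lasso_continuous|move=> t _; exact: lasso_in].
(* The lasso changes stage at 1/3 and 2/3, the nested concatenation at 1/2 and 3/4; this convex
   function matches them. *)
pose phi (t : R) := Num.max (2 / 3 * t + 0) (4 / 3 * t + (- 3^-1)).
pose g := catp (seg u0 (p + v))
  (catp (spiral p (u0 - p) 20^-1 20^-1 0 (0 + 1 * (2 * pi))) (seg (p + v) u0)).
have gE t : unit_itv t -> g t = lasso p (phi t).
  rewrite unit_itvE => /andP[t0 t1]; rewrite /g /catp /phi /lasso.
  have [t2|t2] := leP t 2^-1.
    rewrite (max_idPl _); last by lra.
    have -> : stage 0 3 (2 / 3 * t + 0) = 2 * t by rewrite stage_affine; lra.
    have -> : stage 1 3 (2 / 3 * t + 0) = 0 by rewrite stage_small; lra.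
    have -> : stage 2 3 (2 / 3 * t + 0) = 0 by rewrite stage_small; lra.
    rewrite mulr0 rot0 subr0 /seg /v; case: (u0) (p) => [x1 x2] [y1 y2].
    by congr pair; rewrite /= /GRing.scale /=; field.
  rewrite (max_idPr _); last by lra.
  have -> : stage 0 3 (4 / 3 * t + (- 3^-1)) = 1 by rewrite stage_large; lra.
  have [t4|t4] := leP (2 * t - 1) 2^-1.
    have -> : stage 1 3 (4 / 3 * t + (- 3^-1)) = 2 * (2 * t - 1).
      by rewrite stage_affine; lra.
    have -> : stage 2 3 (4 / 3 * t + (- 3^-1)) = 0 by rewrite stage_small; lra.
    rewrite /spiral; congr (p + _ *: rot _ _); first by field.
    by ring.
  have -> : stage 1 3 (4 / 3 * t + (- 3^-1)) = 1 by rewrite stage_large; lra.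
  have -> : stage 2 3 (4 / 3 * t + (- 3^-1)) = 2 * (2 * t - 1) - 1.
    by rewrite stage_affine; lra.
  rewrite mulr1 rot_2pi /seg /v; case: (u0) (p) => [x1 x2] [y1 y2].
  by congr pair; rewrite /= /GRing.scale /=; field.
have phi0 : phi 0 = 0 by rewrite /phi !mulr0 (max_idPl _); lra.
have phi1 : phi 1 = 1 by rewrite /phi !mulr1 (max_idPr _); lra.
have lg : path_homotopic X (lasso p) g.
  apply: (path_homotopic_reparam (phi := id) (psi := phi) pX) => //.
  - by move=> t; exact: cvg_id.
  - by apply: cts_max; exact: cts_affine.
  - move=> t It; split => //; move: It; rewrite !unit_itvE => /andP[t0 t1].
    rewrite /phi le_max ge_max; apply/andP; split; first by apply/orP; left; lra.
    by apply/andP; split; lra.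
have [_ [cg gX]] := path_homotopic_path lg.
have Xseg : hull [:: u0; p + v] `<=` X.
  have pm : p \in model_seq R by apply: mem_nth; exact: ltn_ord.
  have [p2 /andP[p1 p1'] _] := model_seq_sep pm pm.
  apply: hull_avoids => x; first rewrite in_cons mem_seq1 => /orP[]/eqP->.
  - exact/circle_disk/circle_u0.
  - by rewrite /Defs.disk /normsq /v /= /GRing.scale /= p2; nra.
  - move=> xm; have [x2 _ _] := model_seq_sep xm xm.
    exists (0, -1) => z; rewrite in_cons mem_seq1 /dot /= x2 => /orP[]/eqP->.
      by rewrite /=; lra.
    by rewrite /v /= /GRing.scale /= p2; lra.
have Xseg' : hull [:: p + v; u0] `<=` X.
  by apply: subset_trans Xseg; apply: hull_subset => z; rewrite !in_cons orbCA.
have ra : rot 0 (u0 - p) = u0 - p by exact: rot0.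
have circ : traces X (spiral p (u0 - p) 20^-1 20^-1 0 (0 + 1 * (2 * pi)))
    [:: p + turn 1 v; p - v; p - turn 1 v; p + v].
  have := full_turn_traces (X := X) (Q := [set w | normsq w = normsq (u0 - p)])
    (p := p) (e := u0 - p) (s := 1) (m := 20^-1) (M := 20^-1) (or_introl erefl)
    _ (@lasso_cone i) _ _ (r0 := 20^-1) (r1 := 20^-1) (a := 0).
  rewrite ra !scalerN.
  have -> : (20^-1 + (20^-1 + 20^-1) / 2) / 2 = 20^-1 :> R by field.
  have -> : ((20^-1 + 20^-1) / 2 + 20^-1) / 2 = 20^-1 :> R by field.
  have -> : (20^-1 + 20^-1) / 2 = 20^-1 :> R by field.
  have -> : 20^-1 *: turn 1 (u0 - p) = turn 1 v.
    by rewrite /v /turn; congr pair; rewrite /= /GRing.scale /=; ring.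
  apply => //; try by rewrite lexx.
  by move=> w /= <-; rewrite /normsq /turn /=; ring.
have e1 : spiral p (u0 - p) 20^-1 20^-1 0 (0 + 1 * (2 * pi)) 1 = seg (p + v) u0 0.
  by rewrite spiral1 seg0 mul1r add0r rot_2pi.
have t1 := traces_catp e1 circ (traces_seg Xseg').
have e0 : seg u0 (p + v) 1 = catp (spiral p (u0 - p) 20^-1 20^-1 0 (0 + 1 * (2 * pi)))
    (seg (p + v) u0) 0 by rewrite catp0 seg1 spiral0 ra.
have [h1 h2] := traces_catp e0 (traces_seg Xseg) t1.
have g0 : g 0 = lasso p 0 by rewrite /g catp0 seg0 lasso_start.
rewrite -/g g0 in h1 h2; split=> //; exact: path_homotopic_trans h2.
Qed.
End lassos.

(* The model points, in units of 1/2. *)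
Definition model_abscissas : seq Z := [:: -2; 0; 2; 4; 5; 7]%binz.

Definition model_points : seq zbox :=
  points [seq ((20 * k)%binz, 0%binz) | k <- model_abscissas].

(** With p = (20 k, 0), one twentieth of u0 - p is (-k, -8); this makes the vertices integral in
    fortieths. The circle is replaced by its inscribed square. *)
Definition lasso_polygon (k : Z) : seq zpt :=
  [:: (19 * k, -8); (20 * k + 8, - k); (21 * k, 8); (20 * k - 8, k);
      (19 * k, -8); (0, -160)]%binz.

(* The first four loops, pushed away from the regions swept by the moving points. *)
Definition static_polygons : seq (seq zpt) :=
  [:: [:: (-48, -48); (-20, -20); (-20, 20); (-48, 20); (-48, -48); (0, -160)];
      [:: (-48, -48); (-20, -20); (20, -20); (20, 20); (-20, 20); (-20, -20);
          (-48, -48); (0, -160)];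
      [:: (-48, -48); (-20, -20); (20, -20); (60, -20); (60, 20); (20, 20);
          (20, -20); (-20, -20); (-48, -48); (0, -160)];
      [:: (-48, -48); (-20, -20); (60, -20); (92, -20); (92, 20); (60, 20);
          (60, -20); (-20, -20); (-48, -48); (0, -160)]]%binz.

(* [p] is the current position of the fifth, resp. sixth, point. *)
Definition polygon5 (p : zpt) : seq zpt :=
  [:: (p.1 - 5, p.2 - 8); (p.1 + 8, p.2 - 5); (p.1 + 5, p.2 + 8);
      (p.1 - 8, p.2 + 5); (p.1 - 5, p.2 - 8); (0, -160)]%binz.

(** The stem passes to the right of the whole motion, through (3, -2) and (15/4, 0), so that the
    track of the fifth point never crosses it. *)
Definition polygon6 (p : zpt) : seq zpt :=
  [:: (120, -80); (150, 0); (p.1 + 8, p.2 - 7); (p.1 + 7, p.2 + 8);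
      (p.1 - 8, p.2 + 7); (p.1 - 7, p.2 - 8); (p.1 + 8, p.2 - 7);
      (150, 0); (120, -80); (0, -160)]%binz.

Definition start_polygons : seq (seq zpt) :=
  static_polygons ++ [:: polygon5 (100, 0); polygon6 (140, 0)]%binz.

Definition end_polygons : seq (seq zpt) :=
  static_polygons ++ [:: polygon5 (0, -40); polygon6 (0, 40)]%binz.

Definition fixed_points : seq zpt := [:: (-40, 0); (0, 0); (40, 0); (80, 0)]%binz.

(* Regions swept during the first two stages of the motion, and during the third. *)
Definition sweep1 : seq zbox :=
  points fixed_points ++ [:: ((100, -40), (120, 0)); ((120, 0), (140, 40))]%binz.
Definition sweep2 : seq zbox :=
  points fixed_points ++ [:: ((0, -40), (120, -40)); ((0, 40), (120, 40))]%binz.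

#[local] Arguments Z.add : simpl never.
#[local] Arguments Z.sub : simpl never.
#[local] Arguments Z.opp : simpl never.
#[local] Arguments Z.mul : simpl never.

(** * Polygons following the motion of the g-base *)

Section gbase_action.
Variable R : realType.
Local Notation C := (R * R)%type.
Local Notation disk := (@disk R).
Local Notation u0 := (u0 R).
Local Notation emb := (@emb R).
Local Notation zr := (@zr R).
Local Notation M := (model_config R).
Local Notation K := (K_config R).

Lemma model_pointE (i : 'I_6) :
  model_point R i = (zr (nth 0%binz model_abscissas i) / 2, 0).
Proof.
by case: i => [[|[|[|[|[|[|//]]]]]] ?]; rewrite /model_point /=; zr_eval;
  apply: pair_eq; rewrite /=; lra.
Qed.

Lemma covers_model : covers model_points M.
Proof.
apply: (covers_points (s := [seq ((20 * k)%binz, 0%binz) | k <- model_abscissas])) => p /(nthP u0)[i]; rewrite /= => i6 <-.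
rewrite -[nth _ _ _]/(model_point R (Ordinal i6)) model_pointE.
set k := nth _ _ _; have km : k \in model_abscissas by apply: mem_nth.
have -> : (zr k / 2, 0) = emb ((20 * k)%binz, 0%binz) :> C.
  by apply: pair_eq; rewrite /= ?zrM; zr_eval; lra.
exact: map_f (map_f (fun k => ((20 * k)%binz, 0%binz)) km).
Qed.

Lemma lasso_zclass (i : 'I_6) : loop_class (model_loop R i) =
  zclass M (lasso_polygon (nth 0%binz model_abscissas i)).
Proof.
rewrite -path_class_loop; apply: path_class_homotopic; first exact: is_loop_ploop.
have [_] := lasso_traces R i; rewrite lasso_start.
rewrite [L in polygon _ L](_ : _ =
  map emb (lasso_polygon (nth 0%binz model_abscissas i))); first exact.
rewrite model_pointE; set k := nth _ _ _; rewrite /lasso_polygon [RHS]/=.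
by do !(congr cons; first by
  apply: pair_eq; rewrite /emb /turn /= ?zrD ?zrN ?zrM /GRing.scale /=; zr_eval; lra).
Qed.

(** The first two stages are merged and the circle described by (dx, dy) is relaxed to linear
    inequalities, the form that [lra] can use; dx + dy >= 1/2 still keeps the two moving points
    apart. *)
Lemma gbase_position (t : R) : exists cx dx dy : R,
  (forall i : 'I_6, gbase_fun i t =
     nth u0 [:: (- 1, 0); (0, 0); (1, 0); (2, 0); (cx - dx, - dy); (cx + dx, dy)] i) /\
  ([/\ cx = 3, 0 <= dx <= 2^-1, 0 <= dy <= 1 & 2^-1 <= dx + dy] \/
   [/\ dx = 0, dy = 1 & 0 <= cx <= 3]).
Proof.
pose a := pi / 2 * stage 0 3 t; pose r := (1 + stage 1 3 t) / 2.
exists (3 * (1 - stage 2 3 t)), (cos a * r), (sin a * r); split.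
  by move=> i; rewrite gbase_funE.
have /andP[s2 s2'] := stage_itv 2 3 t.
have [s20|s11] := @stageP R 1 2 3 t isT.
  left; have := gbase_phases t; rewrite -/a -/r s20 => -[[h1 h2 _ h3]|[-> /andP[h1 h2] _]].
    by split; [lra|apply/andP; split; nra|apply/andP; split; nra|nra].
  by split; [lra|apply/andP; split; lra|apply/andP; split; lra|lra].
right; have [s10|s01] := @stageP R 0 1 3 t isT.
  by move: s11; rewrite s10 => /esym/eqP; rewrite oner_eq0.
rewrite /a /r s01 s11 mulr1 cos_pihalf sin_pihalf; split; [lra|lra|].
by apply/andP; split; lra.
Qed.

Lemma gbase_sweep (t : R) :
  covers sweep1 (range (fun i => gbase_fun i t : C)) \/
  covers sweep2 (range (fun i => gbase_fun i t : C)).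
Proof.
have [cx [dx [dy [gE h]]]] := gbase_position t.
have cov (B5 B6 : zbox) : in_zbox (cx - dx, - dy) B5 -> in_zbox (cx + dx, dy) B6 ->
    covers (points fixed_points ++ [:: B5; B6]) (range (fun i => gbase_fun i t : C)).
  move=> h5 h6 _ [i _ <-]; rewrite gE; case: i => [[|[|[|[|[|[|//]]]]]] ?] /=;
    [exists (nth (zu0, zu0) (points fixed_points) 0)|
     exists (nth (zu0, zu0) (points fixed_points) 1)|
     exists (nth (zu0, zu0) (points fixed_points) 2)|
     exists (nth (zu0, zu0) (points fixed_points) 3)|exists B5|exists B6];
    rewrite ?inE ?eqxx ?orbT //; rewrite /in_zbox /=; zr_eval; split; apply/andP; split; lra.
case: h => [[h1 /andP[h2 h3] /andP[h4 h5] h6]|[h1 h2 /andP[h3 h4]]]; [left|right];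
  apply: cov; rewrite /in_zbox /=; zr_eval; split; apply/andP; split; lra.
Qed.

Lemma polygon_family (a : R -> C) (V : seq (R -> C)) :
  {within unit_itv, continuous a} ->
  (forall v, List.In v V -> {within unit_itv, continuous v}) ->
  {within unit_itv `*` unit_itv, continuous
    (fun x : R * R => polygon (a x.1) (map (fun v => v x.1) V) x.2)}.
Proof.
have cfst (f : R -> C) : {within unit_itv, continuous f} ->
    {within unit_itv `*` unit_itv, continuous (fun x : R * R => f x.1)}.
  move=> cf; apply: (within_comp (f := fun x : R * R => x.1)) cf => [x []//|].
  by apply: continuous_subspaceT => x; exact: cvg_fst.
elim: V a => [|b V IH] a ca cV; first exact: cfst.
have cb : {within unit_itv, continuous b} by apply: cV; left.
have {}IH := IH _ cb (fun v Vv => cV v (or_intror Vv)).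
apply: (catp_family_continuous (F := fun x => seg (a x.1) (b x.1) x.2)
  (G := fun x => polygon (b x.1) (map (fun v => v x.1) V) x.2)) => //.
  have c2 : continuous (fun x : R * R => x.2) by move=> x; exact: cvg_snd.
  move=> x; apply: cvgD; apply: cvgZ; [|exact: cfst| |exact: cfst].
    apply: (@continuous_subspaceT _ _ _ (fun x : R * R => 1 - x.2)) => y.
    by apply: cvgB; [exact: cvg_cst|exact: cvg_snd].
  exact: (@continuous_subspaceT _ _ _ (fun x : R * R => x.2)).
by move=> s _ /=; rewrite seg1 polygon0.
Qed.

Lemma transport_polygons (G : realization (gbase_motion R)) (V : seq (R -> C)) :
  (forall v, List.In v V -> {within unit_itv, continuous v}) ->
  (forall s, polygon_in (disk `\` range (fun i => gbase_fun i s))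
     u0 (map (fun v => v s) V)) ->
  (forall s, last u0 (map (fun v => v s) V) = u0) ->
  pi1_map (induced_diffeo G)
    (path_class (punctured M) (polygon u0 (map (fun v => v 0) V))) =
  path_class (punctured K) (polygon u0 (map (fun v => v 1) V)).
Proof.
move=> cV pV lV.
have cu : {within unit_itv, continuous (fun _ : R => u0)}.
  by apply: continuous_subspaceT => x; exact: cvg_cst.
apply: (transport_loops G (polygon_family cu cV)) => /=.
  move=> s t Is It; have [_ /(_ t It)[h1 h2]] := is_path_polygon (pV s).
  by split=> // i e; apply: h2; exists i.
by move=> s _; rewrite polygon0 polygon1.
Qed.

End gbase_action.

Section gbase_polygons.
Variable R : realType.
Local Notation C := (R * R)%type.
Local Notation disk := (@disk R).
Local Notation u0 := (u0 R).
Local Notation emb := (@emb R).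
Local Notation zr := (@zr R).
Local Notation M := (model_config R).
Local Notation K := (K_config R).

Lemma static_zclass (G : realization (gbase_motion R)) L :
  polygon_free sweep1 zu0 L -> polygon_free sweep2 zu0 L -> last zu0 L = zu0 ->
  pi1_map (induced_diffeo G) (zclass M L) = zclass K L.
Proof.
move=> f1 f2 lL; pose V : seq (R -> C) := map (fun z _ => emb z) L.
have VE s : map (fun v => v s) V = map emb L by rewrite /V -map_comp.
have := transport_polygons G (V := V); rewrite !VE; apply.
- rewrite /V => v; elim: (L) => [//|z L' IH] /= [<-|/IH //].
  by apply: continuous_subspaceT => x; exact: cvg_cst.
- move=> s; rewrite VE -emb_u0.
  by have [c|c] := gbase_sweep s; exact: (polygon_free_emb c).
- by move=> s; rewrite VE -emb_u0 last_map lL.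
Qed.

Definition separated (n p a b : C) : Prop := dot n p < dot n a /\ dot n p < dot n b.

(** The four fixed points lie on a segment, so one normal that separates its ends separates them
    all; each moving point has its own normal. *)
Lemma edge_avoids (s cx dx dy : R) (n1 n2 n3 a b : C) :
  (forall i : 'I_6, gbase_fun i s =
    nth u0 [:: (- 1, 0); (0, 0); (1, 0); (2, 0); (cx - dx, - dy); (cx + dx, dy)] i) ->
  disk a -> disk b -> separated n1 (- 1, 0) a b -> separated n1 (2, 0) a b ->
  separated n2 (cx - dx, - dy) a b -> separated n3 (cx + dx, dy) a b ->
  hull [:: a; b] `<=` disk `\` range (fun i => gbase_fun i s).
Proof.
move=> gE da db [h1 h1'] [h2 h2'] [h3 h3'] [h4 h4']; apply: hull_avoids.
  by move=> x; rewrite in_cons mem_seq1 => /orP[]/eqP->.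
have two (n p : C) : dot n p < dot n a -> dot n p < dot n b ->
    exists n, forall x, x \in [:: a; b] -> dot n p < dot n x.
  by move=> pa pb; exists n => x; rewrite in_cons mem_seq1 => /orP[]/eqP->.
move: h1 h1' h2 h2'; rewrite /dot /= => h1 h1' h2 h2'.
move=> _ [i _ <-]; rewrite gE; case: i => [[|[|[|[|[|[|//]]]]]] ?].
- by apply: (two n1 (- 1, 0)); rewrite /dot /=; lra.
- by apply: (two n1 (0, 0)); rewrite /dot /=; lra.
- by apply: (two n1 (1, 0)); rewrite /dot /=; lra.
- by apply: (two n1 (2, 0)); rewrite /dot /=; lra.
- exact: two h3 h3'.
- exact: two h4 h4'.
Qed.

Lemma disk_box (x y : R) : - 1 <= x <= 15 / 4 -> - (6 / 5) <= y <= 6 / 5 -> disk (x, y).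
Proof.
by rewrite /Defs.disk /normsq /= => /andP[h1 h2] /andP[h3 h4]; nra.
Qed.

Let i5 : 'I_6 := @Ordinal 6 4 isT.
Let i6 : 'I_6 := @Ordinal 6 5 isT.

Lemma gbase_fun0 : gbase_fun i5 (0 : R) = (5 / 2, 0) /\ gbase_fun i6 (0 : R) = (7 / 2, 0).
Proof.
by rewrite /gbase_fun /= !stage0 !mulr0 rot0; split; apply: pair_eq; rewrite /=; lra.
Qed.

Lemma gbase_fun1 : gbase_fun i5 (1 : R) = (0, - 1) /\ gbase_fun i6 (1 : R) = (0, 1).
Proof.
rewrite /gbase_fun /= !stage1// !mulr1 rot_pihalf.
by split; apply: pair_eq; rewrite /=; lra.
Qed.

Definition shifted (i : 'I_6) (x y t : R) : C := gbase_fun i t + (x, y).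

Lemma shifted_continuous i x y : {within unit_itv, continuous (shifted i x y)}.
Proof. by move=> t; apply: cvgD; [exact: gbase_continuous|exact: cvg_cst]. Qed.

Lemma cst_continuous (p : C) : {within unit_itv, continuous (fun _ : R => p)}.
Proof. by apply: continuous_subspaceT => x; exact: cvg_cst. Qed.

Definition moving5 : seq (R -> C) :=
  [:: shifted i5 (- (1 / 8)) (- (1 / 5)); shifted i5 (1 / 5) (- (1 / 8));
      shifted i5 (1 / 8) (1 / 5); shifted i5 (- (1 / 5)) (1 / 8);
      shifted i5 (- (1 / 8)) (- (1 / 5)); fun=> u0].

Lemma moving5_free (s : R) :
  polygon_in (disk `\` range (fun i => gbase_fun i s)) u0 (map (fun v => v s) moving5).
Proof.
have [cx [dx [dy [gE h]]]] := gbase_position s.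
rewrite /= /shifted gE /=.
have edge (n1 n2 n3 a b : C) := @edge_avoids s cx dx dy n1 n2 n3 a b gE.
have du : disk u0 by exact/circle_disk/circle_u0.
have dbox (x y : R) : - (1 / 5) <= x <= 1 / 5 -> - (1 / 5) <= y <= 1 / 5 ->
    disk ((cx - dx, - dy) + (x, y)).
  move=> /andP[x1 x2] /andP[y1 y2].
  case: h => [[h1 /andP[h2 h3] /andP[h4 h5] h6]|[h1 h2 /andP[h3 h4]]];
    apply: disk_box; apply/andP; split; rewrite /=; lra.
have d1 := dbox (- (1 / 8)) (- (1 / 5)).
have d2 := dbox (1 / 5) (- (1 / 8)).
have d3 := dbox (1 / 8) (1 / 5).
have d4 := dbox (- (1 / 5)) (1 / 8).
have {}d1 := d1 ltac:(apply/andP; split; lra) ltac:(apply/andP; split; lra).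
have {}d2 := d2 ltac:(apply/andP; split; lra) ltac:(apply/andP; split; lra).
have {}d3 := d3 ltac:(apply/andP; split; lra) ltac:(apply/andP; split; lra).
have {}d4 := d4 ltac:(apply/andP; split; lra) ltac:(apply/andP; split; lra).
have X6 : hull [:: (cx - dx, - dy) + (- (1 / 8), - (1 / 5)); u0] `<=`
    disk `\` range (fun i => gbase_fun i s).
  by case: h => [[h1 /andP[h2 h3] /andP[h4 h5] h6]|[h1 h2 /andP[h3 h4]]];
    apply: (edge (0, - 1) (0, - 1) (0, - 1)) => //; rewrite /separated /dot /=; split; lra.
have Xu : (disk `\` range (fun i => gbase_fun i s)) u0.
  by apply: X6; apply: hull_mem; rewrite !inE eqxx orbT.
case: h => [[h1 /andP[h2 h3] /andP[h4 h5] h6]|[h1 h2 /andP[h3 h4]]].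
(* The second normals are the outward normals of the small square around the fifth point. The third,
   (-1, -1), uses that the sixth point exceeds the fifth by 2 (dx + dy) >= 1 in the sum of
   coordinates. The fixed points lie to the left here, and above during the last stage. *)
- split; [apply: (edge (0, - 1) (0, - 1) (0, - 1)) => //
  |split; [apply: (edge (1, 0) (3, - 13) (- 1, - 1)) => //
  |split; [apply: (edge (1, 0) (13, 3) (- 1, - 1)) => //
  |split; [apply: (edge (1, 0) (- 3, 13) (- 1, - 1)) => //
  |split; [apply: (edge (1, 0) (- 13, - 3) (- 1, - 1)) => //|split=> //]]]]];
  by rewrite /separated /dot /=; clear - h1 h2 h3 h4 h5 h6; split; lra.
- split; [apply: (edge (0, - 1) (0, - 1) (0, - 1)) => //
  |split; [apply: (edge (0, - 1) (3, - 13) (- 1, - 1)) => //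
  |split; [apply: (edge (0, - 1) (13, 3) (- 1, - 1)) => //
  |split; [apply: (edge (0, - 1) (- 3, 13) (- 1, - 1)) => //
  |split; [apply: (edge (0, - 1) (- 13, - 3) (- 1, - 1)) => //|split=> //]]]]];
  by rewrite /separated /dot /=; clear - h1 h2 h3 h4; split; lra.
Qed.

Definition moving6 : seq (R -> C) :=
  [:: fun=> (3, - 2); fun=> (15 / 4, 0);
      shifted i6 (1 / 5) (- (7 / 40)); shifted i6 (7 / 40) (1 / 5);
      shifted i6 (- (1 / 5)) (7 / 40); shifted i6 (- (7 / 40)) (- (1 / 5));
      shifted i6 (1 / 5) (- (7 / 40)); fun=> (15 / 4, 0); fun=> (3, - 2); fun=> u0].

Lemma moving6_free (s : R) :
  polygon_in (disk `\` range (fun i => gbase_fun i s)) u0 (map (fun v => v s) moving6).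
Proof.
have [cx [dx [dy [gE h]]]] := gbase_position s.
rewrite /= /shifted gE /=.
have edge (n1 n2 n3 a b : C) := @edge_avoids s cx dx dy n1 n2 n3 a b gE.
have du : disk u0 by exact/circle_disk/circle_u0.
have dq : disk (3 : R, - 2 : R) by rewrite /Defs.disk /normsq /=; lra.
have dr : disk (15 / 4 : R, 0 : R) by rewrite /Defs.disk /normsq /=; lra.
have dbox (x y : R) : - (1 / 5) <= x <= 1 / 5 -> - (1 / 5) <= y <= 1 / 5 ->
    disk ((cx + dx, dy) + (x, y)).
  move=> /andP[x1 x2] /andP[y1 y2].
  case: h => [[h1 /andP[h2 h3] /andP[h4 h5] h6]|[h1 h2 /andP[h3 h4]]];
    apply: disk_box; apply/andP; split; rewrite /=; lra.
have d1 := dbox (1 / 5) (- (7 / 40)).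
have d2 := dbox (7 / 40) (1 / 5).
have d3 := dbox (- (1 / 5)) (7 / 40).
have d4 := dbox (- (7 / 40)) (- (1 / 5)).
have {}d1 := d1 ltac:(apply/andP; split; lra) ltac:(apply/andP; split; lra).
have {}d2 := d2 ltac:(apply/andP; split; lra) ltac:(apply/andP; split; lra).
have {}d3 := d3 ltac:(apply/andP; split; lra) ltac:(apply/andP; split; lra).
have {}d4 := d4 ltac:(apply/andP; split; lra) ltac:(apply/andP; split; lra).
have X9 : hull [:: (3 : R, - 2 : R); u0] `<=`
    disk `\` range (fun i => gbase_fun i s).
  by case: h => [[h1 /andP[h2 h3] /andP[h4 h5] h6]|[h1 h2 /andP[h3 h4]]];
    apply: (edge (0, - 1) (0, - 1) (0, - 1)) => //; rewrite /separated /dot /=; split; lra.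
have Xu : (disk `\` range (fun i => gbase_fun i s)) u0.
  by apply: X9; apply: hull_mem; rewrite !inE eqxx orbT.
case: h => [[h1 /andP[h2 h3] /andP[h4 h5] h6]|[h1 h2 /andP[h3 h4]]].
(* (2, -3/4) is normal to the edge from (3, -2) to (15/4, 0), which has every point on its left. In
   the last stage (1, 10) replaces (1, 0) on the edge joining (15/4, 0) to the square, which travels
   left above the fixed points. *)
- split; [apply: (edge (0, - 1) (0, - 1) (0, - 1)) => //
  |split; [apply: (edge (2, - (3 / 4)) (2, - (3 / 4)) (2, - (3 / 4))) => //
  |split; [apply: (edge (1, 0) (1, 1) (1, 0)) => //
  |split; [apply: (edge (1, 0) (1, 1) (15, 1)) => //
  |split; [apply: (edge (1, 0) (1, 1) (- 1, 15)) => //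
  |split; [apply: (edge (1, 0) (1, 1) (- 15, - 1)) => //
  |split; [apply: (edge (1, 0) (1, 1) (1, - 15)) => //
  |split; [apply: (edge (1, 0) (1, 1) (1, 0)) => //
  |split; [apply: (edge (2, - (3 / 4)) (2, - (3 / 4)) (2, - (3 / 4))) => //
  |split=> //]]]]]]]]];
  by rewrite /separated /dot /=; clear - h1 h2 h3 h4 h5 h6; split; lra.
- split; [apply: (edge (0, - 1) (0, - 1) (0, - 1)) => //
  |split; [apply: (edge (2, - (3 / 4)) (2, - (3 / 4)) (2, - (3 / 4))) => //
  |split; [apply: (edge (1, 10) (1, 1) (1, 0)) => //
  |split; [apply: (edge (0, 1) (1, 1) (15, 1)) => //
  |split; [apply: (edge (0, 1) (1, 1) (- 1, 15)) => //
  |split; [apply: (edge (0, 1) (1, 1) (- 15, - 1)) => //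
  |split; [apply: (edge (0, 1) (1, 1) (1, - 15)) => //
  |split; [apply: (edge (1, 10) (1, 1) (1, 0)) => //
  |split; [apply: (edge (2, - (3 / 4)) (2, - (3 / 4)) (2, - (3 / 4))) => //
  |split=> //]]]]]]]]];
  by rewrite /separated /dot /=; clear - h1 h2 h3 h4; split; lra.
Qed.

End gbase_polygons.

(** * The relations *)

Section relations_modulo.
Local Open Scope group_scope.
Variables (G : groupType) (N : set G).
Hypothesis nN : normal_subgroup N.

Definition eqmod (u v : G) : Prop := N (u * v^-1).
Local Notation "u =N v" := (eqmod u v) (at level 70).

Lemma eqmod_refl u : u =N u.
Proof. by case: nN => N1 _ _ _; rewrite /eqmod mulgV. Qed.

Lemma eqmod_sym u v : u =N v -> v =N u.
Proof. by case: nN => _ _ NV _ /NV; rewrite /eqmod invgM invgK. Qed.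

Lemma eqmod_trans v u w : u =N v -> v =N w -> u =N w.
Proof. by case: nN => _ NM _ _ uv vw; have := NM _ _ uv vw; rewrite /eqmod mulgA mulgVK. Qed.

Lemma eqmodM u u' v v' : u =N u' -> v =N v' -> u * v =N u' * v'.
Proof.
case: nN => _ NM _ NJ uu vv; have := NM _ _ (NJ _ u^-1 vv) uu.
by rewrite /eqmod invgK invgM !mulgA mulgVK.
Qed.

Lemma eqmodMl w u v : u =N v -> w * u =N w * v.
Proof. exact/eqmodM/eqmod_refl. Qed.

Lemma eqmodMr w u v : u =N v -> u * w =N v * w.
Proof. by move=> uv; apply: eqmodM => //; exact: eqmod_refl. Qed.

Lemma eqmod_cancelr w u v : u * w =N v * w -> u =N v.
Proof. by move=> /(eqmodMr w^-1); rewrite !mulgK. Qed.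

Lemma eqmod_conj w u v : w * u * w^-1 =N v <-> w * u =N v * w.
Proof.
split=> [/(eqmodMr w)|uv]; first by rewrite mulgVK.
by apply: (@eqmod_cancelr w); rewrite mulgVK.
Qed.

Variables x1 x2 x3 x4 x5 x6 : G.
Let w := x5 * x4 * x3 * x2.
Let t := w * x5 * x4 * x3.

Let T1 := w =N x2 * x5 * x4 * x3.
Let T2 := x3 * w * x5 * x4 =N t.
Let T2' := t =N x4 * x3 * w * x5.
Let T3 := x1 =N x5 * x4 * x3 * x4^-1 * x5^-1.
Let T4 := x5 =N x6.

Lemma commute_relation :
  (x5 * x4 * x3) * x2 * (x5 * x4 * x3)^-1 =N x2 <-> T1.
Proof. by rewrite eqmod_conj /T1 /w !mulgA. Qed.

Lemma x1x5 : T3 -> x1 * x5 =N x5 * x4 * x3 * x4^-1.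
Proof. by move=> /(eqmodMr x5); rewrite mulgVK. Qed.

(** The form in which relation (3) is used: it turns w x1 x5 x4 into [t]. *)
Lemma x1x5x4 : T3 -> x1 * x5 * x4 =N x5 * x4 * x3.
Proof. by move=> /x1x5 /(eqmodMr x4); rewrite mulgVK. Qed.

(** Written as w x1 = x3 w and multiplied on the right by x5 x4, the left side becomes [t]. *)
Lemma third_relation : T3 -> (w * x1 * w^-1 =N x3 <-> T2).
Proof.
move=> /x1x5x4 h; rewrite eqmod_conj /T2.
have h' : w * x1 * x5 * x4 =N t by have := eqmodMl w h; rewrite /t !mulgA.
split=> [/(eqmodMr x5) /(eqmodMr x4) k|k].
  by apply: eqmod_trans h'; apply: eqmod_sym.
apply/(@eqmod_cancelr x5)/(@eqmod_cancelr x4).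
exact: eqmod_trans h' (eqmod_sym k).
Qed.

(** Clear the conjugation and multiply by x5 on the right: the left side becomes [t], the right side
    x4 t x4^-1, which (2) turns into x4 x3 w x5. *)
Lemma fourth_relation : T3 -> T2 ->
  ((w * x1) * (x5 * x4 * x5^-1) * (w * x1)^-1 =N x4 <-> T2').
Proof.
move=> h3 h2; rewrite eqmod_conj /T2'.
have l : w * x1 * (x5 * x4 * x5^-1) * x5 =N t.
  by have := eqmodMl w (x1x5x4 h3); rewrite /t !mulgA mulgVK.
have r : x4 * (w * x1) * x5 =N x4 * x3 * w * x5.
  apply: (@eqmod_trans (x4 * t * x4^-1)).
    by have := eqmodMl (x4 * w) (x1x5 h3); rewrite /t !mulgA.
  by have := eqmodMr x4^-1 (eqmodMl x4 (eqmod_sym h2)); rewrite !mulgA mulgK.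
split=> [/(eqmodMr x5) k|k].
  exact: eqmod_trans (eqmod_sym l) (eqmod_trans k r).
apply: (@eqmod_cancelr x5).
exact: eqmod_trans l (eqmod_trans k (eqmod_sym r)).
Qed.

Lemma sixth_relation : T1 -> T2' -> T3 -> T4 ->
  (x6 * w * x1) * (x5 * x4 * x5 * x4^-1 * x5^-1) * (x6 * w * x1)^-1 =N x6.
Proof.
move=> h1 h2 h3 h4; apply/eqmod_conj.
(* By (1), t x5 is x5 x4 x3 w x5, and (2) recognizes x4 x3 w x5 as [t]. This commutation is all that
   the sixth image requires beyond (3) and (4). *)
have wt : t * x5 =N x5 * t.
  apply: (@eqmod_trans (x5 * (x4 * x3 * w * x5))); last first.
    exact: eqmodMl (eqmod_sym h2).
  have := eqmodMl (x5 * x4 * x3) (eqmodMr x5 (eqmod_sym h1)).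
  by have := eqmodMr (x5 * x4 * x3 * x5) h1; rewrite /t /w !mulgA.
have k : w * x1 * (x5 * x4 * x5 * x4^-1 * x5^-1) =N x5 * w * x1.
  apply/(@eqmod_cancelr x5)/(@eqmod_cancelr x4); rewrite !mulgA !mulgVK.
  have h : w * x1 * x5 * x4 =N t.
    by have := eqmodMl w (x1x5x4 h3); rewrite /t !mulgA.
  apply: (@eqmod_trans (t * x5)); first exact: eqmodMr.
  apply: (eqmod_trans wt).
  by have := eqmodMl x5 (eqmod_sym h); rewrite !mulgA.
have := eqmodMl x6 (eqmod_trans k (eqmodMr x1 (eqmodMr w h4))).
by rewrite !mulgA.
Qed.

End relations_modulo.

(* Loops homotopic to [end_polygons], made of edges of known image under the twist. *)
Definition axial_polygons : seq (seq zpt) :=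
  [:: [:: (0, -140); (0, -70); (0, -60); (-24, -50); (-20, -20); (-20, 20); (-54, 20);
          (-54, -20); (-24, -50); (0, -60); (0, -70); (0, -140); (0, -160)];
      [:: (0, -140); (0, -70); (0, -60); (-24, -50); (-20, -20); (20, -20); (20, 20);
          (-20, 20); (-20, -20); (-24, -50); (0, -60); (0, -70); (0, -140); (0, -160)];
      [:: (0, -140); (0, -70); (0, -60); (-24, -50); (-20, -20); (20, -20); (55, -20);
          (55, 20); (20, 20); (20, -20); (-20, -20); (-24, -50); (0, -60); (0, -70);
          (0, -140); (0, -160)];
      [:: (0, -140); (0, -70); (0, -60); (-24, -50); (-20, -20); (20, -20); (24, -50);
          (0, -60); (0, -70); (0, -100); (100, -40); (100, 40); (70, 40); (70, -40);
          (0, -100); (0, -70); (0, -60); (24, -50); (20, -20); (-20, -20); (-24, -50);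
          (0, -60); (0, -70); (0, -140); (0, -160)];
      [:: (0, -140); (0, -70); (0, -60); (24, -50); (20, -20); (-20, -20); (-24, -50);
          (0, -60); (0, -70); (0, -140); (0, -160)];
      [:: (0, -140); (0, -100); (100, -40); (100, 40); (0, 100); (0, 70); (0, 60);
          (-24, 50); (-20, 20); (20, 20); (24, 50); (0, 60); (0, 70); (0, 100);
          (100, 40); (100, -40); (0, -100); (0, -140); (0, -160)]]%binz.

(* The letter [(false, j)] stands for the (j+1)-st generator, [(true, j)] for its
   inverse. *)
Definition beta_words : seq (seq (bool * nat)) :=
  let x j := (false, j.-1) in let y j := (true, j.-1) in
  [:: [:: x 5; x 4; x 3; y 4; y 5];
      [:: x 5; x 4; x 3; x 2; y 3; y 4; y 5];
      [:: x 5; x 4; x 3; x 2; x 1; y 2; y 3; y 4; y 5];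
      [:: x 5; x 4; x 3; x 2; x 1; x 5; x 4; y 5; y 1; y 2; y 3; y 4; y 5];
      [:: x 6];
      [:: x 6; x 5; x 4; x 3; x 2; x 1; x 5; x 4; x 5; y 4; y 5;
          y 1; y 2; y 3; y 4; y 5; y 6]]%N.

Definition end_polygon (j : nat) : seq zpt := nth [::] end_polygons j.

Definition letter_polygon (l : bool * nat) : seq zpt :=
  if l.1 then rev_polygon (end_polygon l.2) else end_polygon l.2.

Definition word_polygon (w : seq (bool * nat)) : seq zpt := flatten (map letter_polygon w).

(** * Finite verifications *)

Lemma start_polygons_check : all (fun j => same_loop model_points
    (lasso_polygon (nth 0%binz model_abscissas j)) (nth [::] start_polygons j)) (iota 0 6).
Proof. by vm_compute. Qed.

Lemma static_polygons_check :
  all (fun L => polygon_free sweep1 zu0 L && polygon_free sweep2 zu0 L) static_polygons.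
Proof. by vm_compute. Qed.

(** Comparing a loop with itself certifies that it is a loop and that its reversed polygon
    represents the inverse, which is needed for the inverse letters. *)
Lemma end_polygons_check : all (fun L => same_loop K_points L L) end_polygons.
Proof. by vm_compute. Qed.

Lemma axial_polygons_check : all (fun j =>
    same_loop K_points (nth [::] axial_polygons j) (end_polygon j)) (iota 0 6).
Proof. by vm_compute. Qed.

Lemma beta_words_check : all (fun j =>
    if twist_polygon zu0 (nth [::] axial_polygons j) is Some L
    then same_loop K_points (word_polygon (nth [::] beta_words j)) L else false) (iota 0 6).
Proof. by vm_compute. Qed.

Lemma same_loop_is_zloop Bs L L' : same_loop Bs L L' ->
  [/\ is_zloop Bs L, is_zloop Bs L' & is_zloop Bs (rev_polygon L)].
Proof. by move=> /and5P[]. Qed.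

(** * Generators and their images as words *)

Section generators.
Variable R : realType.
Local Notation C := (R * R)%type.
Local Notation u0 := (u0 R).
Local Notation emb := (@emb R).
Local Notation zr := (@zr R).
Local Notation M := (model_config R).
Local Notation K := (K_config R).

Lemma gbase_zclass (G : realization (gbase_motion R)) (j : 'I_6) :
  pi1_map (induced_diffeo G) (zclass M (nth [::] start_polygons j)) =
  zclass K (end_polygon j).
Proof.
have static (i : nat) : (i < 4)%N ->
    pi1_map (induced_diffeo G) (zclass M (nth [::] static_polygons i)) =
    zclass K (nth [::] static_polygons i).
  move=> i4; have /allP/(_ _ (mem_nth [::] (i4 : i < size static_polygons)%N))/andP[f1 f2] := static_polygons_check.
  by apply: static_zclass => //; case: i i4 {f1 f2} => [|[|[|[|//]]]].
case: j => [[|[|[|[|[|[|//]]]]]] ?].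
- exact: (static 0).
- exact: (static 1).
- exact: (static 2).
- exact: (static 3).
- have [g0 _] := @gbase_fun0 R; have [g1 _] := @gbase_fun1 R.
  have := transport_polygons G (V := moving5 R) _ (@moving5_free R) (fun=> erefl).
  rewrite /zclass (_ : map _ (moving5 R) = map emb (polygon5 (100, 0)%binz)); last first.
    by do !(congr cons; first by apply: pair_eq;
      rewrite /shifted ?g0 /emb /=; zr_eval; lra).
  rewrite (_ : map _ (moving5 R) = map emb (polygon5 (0, -40)%binz)); last first.
    by do !(congr cons; first by apply: pair_eq;
      rewrite /shifted ?g1 /emb /=; zr_eval; lra).
  apply => v; do !(case=> [<-|]; first exact: shifted_continuous).
  by case=> [<-|//]; exact: cst_continuous.
- have [_ g0] := @gbase_fun0 R; have [_ g1] := @gbase_fun1 R.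
  have := transport_polygons G (V := moving6 R) _ (@moving6_free R) (fun=> erefl).
  rewrite /zclass (_ : map _ (moving6 R) = map emb (polygon6 (140, 0)%binz)); last first.
    by do !(congr cons; first by apply: pair_eq;
      rewrite /shifted ?g0 /emb /=; zr_eval; lra).
  rewrite (_ : map _ (moving6 R) = map emb (polygon6 (0, 40)%binz)); last first.
    by do !(congr cons; first by apply: pair_eq;
      rewrite /shifted ?g1 /emb /=; zr_eval; lra).
  by apply => v; do !(case=> [<-|]; first by
    (exact: shifted_continuous || exact: cst_continuous)).
Qed.

Lemma generator_zclass (G : realization (gbase_motion R)) (j : 'I_6) :
  pi1_map (induced_diffeo G) (loop_class (model_loop R j)) = zclass K (end_polygon j).
Proof.
rewrite lasso_zclass -(gbase_zclass G); congr (pi1_map _ _).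
apply: (zclass_same (@covers_model R)).
have /allP := start_polygons_check; apply.
by rewrite mem_iota /= ltn_ord.
Qed.

Definition letter_value (x : nat -> pi1 R (punctured K)) (l : bool * nat) :=
  (if l.1 then (x l.2)^-1 else x l.2)%g.

Definition word_value (x : nat -> pi1 R (punctured K)) (w : seq (bool * nat)) :=
  foldr (fun l g => letter_value x l * g)%g 1%g w.

Lemma letter_zclass l : (l.2 < 6)%N -> is_zloop K_points (letter_polygon l) /\
  zclass K (letter_polygon l) = letter_value (fun j => zclass K (end_polygon j)) l.
Proof.
move=> l6; have /allP/(_ _ (mem_nth [::] (l6 : l.2 < size end_polygons)%N)) := end_polygons_check.
rewrite -/(end_polygon _) => s; have /and5P[_ _ lr n _] := s.
have [lL _ _] := same_loop_is_zloop s.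
rewrite /letter_polygon /letter_value; case: l.1 => //; split=> //.
have := zclass_null (@covers_K R) (is_zloop_cat lL lr) n.
by rewrite (zclass_cat (@covers_K R) lL lr) => /mulg1_eq ->.
Qed.

Lemma word_zclass w : w != [::] -> all (fun l => l.2 < 6)%N w ->
  is_zloop K_points (word_polygon w) /\
  zclass K (word_polygon w) = word_value (fun j => zclass K (end_polygon j)) w.
Proof.
elim: w => [//|l [|l' w] IH] _ /andP[/letter_zclass[z1 z2] wl].
  by rewrite /word_polygon /= cats0 z2 mulg1.
have [z3 z4] := IH isT wl; split; first exact: is_zloop_cat.
rewrite -[word_polygon _]/(letter_polygon l ++ word_polygon (l' :: w)).
by rewrite (zclass_cat (@covers_K R)) // z2 z4.
Qed.

(** The generator is first deformed to its axial polygon, the only form whose twisted image is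
    computed; that image is then compared with the polygon of the word. *)
Lemma beta_generator (B : realization (beta_motion R)) (j : 'I_6) :
  pi1_map (induced_diffeo B) (zclass K (end_polygon j)) =
  word_value (fun j => zclass K (end_polygon j)) (nth [::] beta_words j).
Proof.
have j6 : (j : nat) \in iota 0 6 by rewrite mem_iota /= ltn_ord.
have /allP/(_ _ j6) s := axial_polygons_check.
rewrite -(zclass_same (@covers_K R) s).
have /allP/(_ _ j6) := beta_words_check.
case E : twist_polygon => [L|//] s'.
have [lL _ _] := same_loop_is_zloop s.
rewrite (beta_zclass B lL E) -(zclass_same (@covers_K R) s').
by apply: (word_zclass _ _).2; case: (j) => [[|[|[|[|[|[|//]]]]]] ?].
Qed.

End generators.

(** * Comparison of normal closures *)

Section normal_closures.
Variable G : groupType.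
Implicit Types (S : set (G * G)) (N : set G).

Lemma normal_closure_normal S : normal_subgroup (normal_closure S).
Proof.
split.
- by move=> N [[]].
- by move=> a b Sa Sb N SN; have [[_ NM _ _] _] := SN; apply: NM; [exact: Sa|exact: Sb].
- by move=> a Sa N SN; have [[_ _ NV _] _] := SN; apply: NV; exact: Sa.
- by move=> a g Sa N SN; have [[_ _ _ NJ] _] := SN; apply: NJ; exact: Sa.
Qed.

Lemma normal_closure_eqmod S r : S r -> eqmod (normal_closure S) r.1 r.2.
Proof. by move=> Sr N [_]; apply; exists r. Qed.

Lemma normal_closure_subset S N : normal_subgroup N ->
  (forall r, S r -> eqmod N r.1 r.2) -> normal_closure S `<=` N.
Proof. by move=> nN SN g; apply; split=> // _ [r Sr <-]; exact: SN. Qed.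

(** A normal closure is determined by the normal subgroups that contain its relators; this reduces
    the theorem to equations modulo an arbitrary N. *)
Lemma eq_normal_closure S S' :
  (forall N, normal_subgroup N ->
     (forall r, S r -> eqmod N r.1 r.2) <-> (forall r, S' r -> eqmod N r.1 r.2)) ->
  normal_closure S = normal_closure S'.
Proof.
move=> SS'; apply/seteqP; split; apply: normal_closure_subset;
  try exact: normal_closure_normal.
  by apply/(SS' _ (normal_closure_normal _)) => r; exact: normal_closure_eqmod.
by apply/(SS' _ (normal_closure_normal _)) => r; exact: normal_closure_eqmod.
Qed.

End normal_closures.

Theorem corollary5p6 (R : realType)
    (G : realization (gbase_motion R)) (B : realization (beta_motion R)) :
  let x (j : 'I_6) : pi1 R (punctured (K_config R)) :=
    pi1_map (induced_diffeo G) (loop_class (model_loop R j)) in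
  let beta : pi1 R (punctured (K_config R)) -> pi1 R (punctured (K_config R)) :=
    pi1_map (induced_diffeo B) in
  let x1 := x (inord 0) in let x2 := x (inord 1) in let x3 := x (inord 2) in
  let x4 := x (inord 3) in let x5 := x (inord 4) in let x6 := x (inord 5) in
  normal_closure [set (beta (x j), x j) | j in [set: 'I_6]] =
  normal_closure
    [set (x5 * x4 * x3 * x2, x2 * x5 * x4 * x3);
         (x3 * x5 * x4 * x3 * x2 * x5 * x4, x5 * x4 * x3 * x2 * x5 * x4 * x3);
         (x5 * x4 * x3 * x2 * x5 * x4 * x3, x4 * x3 * x5 * x4 * x3 * x2 * x5);
         (x1, x5 * x4 * x3 * x4^-1 * x5^-1);
         (x5, x6)]%g.
Proof.
move=> x beta x1 x2 x3 x4 x5 x6.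
have xE (j : 'I_6) : x j = zclass (K_config R) (end_polygon j).
  exact: generator_zclass.
pose X (k : nat) := x (inord k).
have bE (j : 'I_6) : beta (x j) = word_value X (nth [::] beta_words j).
  rewrite xE /beta beta_generator; set w := nth _ _ _.
  (* Below 6, [inord] returns the index itself, so the letters really denote the generators. *)
  have : all (fun l => l.2 < 6)%N w.
    by rewrite /w; case: (j) => [[|[|[|[|[|[|//]]]]]] ?].
  elim: w => [//|l w IH] /= /andP[l6 /IH ->]; congr (_ * _)%g.
  by rewrite /letter_value /X xE inordK.
have b1 : beta x1 = (x5 * x4 * x3 * x4^-1 * x5^-1)%g.
  by rewrite /x1 bE inordK//= mulg1 !mulgA.
have b2 : beta x2 = ((x5 * x4 * x3) * x2 * (x5 * x4 * x3)^-1)%g.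
  by rewrite /x2 bE inordK//= mulg1 !invgM !mulgA.
have b3 : beta x3 = ((x5 * x4 * x3 * x2) * x1 * (x5 * x4 * x3 * x2)^-1)%g.
  by rewrite /x3 bE inordK//= mulg1 !invgM !mulgA.
have b4 : beta x4 = (((x5 * x4 * x3 * x2) * x1) * (x5 * x4 * x5^-1) *
    ((x5 * x4 * x3 * x2) * x1)^-1)%g.
  by rewrite /x4 bE inordK//= mulg1 !invgM !mulgA.
have b5 : beta x5 = x6 by rewrite /x5 bE inordK//= mulg1.
have b6 : beta x6 = ((x6 * (x5 * x4 * x3 * x2) * x1) *
    (x5 * x4 * x5 * x4^-1 * x5^-1) * (x6 * (x5 * x4 * x3 * x2) * x1)^-1)%g.
  by rewrite /x6 bE inordK//= mulg1 !invgM !mulgA.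
(* From the images to the relations, the order matters: (3) comes from x1, it converts the image of
   x3, and both are needed to convert the image of x4. *)
apply: eq_normal_closure => N nN; split=> h.
  have bx j : eqmod N (beta (x j)) (x j) by apply: (h (_, _)); exists j.
  have t3 : eqmod N x1 (x5 * x4 * x3 * x4^-1 * x5^-1)%g.
    by rewrite -b1; apply: eqmod_sym => //; exact: bx.
  have t2 := bx (inord 2); rewrite -/x3 b3 in t2.
  have {}t2 := (third_relation nN x2 t3).1 t2.
  have t2' := bx (inord 3); rewrite -/x4 b4 in t2'.
  have {}t2' := (fourth_relation nN t3 t2).1 t2'.
  move=> r [[[[|]|]|]|] -> //=.
  - have := bx (inord 1); rewrite -/x2 b2 => /(commute_relation nN _ _ _ _).1.
    by [].
  - by rewrite !mulgA in t2 *.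
  - by rewrite !mulgA in t2' *.
  - by have := bx (inord 4); rewrite -/x5 b5; exact: eqmod_sym.
have t1 : eqmod N (x5 * x4 * x3 * x2)%g (x2 * x5 * x4 * x3)%g.
  by apply: (h (_, _)); do 4!left.
have t2 : eqmod N (x3 * (x5 * x4 * x3 * x2) * x5 * x4)%g
    (x5 * x4 * x3 * x2 * x5 * x4 * x3)%g.
  by rewrite !mulgA; apply: (h (_, _)); do 3!left; right.
have t2' : eqmod N (x5 * x4 * x3 * x2 * x5 * x4 * x3)%g
    (x4 * x3 * (x5 * x4 * x3 * x2) * x5)%g.
  by rewrite !mulgA; apply: (h (_, _)); do 2!left; right.
have t3 : eqmod N x1 (x5 * x4 * x3 * x4^-1 * x5^-1)%g.
  by apply: (h (_, _)); left; right.
have t4 : eqmod N x5 x6 by apply: (h (_, _)); right.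
have ordE (j : 'I_6) k : j = k :> nat -> j = inord k.
  by move=> jk; apply: val_inj; rewrite /= jk inordK// -jk.
move=> _ [j _ <-] /=.
have : (j : nat) \in iota 0 6 by rewrite mem_iota /= ltn_ord.
rewrite !in_cons in_nil => /or4P[/eqP/ordE->|/eqP/ordE->|/eqP/ordE->|].
- by rewrite -/x1 b1; exact: eqmod_sym.
- by rewrite -/x2 b2; apply/(commute_relation nN).
- by rewrite -/x3 b3; apply/(third_relation nN x2 t3).
case/or4P=> [/eqP/ordE->|/eqP/ordE->|/eqP/ordE->|//].
- by rewrite -/x4 b4; apply/(fourth_relation nN t3 t2).
- by rewrite -/x5 b5; exact: eqmod_sym.
- by rewrite -/x6 b6; exact: sixth_relation t1 t2' t3 t4.
Qed.
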